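(* There exists a unique solution to the semidiscrete control problem: there is exactly one $z_h\in\mathcal Z_{\mathrm{ad}}^h$ such that $j_h(z_h)=\min_{y\in\mathcal Z_{\mathrm{ad}}^h}j_h(y)$.
   Context: Setting. $\Omega\subset\mathbb R^d$ is a bounded Lipschitz domain with boundary $\Gamma$, partitioned into two non-overlapping relatively open sets $\Gamma_D,\Gamma_N$ ($\Gamma_D=\emptyset$ is allowed), and $T>0$. $A:B$ is the Frobenius product of matrices and $\mathbb R^{d\times d}_{\mathrm{sym}}$ the symmetric matrices. The coefficients $\mathcal C\in L^\infty(\Omega;\mathbb R^{(d\times d)\times(d\times d)})$, $\mathcal E\in L^\infty(\Omega;\mathbb R^{(d\times d)\times d})$, $\boldsymbol\kappa\in L^\infty(\Omega;\mathbb R^{d\times d}_{\mathrm{sym}})$ satisfy, a.e. in $\Omega$ and with constants $c_0,k_0>0$: $\mathcal CA\in\mathbb R^{d\times d}_{\mathrm{sym}}$ and $(\mathcal CA):B=A:(\mathcal CB)$ for all $A,B\in\mathbb R^{d\times d}$; $(\mathcal CA):A\ge c_0A:A$ for $A\in\mathbb R^{d\times d}_{\mathrm{sym}}$; $\mathcal E\mathbf b\in\mathbb R^{d\times d}_{\mathrm{sym}}$ and $(\boldsymbol\kappa\mathbf b)\cdot\mathbf b\ge k_0|\mathbf b|^2$ for $\mathbf b\in\mathbb R^d$. $\mathcal E^\top$ is defined by $(\mathcal E^\top A)\cdot\mathbf b=A:(\mathcal E\mathbf b)$. The density $\rho\in L^\infty(\Omega)$ is strictly positive ($\rho\ge\rho_0>0$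 a.e.). $\boldsymbol\varepsilon(\mathbf u)=\frac12(\nabla\mathbf u+\nabla\mathbf u^\top)$. Spaces. $(\cdot,\cdot)_\Omega$, $\|\cdot\|_\Omega$, $\|\cdot\|_\Gamma$ are $L^2$ inner product/norms on $\Omega$, $\Gamma$; $\|\cdot\|_\rho^2=(\rho\,\cdot,\cdot)_\Omega$; $\gamma$ is the trace operator to $\Gamma$; $\langle\cdot,\cdot\rangle_\Gamma$ is the $H^{-1/2}(\Gamma)\times H^{1/2}(\Gamma)$ duality, equal to the $L^2(\Gamma)$ product on $L^2(\Gamma)$ functions. $\mathbf H^1_D(\Omega)$ is the space of $\mathbf u\in H^1(\Omega)^d$ with zero trace on $\Gamma_D$ (all of $H^1(\Omega)^d$ if $\Gamma_D=\emptyset$). $G:H^1(\Omega)\to\mathbb R$ is linear, bounded, with $G1\ne0$; $H^1_G(\Omega)=\{\psi\in H^1(\Omega):G\psi=0\}$. $L^2_0(\Gamma)=\{z\in L^2(\Gamma):\int_\Gamma z=0\}$. $\mathcal Z=\{z\in H^1(0,T;L^2_0(\Gamma)):z(0)=0\}$ with norm $\left(\int_0^T\|\dot z(\tau)\|_\Gamma^2\,\mathrm d\tau\right)^{1/2}$. $\mathcal U=C^0([0,T];\mathbf H^1_D(\Omega))$. Semidiscretization. $\mathbf V_h\subset\mathbf H^1_D(\Omega)$ and $W_h\subset H^1(\Omega)$ are finite-dimensional subspaces, $W_h$ contains the constant functions, and $W_h^G=W_h\cap H^1_G(\Omega)$. With $a((\mathbf u,\psi),(\mathbf w,\varphi))=(\mathcal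 C\boldsymbol\varepsilon(\mathbf u)+\mathcal E\nabla\psi,\boldsymbol\varepsilon(\mathbf w))_\Omega+(-\mathcal E^\top\boldsymbol\varepsilon(\mathbf u)+\boldsymbol\kappa\nabla\psi,\nabla\varphi)_\Omega$, for $z\in\mathcal Z$ let $(\mathbf u_h,\psi_h)\in C^2([0,T];\mathbf V_h)\times C^0([0,T];W_h^G)$ be the unique solution of $$(\rho\ddot{\mathbf u}_h(t),\mathbf w)_\Omega+a((\mathbf u_h(t),\psi_h(t)),(\mathbf w,\varphi))=-\langle z(t),\gamma\varphi\rangle_\Gamma\quad\forall(\mathbf w,\varphi)\in\mathbf V_h\times W_h^G,\ \forall t\in[0,T],$$ $\mathbf u_h(0)=\dot{\mathbf u}_h(0)=\mathbf 0$; then $S_h:\mathcal Z\to C^0([0,T];\mathbf V_h)\subset\mathcal U$ is given by $S_hz=\mathbf u_h$. Semidiscrete control problem. $\Gamma_h$ is a (finite) partition of $\Gamma$ and $\mathcal P_0(\Gamma_h)$ the space of piecewise constant functions on $\Gamma_h$. $\mathcal Z_h=\{z\in\mathcal Z:z(t)\in\mathcal P_0(\Gamma_h)\ \forall t\}$; $\mathcal Z_{\mathrm{ad}}=\{z\in\mathcal Z:z_a\le z(t)\le z_b\text{ a.e. on }\Gamma,\ \forall t\in[0,T]\}$ with constants $z_a\le0\le z_b$; $\mathcal Z_{\mathrm{ad}}^h=\mathcal Z_h\cap\mathcal Z_{\mathrm{ad}}$. $\mathbf u_d\in\mathcal U$ is given with $\mathbf u_d(0)=\mathbf 0$, $\alpha>0$,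 and $$j_h(z)=\frac12\int_0^T\|S_hz(t)-\mathbf u_d(t)\|_\rho^2\,\mathrm dt+\frac\alpha2\int_0^T\|\dot z(t)\|_\Gamma^2\,\mathrm dt.$$ *)

(* Defs.v *)
From HB Require Import structures.
From mathcomp Require Import all_boot all_order all_algebra.
From mathcomp Require Import all_classical all_reals all_analysis.
Set Implicit Arguments.
Unset Strict Implicit.
Unset Printing Implicit Defensive.
Import Order.TTheory GRing.Theory Num.Theory.
Import numFieldNormedType.Exports.
Local Open Scope classical_set_scope.
Local Open Scope ring_scope.

Section OuterMeasures.
Variable R : realType.
Local Open Scope ereal_scope.

(* inf { \sum_k tau (F k) | A `<=` \bigcup_k F k }, where the F k are arbitrary
   sets: every subset of V is measurable for <<s setT >>. *)
Definition cover_outer (V : pointedType) (tau : set V -> \bar R)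
    (A : set V) : \bar R :=
  mu_ext (tau : set (g_sigma_algebraType [set: set V]) -> \bar R) A.

Section Lebesgue.
Variable d : nat.
Local Notation V := 'rV[R]_d.

Definition box (ab : V * V) : set V :=
  [set x | forall i, (ab.1 0 i <= x 0 i <= ab.2 0 i)%R].

(* Volume of the smallest box around U, +oo if U is unbounded. *)
Definition box_gauge (U : set V) : \bar R :=
  if U == set0 then 0 else
  ereal_inf [set (\prod_(i < d) (ab.2 0 i - ab.1 0 i))%:E
            | ab in [set ab : V * V |
                (forall i, ab.1 0 i <= ab.2 0 i)%R /\ U `<=` box ab]].

Definition lebesgue_outer (A : set V) : \bar R := cover_outer box_gauge A.

Definition enorm (x : V) : R := Num.sqrt (\sum_(i < d) x 0 i ^+ 2).

Definition diam (U : set V) : \bar R :=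
  ereal_sup [set (enorm (xy.1 - xy.2))%:E | xy in U `*` U].

End Lebesgue.

(* Volume of the Euclidean unit ball of R^n. *)
Definition unit_ball_volume (n : nat) : R :=
  fine (lebesgue_outer [set x : 'rV[R]_n | (enorm x <= 1)%R]).

Section Hausdorff.
Variable d : nat.
Local Notation V := 'rV[R]_d.

Definition hausdorff_gauge (n : nat) (delta : R) (U : set V) : \bar R :=
  if U == set0 then 0 else
  if diam U <= delta%:E
  then (unit_ball_volume n * (fine (diam U) / 2) ^+ n)%:E else +oo.

(* Normalized so as to agree with the n-dimensional area on n-dimensional
   Lipschitz graphs. *)
Definition hausdorff_outer (n : nat) (A : set V) : \bar R :=
  ereal_sup [set cover_outer (hausdorff_gauge n delta) A
            | delta in [set delta : R | (0 < delta)%R]].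

End Hausdorff.

Definition restr_outer (V : Type) (mu : set V -> \bar R) (D : set V)
  (A : set V) : \bar R := mu (A `&` D).

End OuterMeasures.

Section OuterMeasureInstances.
Variable R : realType.
Local Open Scope ereal_scope.

Section Cover.
Variables (V : pointedType) (tau : set V -> \bar R).
Hypotheses (tau0 : tau set0 = 0) (tau_ge0 : forall U, 0 <= tau U).

Lemma cover_outer0 : cover_outer tau set0 = 0.
Proof. exact: mu_ext0. Qed.

Lemma cover_outer_ge0 A : 0 <= cover_outer tau A.
Proof. exact: mu_ext_ge0. Qed.

Lemma le_cover_outer : {homo cover_outer tau : A B / A `<=` B >-> A <= B}.
Proof. by move=> A B AB; exact: (@le_mu_ext _ (g_sigma_algebraType setT)). Qed.

Lemma cover_outer_sigma_subadditive : sigma_subadditive (cover_outer tau).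
Proof.
exact: (@mu_ext_sigma_subadditive _ (g_sigma_algebraType [set: set V]) R tau
  tau_ge0).
Qed.

End Cover.

Section LebesgueInstance.
Variable d : nat.

Lemma box_gauge0 : box_gauge (@set0 'rV[R]_d) = 0.
Proof. by rewrite /box_gauge eqxx. Qed.

Lemma box_gauge_ge0 (U : set 'rV[R]_d) : 0 <= box_gauge U.
Proof.
rewrite /box_gauge; case: ifP => // _.
apply: le_ereal_inf_tmp => _ [ab [ab0 _] <-].
by rewrite lee_fin prodr_ge0// => i _; rewrite subr_ge0.
Qed.

HB.instance Definition _ := isOuterMeasure.Build R 'rV[R]_d
  (@lebesgue_outer R d) (cover_outer0 box_gauge0 box_gauge_ge0)
  (cover_outer_ge0 box_gauge_ge0)
  (@le_cover_outer _ _) (cover_outer_sigma_subadditive box_gauge_ge0).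

End LebesgueInstance.

Section HausdorffInstance.
Variables d n : nat.
Local Notation H := (@hausdorff_outer R d n).

Lemma hausdorff_gauge0 delta :
  hausdorff_gauge n delta (@set0 'rV[R]_d) = 0.
Proof. by rewrite /hausdorff_gauge eqxx. Qed.

Lemma hausdorff_gauge_ge0 delta (U : set 'rV[R]_d) :
  0 <= hausdorff_gauge n delta U.
Proof.
rewrite /hausdorff_gauge; case: ifPn => // U0; case: ifP => // _.
rewrite lee_fin mulr_ge0//.
  by rewrite /unit_ball_volume fine_ge0// outer_measure_ge0.
rewrite exprn_ge0// divr_ge0// fine_ge0//.
have /set0P[x Ux] := U0.
apply: (@le_trans _ _ (enorm (x - x))%:E); first by rewrite lee_fin sqrtr_ge0.
by apply: ereal_sup_ubound; exists (x, x).
Qed.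

Lemma le_hausdorff_pre delta A : (0 < delta)%R ->
  cover_outer (hausdorff_gauge n delta) A <= H A.
Proof. by move=> delta0; apply: ereal_sup_ubound; exists delta. Qed.

Lemma hausdorff_outer_ge0 A : 0 <= H A.
Proof.
apply: le_trans (le_hausdorff_pre A ltr01).
exact: cover_outer_ge0 (hausdorff_gauge_ge0 1) _.
Qed.

Lemma hausdorff_outer0 : H set0 = 0.
Proof.
apply/eqP; rewrite eq_le hausdorff_outer_ge0 andbT.
apply: ge_ereal_sup => _ [delta _ <-].
by rewrite (cover_outer0 (hausdorff_gauge0 delta) (hausdorff_gauge_ge0 delta)).
Qed.

Lemma le_hausdorff_outer : {homo H : A B / A `<=` B >-> A <= B}.
Proof.
move=> A B AB; apply: ge_ereal_sup => _ [delta delta0 <-].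
by apply: le_trans (le_hausdorff_pre B delta0); exact: le_cover_outer.
Qed.

Lemma hausdorff_outer_sigma_subadditive : sigma_subadditive H.
Proof.
move=> F; apply: ge_ereal_sup => _ [delta delta0 <-].
apply: (le_trans (cover_outer_sigma_subadditive
  (hausdorff_gauge_ge0 delta) F)).
apply: lee_nneseries => k _; last exact: le_hausdorff_pre.
by move=> _; exact: cover_outer_ge0 (hausdorff_gauge_ge0 delta) _.
Qed.

HB.instance Definition _ := isOuterMeasure.Build R 'rV[R]_d H
  hausdorff_outer0 hausdorff_outer_ge0 le_hausdorff_outer
  hausdorff_outer_sigma_subadditive.

End HausdorffInstance.

Section Restriction.
Variables (V : Type) (mu : {outer_measure set V -> \bar R}) (D : set V).
Local Notation muD := (restr_outer mu D).

Lemma restr_outer0 : muD set0 = 0.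
Proof. by rewrite /restr_outer set0I outer_measure0. Qed.

Lemma restr_outer_ge0 A : 0 <= muD A.
Proof. exact: outer_measure_ge0. Qed.

Lemma le_restr_outer : {homo muD : A B / A `<=` B >-> A <= B}.
Proof. by move=> A B AB; apply: le_outer_measure; exact: setSI. Qed.

Lemma restr_outer_sigma_subadditive : sigma_subadditive muD.
Proof.
move=> F; rewrite /restr_outer setI_bigcupl.
exact: outer_measure_sigma_subadditive.
Qed.

HB.instance Definition _ := isOuterMeasure.Build R V muD
  restr_outer0 restr_outer_ge0 le_restr_outer restr_outer_sigma_subadditive.

End Restriction.
End OuterMeasureInstances.

(* The measures carried by the domain and by its boundary live on the whole of
   R^d and are concentrated on Omega, resp. Gamma: they are the Caratheodory
   measures of the restricted outer measures.  Hence L^p(Omega) and L^p(Gamma)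
   are represented by functions on R^d whose values off Omega, resp. Gamma, are
   irrelevant. *)
Section DomainMeasures.
Variables (R : realType) (d : nat) (Omega : set 'rV[R]_d).

Definition boundary : set 'rV[R]_d := closure Omega `\` interior Omega.

Definition vol_outer : {outer_measure set 'rV[R]_d -> \bar R} :=
  restr_outer (@lebesgue_outer R d) Omega.

Definition surf_outer : {outer_measure set 'rV[R]_d -> \bar R} :=
  restr_outer (@hausdorff_outer R d d.-1) boundary.

Definition volume : {measure set (caratheodory_type vol_outer) -> \bar R} :=
  (vol_outer : set (caratheodory_type vol_outer) -> \bar R).

Definition surface : {measure set (caratheodory_type surf_outer) -> \bar R} :=
  (surf_outer : set (caratheodory_type surf_outer) -> \bar R).

(* Near each boundary point, after an orthogonal change of coordinates Q, Omega
   is the region above the graph of a Lipschitz function of the coordinates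
   other than the i-th one. *)
Definition locally_lipschitz_graph : Prop :=
  forall x0, boundary x0 ->
  exists (r : R) (Q : 'M[R]_d) (i : 'I_d) (g : 'rV[R]_d.-1 -> R),
    [/\ 0 < r, Q *m Q^T = 1%:M, [lipschitz g x | x in setT] &
        forall x, ball x0 r x ->
          (Omega x <-> g (col' i (x *m Q)) < (x *m Q) 0 i)].

Definition bounded_lipschitz_domain : Prop :=
  [/\ Omega !=set0, open Omega, connected Omega, bounded_set Omega &
      locally_lipschitz_graph].

End DomainMeasures.

Section Sobolev.
Variables (R : realType) (d : nat) (Omega : set 'rV[R]_d).
Local Notation V := 'rV[R]_d.
Local Notation vol := (volume Omega).
Local Notation sigma := (surface Omega).
Local Notation Gamma := (boundary Omega).

Fixpoint Cn (k : nat) (phi : V -> R) : Prop :=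
  continuous phi /\
  (if k is k'.+1 then
     forall i : 'I_d, (forall x, derivable phi x (delta_mx 0 i)) /\
                      Cn k' ('D_(delta_mx 0 i) phi)
   else True).

Definition test_function (phi : V -> R) : Prop :=
  [/\ forall k, Cn k phi,
      compact (closure [set x | phi x != 0]) &
      closure [set x | phi x != 0] `<=` Omega].

Definition weak_partial (i : 'I_d) (v g : V -> R) : Prop :=
  forall phi, test_function phi ->
    \int[vol]_x (v x * 'D_(delta_mx 0 i) phi x) = - \int[vol]_x (g x * phi x).

(* A function together with its gradient; H^1(Omega) is identified with the
   set of pairs (v, grad v) of L^2 functions. *)
Definition jet : Type := ((V -> R) * ('I_d -> V -> R))%type.
HB.instance Definition _ := GRing.Lmodule.on jet.

Definition vjet : Type := 'I_d -> jet.
HB.instance Definition _ := GRing.Lmodule.on vjet.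

Definition H1 : set jet :=
  [set v | [/\ v.1 \in Lfun vol 2%:E,
               forall i, v.2 i \in Lfun vol 2%:E &
               forall i, weak_partial i v.1 (v.2 i)]].

Definition jet_ae_eq (v w : jet) : Prop :=
  (v.1 = w.1 %[ae vol]) /\ (forall i, v.2 i = w.2 i %[ae vol]).

Definition vjet_ae_eq (v w : vjet) : Prop := forall i, jet_ae_eq (v i) (w i).

Definition jet_one : jet := (cst 1, fun _ => cst 0).

Definition h1sq (v : jet) : R :=
  \int[vol]_x (v.1 x ^+ 2) + \sum_(i < d) \int[vol]_x (v.2 i x ^+ 2).

Definition h1norm (v : jet) : R := Num.sqrt (h1sq v).

Definition vh1norm (v : vjet) : R := Num.sqrt (\sum_(i < d) h1sq (v i)).

Definition trace_operator (gamma : jet -> V -> R) : Prop :=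
  [/\ forall v, H1 v -> gamma v \in Lfun sigma 2%:E,
      forall (a : R) v w, H1 v -> H1 w ->
        gamma (a *: v + w) = (fun x => a * gamma v x + gamma w x) %[ae sigma],
      exists c : R, forall v, H1 v ->
        Num.sqrt (\int[sigma]_x (gamma v x ^+ 2)) <= c * h1norm v &
      forall v, H1 v -> {within closure Omega, continuous v.1} ->
        gamma v = v.1 %[ae sigma]].

(* Relatively open and non-overlapping parts which together make up Gamma up
   to their relative boundaries. *)
Definition boundary_partition (GammaD GammaN : set V) : Prop :=
  [/\ exists2 O, open O & GammaD = Gamma `&` O,
      exists2 O, open O & GammaN = Gamma `&` O,
      GammaD `&` GammaN = set0 &
      Gamma = closure GammaD `|` closure GammaN].

Definition H1D (gamma : jet -> V -> R) (GammaD : set V) : set vjet :=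
  [set u | forall i, H1 (u i) /\
                     {ae sigma, forall x, GammaD x -> gamma (u i) x = 0}].

Definition bounded_linear_functional (G : jet -> R) : Prop :=
  (forall (a : R) v w, H1 v -> H1 w -> G (a *: v + w) = a * G v + G w) /\
  (exists c : R, forall v, H1 v -> `|G v| <= c * h1norm v).

Definition H1G (G : jet -> R) : set jet := H1 `&` [set v | G v = 0].

(* W is a finite-dimensional subspace of H, as a set of representatives that is
   saturated for eqU. *)
Definition finite_dim_subspace (U : lmodType R) (eqU : U -> U -> Prop)
    (H W : set U) : Prop :=
  exists (m : nat) (b : 'I_m -> U),
    (forall k, H (b k)) /\
    forall v, W v <->
      (H v /\ exists c : 'I_m -> R, eqU v (\sum_(k < m) c k *: b k)).

End Sobolev.

Section Time.
Variables (R : realType) (T : R).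
Local Notation leb := (@lebesgue_measure R).

Section Classical.
Variables (U : lmodType R) (N : U -> R).

Definition continuous_in_time (u : R -> U) : Prop :=
  forall t, 0 <= t <= T ->
    N (u s - u t) @[s --> within `[0, T] (nbhs t)] --> (0 : R).

Definition time_derivative (u v : R -> U) : Prop :=
  forall t, 0 <= t <= T ->
    N ((s - t)^-1 *: (u s - u t) - v t) @[s --> within `[0, T] t^']
      --> (0 : R).

End Classical.

(* Bochner spaces with values in a subspace X of L^2(mu). *)
Section Bochner.
Context {disp : measure_display} {Y : measurableType disp}.
Variables (mu : {measure set Y -> \bar R}) (X : set (Y -> R)).

Definition simple_in_time (s : R -> Y -> R) : Prop :=
  exists (m : nat) (A : 'I_m -> set R) (v : 'I_m -> Y -> R),
    (forall k, measurable (A k) /\ X (v k)) /\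
    (forall t y, s t y = \sum_(k < m) \1_(A k) t * v k y).

(* The representative is normalized on a null set of times so that the
   approximation by simple functions holds for every t. *)
Definition bochner_L2 (z : R -> Y -> R) : Prop :=
  [/\ forall t, 0 <= t <= T -> X (z t),
      exists2 s : nat -> R -> Y -> R, (forall k, simple_in_time (s k)) &
        forall t, 0 <= t <= T ->
          \int[mu]_y ((s k t y - z t y) ^+ 2) @[k --> \oo] --> (0 : R) &
      (\int[leb]_(t in `[0%R, T]) (\int[mu]_y (z t y ^+ 2))%R%:E < +oo)%E].

(* dz in L^2(0,T;X) and z(t) = z(0) + \int_0^t dz for all t, the X-valued
   integral being tested against the elements of X. *)
Definition weak_time_derivative (z dz : R -> Y -> R) : Prop :=
  [/\ forall t, 0 <= t <= T -> X (z t),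
      bochner_L2 dz &
      forall t, 0 <= t <= T -> forall w, X w ->
        \int[mu]_y (z t y * w y) = \int[mu]_y (z 0 y * w y) +
          \int[leb]_(r in `[0, t]) \int[mu]_y (dz r y * w y)].

(* H^1(0,T;X), through the continuous representatives *)
Definition bochner_H1 : set (R -> Y -> R) :=
  [set z | exists dz, weak_time_derivative z dz].

Definition time_weak_deriv (z : R -> Y -> R) : R -> Y -> R :=
  xget (fun _ _ => 0) [set dz | weak_time_derivative z dz].

End Bochner.
End Time.

Section Tensors.
Variables (R : realType) (d : nat).
Local Notation V := 'rV[R]_d.
Local Notation M := 'M[R]_d.

Definition dot (b c : V) : R := \sum_(i < d) b 0 i * c 0 i.
Definition frob (A B : M) : R := \sum_(i < d) \sum_(j < d) A i j * B i j.
Definition sym (A : M) : Prop := A^T = A.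

Definition tensor4 : Type := 'I_d -> 'I_d -> 'I_d -> 'I_d -> V -> R.
Definition tensor3 : Type := 'I_d -> 'I_d -> 'I_d -> V -> R.
Definition tensor2 : Type := 'I_d -> 'I_d -> V -> R.

Definition appC (C : tensor4) (x : V) (A : M) : M :=
  \matrix_(i, j) \sum_(k < d) \sum_(l < d) C i j k l x * A k l.
Definition appE (E : tensor3) (x b : V) : M :=
  \matrix_(i, j) \sum_(k < d) E i j k x * b 0 k.
Definition appET (E : tensor3) (x : V) (A : M) : V :=
  \row_k \sum_(i < d) \sum_(j < d) E i j k x * A i j.
Definition appK (K : tensor2) (x b : V) : V :=
  \row_i \sum_(j < d) K i j x * b 0 j.

Lemma appETP (E : tensor3) (x : V) (A : M) (b : V) :
  dot (appET E x A) b = frob A (appE E x b).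
Proof.
rewrite /dot /frob.
under eq_bigr => k _ do (rewrite mxE mulr_suml;
  under eq_bigr => i _ do rewrite mulr_suml).
rewrite exchange_big/=; apply: eq_bigr => i _.
rewrite exchange_big/=; apply: eq_bigr => j _.
rewrite mxE mulr_sumr; apply: eq_bigr => k _.
by rewrite mulrAC mulrC [E _ _ _ _ * _]mulrC.
Qed.

Definition grad (psi : jet R d) (x : V) : V := \row_i psi.2 i x.

Definition strain (u : vjet R d) (x : V) : M :=
  \matrix_(i, j) (((u i).2 j x + (u j).2 i x) / 2).

End Tensors.

Section System.
Variables (R : realType) (d : nat) (Omega : set 'rV[R]_d).
Local Notation V := 'rV[R]_d.
Local Notation M := 'M[R]_d.
Local Notation vol := (volume Omega).
Local Notation sigma := (surface Omega).
Local Notation vjet := (vjet R d).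
Local Notation jet := (jet R d).

Definition admissible_coefficients (C : tensor4 R d) (E : tensor3 R d)
    (K : tensor2 R d) (c0 k0 : R) : Prop :=
  [/\ forall i j k l, C i j k l \in Lfun vol +oo%E,
      forall i j k, E i j k \in Lfun vol +oo%E &
      forall i j, K i j \in Lfun vol +oo%E] /\
  [/\ {ae vol, forall x, (forall A, sym (appC C x A)) /\
         forall A B, frob (appC C x A) B = frob A (appC C x B)},
      {ae vol, forall x, forall A : M, sym A ->
         c0 * frob A A <= frob (appC C x A) A},
      {ae vol, forall x, forall b, sym (appE E x b)},
      {ae vol, forall x, sym (\matrix_(i, j) K i j x)} &
      {ae vol, forall x, forall b, k0 * dot b b <= dot (appK K x b) b}].

Definition admissible_density (rho : V -> R) : Prop :=
  rho \in Lfun vol +oo%E /\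
  exists2 rho0 : R, 0 < rho0 & {ae vol, forall x, rho0 <= rho x}.

Section Forms.
Variables (C : tensor4 R d) (E : tensor3 R d) (K : tensor2 R d) (rho : V -> R).

Definition mass (u w : vjet) : R :=
  \int[vol]_x (rho x * \sum_(i < d) (u i).1 x * (w i).1 x).

Definition form_a (u : vjet) (psi : jet) (w : vjet) (phi : jet) : R :=
  \int[vol]_x frob (appC C x (strain u x) + appE E x (grad psi x)) (strain w x)
  + \int[vol]_x dot (- appET E x (strain u x) + appK K x (grad psi x))
                    (grad phi x).

Variables (gamma : jet -> V -> R) (G : jet -> R).
Variables (Vh : set vjet) (Wh : set jet) (T : R).
Local Notation WhG := (Wh `&` H1G Omega G).

Definition semidiscrete_solution (z : R -> V -> R)
    (u : R -> vjet) (psi : R -> jet) : Prop :=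
  exists du ddu : R -> vjet,
  [/\ forall t, 0 <= t <= T -> [/\ Vh (u t), Vh (du t) & Vh (ddu t)],
      [/\ time_derivative T (vh1norm Omega) u du,
          time_derivative T (vh1norm Omega) du ddu &
          continuous_in_time T (vh1norm Omega) ddu],
      (forall t, 0 <= t <= T -> WhG (psi t)) /\
        continuous_in_time T (h1norm Omega) psi,
      vjet_ae_eq Omega (u 0) 0 /\ vjet_ae_eq Omega (du 0) 0 &
      forall t, 0 <= t <= T -> forall w phi, Vh w -> WhG phi ->
        mass (ddu t) w + form_a (u t) (psi t) w phi =
        - \int[sigma]_x (z t x * gamma phi x)].

Definition L20 : set (V -> R) :=
  [set v | v \in Lfun sigma 2%:E /\ \int[sigma]_x v x = 0].

Definition Zspace : set (R -> V -> R) :=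
  [set z | bochner_H1 T sigma L20 z /\ z 0 = cst 0 %[ae sigma]].

Definition solution_operator (Sh : (R -> V -> R) -> R -> vjet) : Prop :=
  forall z, Zspace z -> exists psi, semidiscrete_solution z (Sh z) psi.

Definition P0 (m : nat) (cell : 'I_m -> set V) : set (V -> R) :=
  [set v | exists c : 'I_m -> R,
     v = (fun x => \sum_(k < m) c k * \1_(cell k) x) %[ae sigma]].

Definition boundary_mesh (m : nat) (cell : 'I_m -> set V) : Prop :=
  [/\ forall k, measurable (cell k : set (caratheodory_type
        (restr_outer (@hausdorff_outer R d d.-1) (boundary Omega)))),
      trivIset setT cell &
      \bigcup_k cell k = boundary Omega].

Definition Zh (m : nat) (cell : 'I_m -> set V) : set (R -> V -> R) :=
  [set z | Zspace z /\ forall t, 0 <= t <= T -> P0 cell (z t)].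

Definition Zad (za zb : R) : set (R -> V -> R) :=
  [set z | Zspace z /\ forall t, 0 <= t <= T ->
                         {ae sigma, forall x, za <= z t x <= zb}].

Definition Zadh (m : nat) (cell : 'I_m -> set V) (za zb : R) :
  set (R -> V -> R) := Zh cell `&` Zad za zb.

Definition jh (Sh : (R -> V -> R) -> R -> vjet) (ud : R -> vjet) (alpha : R)
    (z : R -> V -> R) : R :=
  2^-1 * \int[@lebesgue_measure R]_(t in `[0, T])
           mass (Sh z t - ud t) (Sh z t - ud t) +
  alpha / 2 * \int[@lebesgue_measure R]_(t in `[0, T])
           \int[sigma]_x (time_weak_deriv T sigma L20 z t x ^+ 2).

End Forms.
End System.

(* Main.v *)
Require Import Defs.
From HB Require Import structures.
From mathcomp Require Import all_boot all_order all_algebra.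
From mathcomp Require Import all_classical all_reals all_analysis.
From mathcomp Require Import measurable_realfun ess_sup_inf.
From mathcomp Require Import ring lra.
Set Implicit Arguments.
Unset Strict Implicit.
Unset Printing Implicit Defensive.
Import Order.TTheory GRing.Theory Num.Theory.
Import numFieldNormedType.Exports.
Local Open Scope classical_set_scope.
Local Open Scope ring_scope.

(* A control with values in the finite-dimensional space spanned by e_1, ..., e_k
   (orthonormal piecewise constant functions of zero mean) is
   z(t) = sum_j (int_0^t g_j) e_j with g in L^2(0,T)^k, and the norm of z' is
   that of g.  The L^2 products are only semi-inner products on functions, and
   the form a is degenerate, so no system matrix is inverted: coercivity shows
   that a vanishing residual with zero displacement and zero load forces a zero
   acceleration, which makes the linear relation between (u, z) and u'' a
   bounded map on a finite-dimensional space.  Gronwall's inequality then bounds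
   the state linearly in terms of g.  The cost is thus a quadratic functional of
   g, convex plus (alpha/2)|g|^2; by the parallelogram law, minimizing sequences
   are Cauchy and two minimizers coincide.  The admissible g form a closed
   convex set containing 0 because g |-> z(t) is bounded for every t. *)

(** * Semi-inner products and finite-dimensional linear relations *)

(** [Vh] and [Wh] are saturated sets of representatives. Instead of checking that they are closed
    under linear combinations, the argument moves to their linear spans, which stay among the jets
    with square integrable components, where all the forms are bilinear. [Sh] is merely some
    solution operator, so its affine behaviour is not given: it comes from the stability bound with
    zero load, applied to combinations of three trajectories. The derivative in the cost is chosen
    among the weak derivatives, and the identity defining these holds for one test function at a
    time, with an exceptional set of times that depends on it; strong measurability brings the tests
    down to countably many. Since [ud] need not lie in the discrete space, the tracking term is
    split by projection into a finite-dimensional misfit and a remainder free of the control.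
    Finally, zero distance between two parameters means equality at almost every time only;
    primitives do not see the exceptional times, so the control is unique at every time. *)

Section SemiInnerProduct.
Variables (R : realType) (U : lmodType R).
Implicit Types (D X : set U) (B : U -> U -> R).

Definition lin_closed D := D 0 /\ forall a u v, D u -> D v -> D (a *: u + v).

(** The laws are required on [D] only, because integrals of products are additive only for square
    integrable arguments. Definiteness is left out: functions are not identified up to null sets. *)
Definition semi_inner D B := [/\ lin_closed D,
  forall u v, D u -> D v -> B u v = B v u,
  forall a u v w, D u -> D v -> D w -> B (a *: u + v) w = a * B u w + B v w &
  forall u, D u -> 0 <= B u u].

Lemma lin_closedZ D a u : lin_closed D -> D u -> D (a *: u).
Proof. by move=> [D0 Dl] Du; rewrite -[_ *: _]addr0; exact: Dl. Qed.

Lemma lin_closedD D u v : lin_closed D -> D u -> D v -> D (u + v).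
Proof. by move=> [D0 Dl] Du Dv; rewrite -[u]scale1r; exact: Dl. Qed.

Lemma lin_closedB D u v : lin_closed D -> D u -> D v -> D (u - v).
Proof. by move=> [D0 Dl] Du Dv; rewrite addrC -scaleN1r; exact: Dl. Qed.

Lemma lin_closed_sum D (I : Type) (s : seq I) (c : I -> R) (b : I -> U) :
  lin_closed D -> (forall k, D (b k)) -> D (\sum_(k <- s) c k *: b k).
Proof.
move=> Dl Db; elim/big_rec: _ => [|k x _ Dx]; first by have [] := Dl.
by apply: Dl.2.
Qed.

Section Theory.
Variables (D : set U) (B : U -> U -> R) (DB : semi_inner D B).

Lemma form_lin_closed : lin_closed D. Proof. by case: DB. Qed.
Local Notation Dl := form_lin_closed.

Lemma formC u v : D u -> D v -> B u v = B v u. Proof. by case: DB => _ /(_ u v). Qed.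

Lemma formDZl a u v w : D u -> D v -> D w -> B (a *: u + v) w = a * B u w + B v w.
Proof. by case: DB => _ _ + _; exact. Qed.

Lemma form_ge0 u : D u -> 0 <= B u u. Proof. by case: DB => _ _ _; exact. Qed.

Lemma formDl u v w : D u -> D v -> D w -> B (u + v) w = B u w + B v w.
Proof. by move=> *; rewrite -[in LHS](scale1r u) formDZl// mul1r. Qed.

Lemma formBl u v w : D u -> D v -> D w -> B (u - v) w = B u w - B v w.
Proof.
by move=> *; rewrite addrC -[in LHS](scaleN1r v) formDZl// mulN1r addrC.
Qed.

Lemma form0l w : D w -> B 0 w = 0.
Proof.
move=> Dw; have D0 := Dl.1.
by have := formBl D0 D0 Dw; rewrite !subrr.
Qed.

Lemma formZl a u w : D u -> D w -> B (a *: u) w = a * B u w.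
Proof.
by move=> Du Dw; rewrite -[_ *: _]addr0 formDZl//; [rewrite form0l// addr0|exact: Dl.1].
Qed.

Lemma formDr u v w : D u -> D v -> D w -> B w (u + v) = B w u + B w v.
Proof.
move=> Du Dv Dw; rewrite formC ?formDl//; last exact: lin_closedD Dl _ _.
by rewrite (formC Du)// (formC Dv).
Qed.

Lemma formBr u v w : D u -> D v -> D w -> B w (u - v) = B w u - B w v.
Proof.
move=> Du Dv Dw; rewrite formC ?formBl//; last exact: lin_closedB Dl _ _.
by rewrite (formC Du)// (formC Dv).
Qed.

Lemma formZr a u w : D u -> D w -> B w (a *: u) = a * B w u.
Proof.
move=> Du Dw; rewrite formC ?formZl//; last exact: lin_closedZ Dl _.
by rewrite (formC Du).
Qed.

Lemma form_suml (I : Type) (s : seq I) (c : I -> R) (b : I -> U) w :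
  (forall k, D (b k)) -> D w ->
  B (\sum_(k <- s) c k *: b k) w = \sum_(k <- s) c k * B (b k) w.
Proof.
move=> Db Dw; elim: s => [|k s ih]; first by rewrite !big_nil form0l.
by rewrite !big_cons formDZl ?ih//; exact: lin_closed_sum Dl Db.
Qed.

Lemma form_sumr (I : Type) (s : seq I) (c : I -> R) (b : I -> U) w :
  (forall k, D (b k)) -> D w ->
  B w (\sum_(k <- s) c k *: b k) = \sum_(k <- s) c k * B w (b k).
Proof.
move=> Db Dw; rewrite formC//; last exact: lin_closed_sum Dl Db.
by rewrite form_suml//; apply: eq_bigr => k _; rewrite formC.
Qed.

Lemma formDD u v : D u -> D v -> B (u + v) (u + v) = B u u + 2 * B u v + B v v.
Proof.
move=> Du Dv; have Duv := lin_closedD Dl Du Dv.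
by rewrite formDl// !formDr// (formC Dv Du); ring.
Qed.

Lemma formBB u v : D u -> D v -> B (u - v) (u - v) = B u u - 2 * B u v + B v v.
Proof.
move=> Du Dv; have Duv := lin_closedB Dl Du Dv.
by rewrite formBl// !formBr// (formC Dv Du); ring.
Qed.

(** The quadratic [t |-> B (u - t *: v) (u - t *: v)] is nonnegative; evaluate it at its minimum,
    with the degenerate case [B v v = 0] apart. *)
Lemma form_CS u v : D u -> D v -> B u v ^+ 2 <= B u u * B v v.
Proof.
move=> Du Dv.
have pos t : 0 <= B u u - 2 * t * B u v + t ^+ 2 * B v v.
  have := form_ge0 (lin_closedB Dl Du (lin_closedZ t Dl Dv)).
  rewrite formBB ?formZr ?formZl//; last 2 first.
  - exact: lin_closedZ Dl Dv.
  - exact: lin_closedZ Dl Dv.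
  by move=> h; apply: le_trans h _; rewrite le_eqVlt; apply/orP; left; apply/eqP; ring.
have u0 := form_ge0 Du; have v0 := form_ge0 Dv.
have [vv0|vvN0] := eqVneq (B v v) 0; last first.
  have vvp : 0 < B v v by rewrite lt_neqAle eq_sym vvN0.
  have := pos (B u v / B v v).
  rewrite -(pmulr_lge0 _ vvp) => h.
  rewrite -subr_ge0; apply: le_trans h _; rewrite le_eqVlt; apply/orP; left.
  by apply/eqP; field.
rewrite vv0 mulr0 leNgt; apply/negP => h.
have uv0 : B u v != 0 by apply: contraTneq h => ->; rewrite expr0n ltxx.
(* With [B v v = 0] the quadratic is affine in [t], and this [t] gives it the value -1. *)
have := pos ((B u u + 1) / (2 * B u v)).
rewrite vv0 mulr0 addr0.
have -> : 2 * ((B u u + 1) / (2 * B u v)) * B u v = B u u + 1 by field.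
by rewrite opprD addrA subrr; lra.
Qed.

Lemma form_null u v : D u -> D v -> B u u = 0 -> B u v = 0.
Proof.
move=> Du Dv u0; have := form_CS Du Dv; rewrite u0 mul0r => h.
by apply/eqP; rewrite -sqrf_eq0 eq_le h sqr_ge0.
Qed.

(** Stands in for rewriting in the quotient by null vectors: vectors at distance zero are
    interchangeable inside the form. *)
Lemma form_null_sub u v w : D u -> D v -> D w -> B (u - v) (u - v) = 0 -> B u w = B v w.
Proof.
move=> Du Dv Dw /(form_null (lin_closedB Dl Du Dv) Dw).
by rewrite formBl// => /eqP; rewrite subr_eq0 => /eqP.
Qed.

(** Carries a representation by the [b k], known up to null vectors on a set, over to the linear
    span of that set. *)
Lemma null_span_lin_closed m (b : 'I_m -> U) : (forall k, D (b k)) ->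
  lin_closed [set v | D v /\ exists c : 'I_m -> R,
    let r := v - \sum_(k < m) c k *: b k in B r r = 0].
Proof.
move=> Db; have sD c : D (\sum_(k < m) c k *: b k) by exact: lin_closed_sum Dl Db.
split.
  split; first exact: Dl.1.
  exists (fun=> 0); rewrite big1 => [|k _]; last by rewrite scale0r.
  by rewrite /= subr0 form0l//; exact: Dl.1.
move=> a u v [Du [c hc]] [Dv [c' hc']]; split; first exact: Dl.2.
exists (fun k => a * c k + c' k) => /=.
have -> : a *: u + v - \sum_(k < m) (a * c k + c' k) *: b k =
   a *: (u - \sum_(k < m) c k *: b k) + (v - \sum_(k < m) c' k *: b k).
  rewrite scalerBr scaler_sumr addrACA -opprD -big_split/=; congr (_ - _).
  by apply: eq_bigr => k _; rewrite scalerDl scalerA.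
have r2 := lin_closedB Dl Du (sD c); have r2' := lin_closedB Dl Dv (sD c').
have rr := Dl.2 a _ _ r2 r2'.
by rewrite (formDZl a r2 r2' rr) (form_null r2 rr hc) (form_null r2' rr hc') mulr0 addr0.
Qed.

(* A maximal orthonormal family; the Gram matrix bounds its size by the rank. *)
Lemma orthonormal_basis (X : set U) (m : nat) (b : 'I_m -> U) :
  lin_closed X -> X `<=` D -> (forall k, D (b k)) ->
  (forall v, X v -> exists c : 'I_m -> R,
     let r := v - \sum_(k < m) c k *: b k in B r r = 0) ->
  exists (n : nat) (e : 'I_n -> U),
    [/\ forall j, X (e j),
        forall i j, B (e i) (e j) = (i == j)%:R &
        forall v, X v -> let r := v - \sum_(j < n) B v (e j) *: e j in B r r = 0].
Proof.
move=> Xl XD Db Xb.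
pose ortho n (e : 'I_n -> U) :=
  (forall j, X (e j)) /\ forall i j, B (e i) (e j) = (i == j)%:R.
have bound n (e : 'I_n -> U) : ortho n e -> (n <= m)%N.
  move=> [Xe eo].
  have /choice[c hc] j := Xb _ (Xe j).
  pose C := \matrix_(j < n, k < m) c j k.
  pose G := \matrix_(k < m, l < m) B (b k) (b l).
  suff CG : C *m G *m C^T = 1%:M.
    rewrite -[n](mxrank1 R) -CG -mulmxA.
    exact: leq_trans (mxrankM_maxl _ _) (rank_leq_col _).
  apply/matrixP => i j.
  have De k := XD _ (Xe k).
  have Ds k : D (\sum_(l < m) c k l *: b l) by exact: lin_closed_sum Dl Db.
  have -> : 1%:M i j = B (e i) (e j) by rewrite mxE eo.
  rewrite (form_null_sub (De i) (Ds i) (De j) (hc i)).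
  rewrite (formC (Ds i) (De j)) (form_null_sub (De j) (Ds j) (Ds i) (hc j)).
  rewrite (form_suml _ _ Db (Ds i)) mxE; apply: eq_bigr => l _.
  rewrite (form_sumr _ _ Db (Db l)) mxE mulrC [C^T _ _]mxE [C _ _]mxE; congr (_ * _).
  by apply: eq_bigr => k _; rewrite [C _ _]mxE [G _ _]mxE (formC (Db l) (Db k)).
pose P n := `[< exists e : 'I_n -> U, ortho n e >].
have exP : exists n, P n.
  exists 0%N; apply/asboolP; exists (fun=> 0); split; first by case.
  by case.
have ubP n : P n -> (n <= m)%N by move=> /asboolP[e /bound].
case: (ex_maxnP exP ubP) => n /asboolP[e [Xe eo]] maxn.
exists n, e; split => // v Xv; set r := v - _ => /=.
have De k := XD _ (Xe k).
have Xr : X r by apply: lin_closedB => //; exact: lin_closed_sum.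
have Dr := XD _ Xr; have Dv := XD _ Xv.
have re j : B r (e j) = 0.
  rewrite /r formBl//; last exact: lin_closed_sum Dl De.
  rewrite form_suml// (bigD1 j)//= eo eqxx mulr1 big1 ?addr0 ?subrr// => i ij.
  by rewrite eo (negbTE ij) mulr0.
(* A residual of positive norm, once normalized, would extend the family beyond its maximal size. *)
apply/eqP; apply/negPn/negP => rr0.
have rp : 0 < B r r by rewrite lt_neqAle eq_sym rr0 form_ge0.
pose s := (Num.sqrt (B r r))^-1 *: r.
have Xs : X s by exact: lin_closedZ.
have Ds := XD _ Xs.
have se j : B s (e j) = 0 by rewrite /s formZl// re mulr0.
have ss : B s s = 1.
  rewrite /s formZl ?formZr//.
  rewrite mulrA -invfM -expr2 sqr_sqrtr ?ltW// mulVf//.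
pose e' (i : 'I_n.+1) := if unlift ord_max i is Some j then e j else s.
suff /maxn : P n.+1 by rewrite ltnn.
apply/asboolP; exists e'; split=> [j|i j]; first by rewrite /e'; case: unliftP.
rewrite /e'; case: unliftP => [i' ->|->]; case: unliftP => [j' ->|->].
- by rewrite eo (inj_eq lift_inj).
- by rewrite formC// se eq_sym (negbTE (neq_lift _ _)).
- by rewrite se (negbTE (neq_lift _ _)).
- by rewrite eqxx.
Qed.

End Theory.
End SemiInnerProduct.

(** * Boundedness of finite-dimensional linear relations *)

Section LinearRelation.
Variable R : realType.

Definition sumsq n (x : 'I_n -> R) : R := \sum_(i < n) x i ^+ 2.

Lemma sumsq_ge0 n (x : 'I_n -> R) : 0 <= sumsq x.
Proof. by apply: sumr_ge0 => i _; rewrite sqr_ge0. Qed.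

Lemma le_sumsq n (x : 'I_n -> R) i : x i ^+ 2 <= sumsq x.
Proof. by rewrite /sumsq (bigD1 i)//= lerDl sumr_ge0// => j _; rewrite sqr_ge0. Qed.

Lemma sumsq_eq0 n (x : 'I_n -> R) : sumsq x = 0 -> forall i, x i = 0.
Proof.
move=> x0 i; apply/eqP; rewrite -sqrf_eq0 eq_le sqr_ge0 andbT -x0.
exact: le_sumsq.
Qed.

Definition dotf n (x y : 'I_n -> R) : R := \sum_(i < n) x i * y i.

Lemma dotf_sumsq n (x : 'I_n -> R) : dotf x x = sumsq x.
Proof. by apply: eq_bigr => i _; rewrite expr2. Qed.

Lemma semi_inner_dotf n : @semi_inner R ('I_n -> R) setT (@dotf n).
Proof.
split=> [//|u v _ _|a u v w _ _ _|u _].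
- by apply: eq_bigr => i _; rewrite mulrC.
- rewrite /dotf mulr_sumr -big_split/=; apply: eq_bigr => i _.
  by rewrite mulrDl mulrA.
- by rewrite dotf_sumsq sumsq_ge0.
Qed.

(** Linearity together with [L x 0 -> x = 0] makes [L] the graph of a linear map on its projection
    [X]. This map is determined by the images [f j] of an orthonormal basis of [X]; the constant is
    the squared Frobenius norm of these images, times the dimension of [X]. *)
Lemma linear_relation_bound p q (L : ('I_p -> R) -> ('I_q -> R) -> Prop) :
  (forall a x1 y1 x2 y2, L x1 y1 -> L x2 y2 ->
     L (a *: x1 + x2) (a *: y1 + y2)) ->
  L 0 0 ->
  (forall x, L x 0 -> x = 0) ->
  exists2 K : R, 0 <= K & forall x y, L x y -> sumsq x <= K * sumsq y.
Proof.
move=> Ll L00 L0.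
pose X : set ('I_q -> R) := [set y | exists x, L x y].
have Xl : lin_closed X.
  split; first by exists 0.
  by move=> a u v [x xu] [x' xv]; exists (a *: x + x'); exact: Ll.
have dq := semi_inner_dotf q.
have [||n [e [Xe eo Xs]]] := @orthonormal_basis _ _ _ _ dq X q
    (fun k => fun i => (i == k)%:R) Xl (@subsetT _ _).
- by [].
- move=> v _; exists v => /=; set r := _ - _.
  suff -> : r = 0 by exact: (form0l dq).
  apply/funext => i; rewrite /r.
  have -> : (v - \sum_(k < q) v k *: (fun i0 : 'I_q => (i0 == k)%:R : R)) i =
    v i - (\sum_(k < q) v k *: (fun i0 : 'I_q => (i0 == k)%:R : R)) i by [].
  rewrite fct_sumE (bigD1 i)//= big1 ?addr0; last first.
    by move=> k ki; rewrite -[LHS]/(v k * (i == k)%:R) eq_sym (negbTE ki) mulr0.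
  by rewrite -[X in _ - X]/(v i * (i == i)%:R) eqxx mulr1 subrr.
have /choice[f fe] j : exists x, L x (e j) by exact: Xe.
pose K := \sum_(i < p) sumsq (fun j => f j i).
have K0 : 0 <= K by apply: sumr_ge0 => i _; exact: sumsq_ge0.
exists (n%:R * K); first by rewrite mulr_ge0.
move=> x y Lxy.
pose c j := dotf y (e j).
have yE : y = \sum_(j < n) c j *: e j.
  have /= := Xs y (ex_intro _ _ Lxy); rewrite dotf_sumsq => /sumsq_eq0 h.
  by apply/eqP; rewrite -subr_eq0; apply/eqP/funext => i; exact: h.
have Lc : L (\sum_(j < n) c j *: f j) (\sum_(j < n) c j *: e j).
  elim: (index_enum _) => [|k s ih]; first by rewrite !big_nil.
  by rewrite !big_cons; exact: Ll.
(* Both sides are related to [y], so their difference is related to 0. *)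
have xE : x = \sum_(j < n) c j *: f j.
  apply/eqP; rewrite -subr_eq0; apply/eqP; apply: L0.
  have := Ll (-1) _ _ _ _ Lc Lxy; rewrite -yE !scaleN1r addNr addrC.
  by [].
(* Each coefficient is bounded separately by Cauchy-Schwarz, which costs the factor [n]. *)
have cn : sumsq c <= n%:R * sumsq y.
  rewrite /sumsq mulr_natl -[in leRHS](card_ord n) -sumr_const; apply: ler_sum => j _.
  have := form_CS dq (I : setT y) (I : setT (e j)).
  by rewrite eo eqxx mulr1 dotf_sumsq.
have : sumsq x <= sumsq c * K.
  rewrite /K mulr_sumr; apply: ler_sum => i _.
  have -> : x i = dotf c (fun j => f j i).
    by rewrite xE fct_sumE.
  have := form_CS (semi_inner_dotf n) (I : setT c) (I : setT (fun j => f j i)).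
  by rewrite !dotf_sumsq.
by move/le_trans; apply; rewrite mulrAC ler_wpM2r.
Qed.

End LinearRelation.

(** * Square integrable functions *)

Section AlmostEverywhere.
Context {disp : measure_display} {Y : measurableType disp} {R : realType}.
Variable mu : {measure set Y -> \bar R}.

Lemma aeS (P Q : Y -> Prop) : (forall y, P y -> Q y) ->
  {ae mu, forall y, P y} -> {ae mu, forall y, Q y}.
Proof. by move=> PQ; apply: filterS. Qed.

Lemma aeS2 (P1 P2 Q : Y -> Prop) : (forall y, P1 y -> P2 y -> Q y) ->
  {ae mu, forall y, P1 y} -> {ae mu, forall y, P2 y} -> {ae mu, forall y, Q y}.
Proof. by move=> PQ; apply: filterS2. Qed.

Lemma aeS3 (P1 P2 P3 Q : Y -> Prop) : (forall y, P1 y -> P2 y -> P3 y -> Q y) ->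
  {ae mu, forall y, P1 y} -> {ae mu, forall y, P2 y} -> {ae mu, forall y, P3 y} ->
  {ae mu, forall y, Q y}.
Proof. by move=> PQ; apply: filterS3. Qed.

Lemma ae_ord m (P : 'I_m -> Y -> Prop) : (forall l, {ae mu, forall y, P l y}) ->
  {ae mu, forall y, forall l, P l y}.
Proof.
move=> Pl; apply: (aeS (P := fun y => forall l : nat, forall lm : (l < m)%N, P (Ordinal lm) y)).
  by move=> y h [l lm]; exact: h.
apply: ae_foralln => l.
have [lm|ml] := pselect (l < m)%N; last exact: aeW.
by apply: aeS (Pl (Ordinal lm)) => y h lm'; rewrite (bool_irrelevance lm' lm).
Qed.

End AlmostEverywhere.

Section L2.
Context {disp : measure_display} {Y : measurableType disp} {R : realType}.
Variable mu : {measure set Y -> \bar R}.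
Implicit Types f g h : Y -> R.

Definition L2 : set (Y -> R) := [set f | f \in Lfun mu 2%:E].
Definition ip f g : R := \int[mu]_y (f y * g y).

Lemma L2_measurable f : L2 f -> measurable_fun setT f.
Proof. by rewrite /L2/= inE => /andP[+ _]; rewrite inE. Qed.

Lemma L2_int f g : L2 f -> L2 g -> mu.-integrable setT (EFin \o (fun y => f y * g y)).
Proof. by move=> f2 g2; apply/Lfun1_integrable; exact: Lfun2_mul_Lfun1. Qed.

Lemma L2_intro f : measurable_fun setT f ->
  (\int[mu]_y (f y ^+ 2)%:E < +oo)%E -> L2 f.
Proof.
move=> mf foo; rewrite /L2/= inE; apply/andP; split; rewrite inE//=.
rewrite /finite_norm unlock /Lnorm; apply: poweR_lty.
by under eq_integral => x _ do rewrite /= powR_mulrn ?normr_ge0// real_normK ?num_real//.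
Qed.

Lemma L2_sq_lty f : L2 f -> (\int[mu]_y (f y ^+ 2)%:E < +oo)%E.
Proof. by move=> f2; apply: integrable_lty => //; exact: Lfun2_integrable_sqr. Qed.

Lemma ip_sq f : ip f f = \int[mu]_y (f y ^+ 2).
Proof. by apply: eq_Rintegral => y _; rewrite expr2. Qed.

Lemma ip_sqE f : L2 f -> (ip f f)%:E = (\int[mu]_y (f y ^+ 2)%:E)%E.
Proof.
move=> f2; rewrite ip_sq /Rintegral fineK// ge0_fin_numE ?L2_sq_lty//.
by apply: integral_ge0 => y _; rewrite lee_fin sqr_ge0.
Qed.

Lemma L2_lin_closed : lin_closed L2.
Proof.
have [l0 ll] := @Lfun_submod_closed _ _ _ mu 2%:E (lee1n 2).
by split=> // a u v; exact: ll.
Qed.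

Lemma semi_inner_L2 : semi_inner L2 ip.
Proof.
split=> [|f g _ _|a f g h f2 g2 h2|f f2].
- exact: L2_lin_closed.
- by apply: eq_Rintegral => y _; rewrite mulrC.
- rewrite /ip -RintegralZl//; last exact: L2_int.
  rewrite -RintegralD//; last 2 first.
  - by apply: (@integrableZl _ _ _ mu _ measurableT a (EFin \o _)); exact: L2_int.
  - exact: L2_int.
  by apply: eq_Rintegral => y _; rewrite mulrDl mulrA.
- by apply: Rintegral_ge0 => y _; rewrite -expr2 sqr_ge0.
Qed.

Lemma L2_mulC f g : ip f g = ip g f.
Proof. by apply: eq_Rintegral => y _; rewrite mulrC. Qed.

Lemma ae_eq_Rintegral f g : measurable_fun setT f -> measurable_fun setT g ->
  f = g %[ae mu] -> \int[mu]_y f y = \int[mu]_y g y.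
Proof.
move=> mf mg fg; congr fine; apply: ae_eq_integral => //.
- by apply/measurable_EFinP.
- by apply/measurable_EFinP.
by apply: filterS fg => y h /h ->.
Qed.

Lemma ip_ael f f' g : L2 f -> L2 f' -> L2 g -> f = f' %[ae mu] -> ip f g = ip f' g.
Proof.
move=> f2 f'2 g2 ff'; apply: ae_eq_Rintegral.
- exact: measurable_funM (L2_measurable f2) (L2_measurable g2).
- exact: measurable_funM (L2_measurable f'2) (L2_measurable g2).
- by apply: filterS ff' => y h /h ->.
Qed.

Lemma ip_ae f f' g g' : L2 f -> L2 f' -> L2 g -> L2 g' ->
  f = f' %[ae mu] -> g = g' %[ae mu] -> ip f g = ip f' g'.
Proof.
move=> f2 f'2 g2 g'2 ff' gg'.
by rewrite (ip_ael f2 f'2 g2 ff') L2_mulC (ip_ael g2 g'2 f'2 gg') L2_mulC.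
Qed.

Lemma ip_eq0 f : L2 f -> ip f f = 0 -> f = (fun=> 0) %[ae mu].
Proof.
move=> f2 f0; have /(congr1 (@EFin R)) := f0; rewrite ip_sqE// => h.
have /(_ _)[//|+ _] := @ae_eq_integral_abs _ _ _ mu setT measurableT
   (fun y => (f y ^+ 2)%:E).
  by apply/measurable_EFinP/measurable_funX; exact: L2_measurable.
under eq_integral => y _ do rewrite abse_EFin ger0_norm ?sqr_ge0//.
move=> /(_ h); apply: filterS => y /= {}h _.
by have [/eqP] := h I; rewrite sqrf_eq0 => /eqP.
Qed.

Lemma ip_ae0 f : L2 f -> f = (fun=> 0) %[ae mu] -> ip f f = 0.
Proof.
move=> f2 f0; have D0 := L2_lin_closed.1.
rewrite (ip_ae f2 D0 f2 D0 f0 f0).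
exact: form0l semi_inner_L2 _ D0.
Qed.

Lemma Linfty_bounded h : h \in Lfun mu +oo%E ->
  measurable_fun setT h /\ exists2 M : R, 0 <= M & {ae mu, forall y, `|h y| <= M}.
Proof.
rewrite inE => /andP[]; rewrite inE/= => mh; rewrite inE/= /finite_norm unlock.
(* The sup norm is an essential supremum only when the whole space has positive measure; in the
   other case every bound holds almost everywhere. *)
case: ifPn => [_ hoo|mu0 _]; split=> //; last first.
  exists 0 => //; exists setT; split => //.
  by apply/eqP; rewrite eq_le measure_ge0 andbT leNgt.
have [M hM] := @ess_supr_bounded _ _ _ mu (fun y => `|h y|) hoo.
exists `|M| => //; apply: filterS hM => y h1.
exact: le_trans (ler_norm _).
Qed.

Lemma L2_bounded_mul h f : h \in Lfun mu +oo%E -> L2 f -> L2 (fun y => h y * f y).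
Proof.
move=> /Linfty_bounded[mh [M M0 hM]] f2; have mf := L2_measurable f2.
have mhf : measurable_fun setT (fun y => h y * f y) by exact: measurable_funM.
have Mf2 : L2 (M *: f) by exact: (lin_closedZ _ L2_lin_closed).
apply: L2_intro => //; apply: le_lt_trans (L2_sq_lty Mf2).
apply: ae_ge0_le_integral => //.
- by move=> y _; rewrite lee_fin sqr_ge0.
- by apply/measurable_EFinP; exact: measurable_funX.
- by move=> y _; rewrite lee_fin sqr_ge0.
- by apply/measurable_EFinP; apply: measurable_funX; exact: L2_measurable.
- apply: filterS hM => y hM _; rewrite lee_fin !exprMn ler_wpM2r ?sqr_ge0//.
  by rewrite -(real_normK (num_real (h y))) lerXn2r ?nnegrE.
Qed.

Lemma L2_indic (A : set Y) : measurable A -> (mu A < +oo)%E -> L2 (\1_A).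
Proof.
move=> mA Aoo; apply: L2_intro => //.
rewrite (eq_integral (fun y => (\1_A y)%:E)); first by rewrite integral_indic// setIT.
by move=> y _; rewrite indicE; case: (_ \in _); rewrite ?expr1n ?expr0n.
Qed.

(** Otherwise the integral of [c ^+ 2] over [A] would be infinite. *)
Lemma L2_constant_on (A : set Y) (c : R) f : L2 f -> measurable A ->
  {ae mu, forall y, A y -> f y = c} -> c != 0 -> (mu A < +oo)%E.
Proof.
move=> f2 mA fc c0; have mf := L2_measurable f2; rewrite ltey; apply/negP => /eqP Aoo.
have mf2 : measurable_fun setT (fun y => (f y ^+ 2)%:E).
  by apply/measurable_EFinP/measurable_funX.
have : (\int[mu]_(y in A) (f y ^+ 2)%:E < +oo)%E.
  apply: le_lt_trans (L2_sq_lty f2); apply: ge0_subset_integral => //.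
  by move=> y _; rewrite lee_fin sqr_ge0.
rewrite (ae_eq_integral (fun=> (c ^+ 2)%:E))//.
- by rewrite integral_cst// Aoo gt0_muley// lte_fin exprn_even_gt0.
- exact: measurable_funTS.
- by apply: aeS fc => y fc Ay; rewrite fc.
Qed.

Lemma ip_indic (A : set Y) f : ip f \1_A = \int[mu]_(y in A) f y.
Proof.
rewrite /ip [RHS]Rintegral_mkcond; apply: eq_Rintegral => y _.
by rewrite patchE indicE; case: (_ \in _); rewrite ?mulr1 ?mulr0.
Qed.

Lemma geometric_sum_le2 n : \sum_(0 <= k < n) (4^-1 : R) ^+ k <= 2.
Proof.
(* Adding the tail of the series makes the left side independent of [n], so that induction goes
   through. *)
have : \sum_(0 <= k < n) (4^-1 : R) ^+ k + 4 / 3 * 4^-1 ^+ n <= 2.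
  elim: n => [|n ih]; first by rewrite big_nil expr0; lra.
  rewrite big_nat_recr//= exprS; apply: le_trans ih; rewrite le_eqVlt.
  by apply/orP; left; apply/eqP; field.
by apply: le_trans; rewrite lerDl mulr_ge0// exprn_ge0.
Qed.

Lemma cvg_of_geometric_steps (u : nat -> R) (C : R) : 0 <= C ->
  (forall n, `|u n.+1 - u n| <= C * 2^-1 ^+ n) ->
  cvgn u /\ forall n, `|u n - limn u| <= 2 * C * 2^-1 ^+ n.
Proof.
move=> C0 uC.
have cu : cvgn u.
  have -> : u = (fun n => u 0%N + series (telescope u) n).
    by apply/funext => n; exact: eq_sum_telescope.
  apply: is_cvgD; first exact: is_cvg_cst.
  apply: normed_cvg; apply: (@series_le_cvg _ _ (geometric C 2^-1)) => //.
  - by move=> n /=.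
  - by move=> n; rewrite /= mulr_ge0// exprn_ge0.
  - by apply: is_cvg_geometric_series; rewrite ger0_norm// invf_lt1 ?ltr1n.
split=> // n.
have step k : `|u (n + k)%N - u n| <= 2 * C * 2^-1 ^+ n * (1 - 2^-1 ^+ k).
  elim: k => [|k ih]; first by rewrite addn0 subrr normr0 expr0 subrr mulr0.
  rewrite addnS; have := uC (n + k)%N => h.
  apply: (@le_trans _ _ (`|u (n + k).+1 - u (n + k)%N| + `|u (n + k)%N - u n|)).
    by apply: le_trans (ler_normD _ _); rewrite addrA subrK.
  apply: le_trans (lerD h ih) _; rewrite le_eqVlt; apply/orP; left; apply/eqP.
  by rewrite exprD exprS; field.
have cn : (fun k => `|u n - u (n + k)%N|) @ \oo --> `|u n - limn u|.
  apply: cvg_norm; apply: cvgB; first exact: cvg_cst.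
  have := cu; rewrite -(cvg_shiftn n u (nbhs (limn u))).
  by under eq_fun do rewrite addnC.
apply: (cvgr_to_le cn); near=> k.
rewrite distrC; apply: le_trans (step k) _.
rewrite ler_piMr//; first by rewrite !mulr_ge0// exprn_ge0.
Unshelve. all: by end_near. Qed.

(** Riesz-Fischer for fast Cauchy sequences. The weights [2 ^+ n] leave the squared norms of the
    steps [u n] below [4^-1 ^+ n], so [h] has integral at most 2. Where [h] is finite, [u n] is at
    most [sqrt h] times [2^-1 ^+ n], hence pointwise convergence at a geometric rate, and
    integrating the square of that rate gives convergence in norm. The last clause survives because
    the limit is pointwise; it keeps limits of signals supported in the time interval. *)
Lemma L2_complete (f : nat -> Y -> R) : (forall n, L2 (f n)) ->
  (forall n, ip (f n.+1 - f n) (f n.+1 - f n) <= 16^-1 ^+ n) ->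
  exists g, [/\ L2 g, ip (f n - g) (f n - g) @[n --> \oo] --> 0 &
                forall y, (forall n, f n y = 0) -> g y = 0].
Proof.
move=> f2 fC.
have mf n := L2_measurable (f2 n).
pose u n := f n.+1 - f n.
have u2 n : L2 (u n) by exact: lin_closedB L2_lin_closed _ _.
have mu2 n : measurable_fun setT (fun y => ((2 ^+ n * u n y) ^+ 2)%:E).
  apply/measurable_EFinP/measurable_funX/measurable_funM => //.
  exact: L2_measurable.
have u0 n y : (0 <= ((2 ^+ n * u n y) ^+ 2)%:E)%E by rewrite lee_fin sqr_ge0.
pose h y := (\sum_(n <oo) ((2 ^+ n * u n y) ^+ 2)%:E)%E.
have mh : measurable_fun setT h by exact: ge0_emeasurable_sum.
have h0 y : (0 <= h y)%E by exact: nneseries_ge0.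
have hE : (\int[mu]_y h y <= 2%:E)%E.
  rewrite integral_nneseries//; apply: lime_le.
    by apply: is_cvg_nneseries => n _ _; exact: integral_ge0.
  apply: nearW => N; apply: (@le_trans _ _ (\sum_(0 <= k < N) (4^-1 ^+ k)%:E)%E).
    apply: lee_sum => n _.
    under eq_integral do rewrite exprMn EFinM.
    rewrite ge0_integralZl_EFin ?sqr_ge0//; last 2 first.
    - by move=> y _; rewrite lee_fin sqr_ge0.
    - by apply/measurable_EFinP/measurable_funX; exact: L2_measurable.
    rewrite -ip_sqE// -EFinM lee_fin.
    apply: le_trans (ler_wpM2l _ (fC n)) _; first by rewrite sqr_ge0.
    rewrite le_eqVlt; apply/orP; left; apply/eqP.
    by rewrite -exprM mulnC exprM -exprMn; congr (_ ^+ _); field.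
  by rewrite sumEFin lee_fin geometric_sum_le2.
have hfin : mu.-integrable setT h.
  apply/integrableP; split => //; apply: le_lt_trans (ltry 2).
  by under eq_integral => y _ do rewrite gee0_abs//.
pose A : set Y := [set y | h y \is a fin_num].
have mA : measurable A.
  by rewrite -[A]setTI; exact: emeasurable_fin_num.
(* Cutting off outside [A] makes the sequence converge at every point, which is what measurability
   of the pointwise limit asks for. *)
pose f' n y := f n y * \1_A y.
have mf' n : measurable_fun setT (f' n) by exact: measurable_funM.
have A1 y : A y -> \1_A y = 1 :> R by move=> Ay; rewrite indicE mem_set.
have A0 y : ~ A y -> \1_A y = 0 :> R by move=> Ay; rewrite indicE memNset.
have key y : A y -> cvgn (f ^~ y) /\
    forall n, `|f n y - limn (f ^~ y)| <= 2 * Num.sqrt (fine (h y)) * 2^-1 ^+ n.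
  move=> Ay; apply: cvg_of_geometric_steps => [|n]; first exact: sqrtr_ge0.
  have : ((2 ^+ n * u n y) ^+ 2 <= fine (h y)).
    rewrite -lee_fin fineK//.
    apply: le_trans (nneseries_lim_ge n.+1 _); last by move=> *; exact: u0.
    by rewrite big_nat_recr//= leeDr// sume_ge0.
  move=> hn; have : Num.sqrt ((2 ^+ n * u n y) ^+ 2) <= Num.sqrt (fine (h y)).
    by rewrite ler_wsqrtr.
  rewrite sqrtr_sqr normrM ger0_norm ?exprn_ge0// => hn2.
  by rewrite exprVn ler_pdivlMr ?exprn_gt0// mulrC.
pose g y := limn (f' ^~ y).
have f'g y : f' ^~ y @ \oo --> g y.
  have [Ay|Ay] := pselect (A y); last first.
    by apply/cvg_ex; exists 0; rewrite /f'; under eq_fun do rewrite A0// mulr0; exact: cvg_cst.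
  rewrite /g /f'; under eq_fun do rewrite A1// mulr1.
  exact: (key _ Ay).1.
have mg : measurable_fun setT g by exact: (measurable_fun_cvg mf').
have mfg n : measurable_fun setT (f n - g) by exact: measurable_funB.
have bnd n : (\int[mu]_y ((f n - g) y ^+ 2)%:E <= (8 * 4^-1 ^+ n)%:E)%E.
  apply: (@le_trans _ _ (\int[mu]_y ((4 * 4^-1 ^+ n)%:E * h y))%E).
    apply: ae_ge0_le_integral => //.
    - by move=> y _; rewrite lee_fin sqr_ge0.
    - by apply/measurable_EFinP; exact: measurable_funX.
    - by move=> y _; rewrite mule_ge0// lee_fin mulr_ge0// exprn_ge0.
    - exact: measurable_funeM.
    have := integrable_ae measurableT hfin; apply: filterS => y /(_ I) hy _.
    have [cy by_] := key _ hy.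
    rewrite -(fineK hy) -EFinM lee_fin.
    have -> : (f n - g) y = f n y - limn (f ^~ y).
      rewrite -[LHS]/(f n y - g y); congr (_ - _).
      by rewrite /g /f'; under eq_fun do rewrite A1// mulr1.
    rewrite -(real_normK (num_real (f n y - _))).
    have -> : 4 * 4^-1 ^+ n * fine (h y) = (2 * Num.sqrt (fine (h y)) * 2^-1 ^+ n) ^+ 2.
      rewrite !exprMn sqr_sqrtr ?fine_ge0// -[in RHS]exprM mulnC exprM.
      have -> : (2^-1 : R) ^+ 2 = 4^-1 by field.
      by ring.
    by rewrite lerXn2r ?nnegrE// !mulr_ge0// ?sqrtr_ge0// exprn_ge0.
  rewrite ge0_integralZl_EFin//.
  apply: le_trans (lee_wpmul2l _ hE) _; first by rewrite lee_fin mulr_ge0// exprn_ge0.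
  by rewrite -EFinM lee_fin mulrAC -natrM.
have fg2 n : L2 (f n - g).
  by apply: L2_intro => //; apply: le_lt_trans (bnd n) (ltry _).
exists g; split.
- have -> : g = f 0%N - (f 0%N - g) by rewrite opprB addrC subrK.
  exact: lin_closedB L2_lin_closed _ _.
- apply: (@squeeze_cvgr _ _ _ _ (fun=> 0) (fun n => 8 * 4^-1 ^+ n)).
  + apply: nearW => n; rewrite (form_ge0 semi_inner_L2)//=.
    by rewrite -lee_fin ip_sqE.
  + exact: cvg_cst.
  + by apply: cvg_geometric; rewrite ger0_norm// invf_lt1// ltr1n.
- move=> y fy; rewrite /g /f'; under eq_fun do rewrite fy mul0r.
  by apply/cvg_lim => //; exact: cvg_cst.
Qed.

End L2.

(** * Functions with vanishing primitive *)

Section ZeroPrimitive.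
Variable R : realType.
Local Notation leb := (@lebesgue_measure R).

Lemma L2_itv (a b : R) : L2 leb (\1_`[a, b]).
Proof.
apply: L2_indic; first exact: measurable_itv.
rewrite [X in (X < _)%E]lebesgue_measure_itv/=.
by case: ifPn => // _; rewrite -EFinB ltry.
Qed.

(** Lebesgue differentiation: the primitive from minus infinity has derivative [f] almost
    everywhere. As [f] vanishes at negative times, it agrees with the primitive from 0, hence is
    zero around each interior point of the interval. *)
Lemma zero_primitive_ae0 (T : R) (f : R -> R) : L2 leb f ->
  (forall t, ~ `[0, T]%classic t -> f t = 0) ->
  (forall t, 0 <= t <= T -> \int[leb]_(r in `[0, t]) f r = 0) ->
  f = (fun=> 0) %[ae leb].
Proof.
move=> f2 fout fprim.
have iT : leb.-integrable setT (EFin \o f).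
  apply/(integrable_mkcond _ measurableT); rewrite restrict_EFin.
  have := L2_int f2 (L2_itv 0 T); apply: eq_integrable => // t _ /=.
  rewrite patchE mem_set// indicE; have [tT|tT] := pselect (`[0, T]%classic t).
    by rewrite mem_set// mulr1.
  by rewrite memNset// fout// mulr0.
have loc : locally_integrable setT f.
  exact: open_integrable_locally openT iT.
have iy (y : R) : leb.-integrable `]-oo, y] (EFin \o f).
  by apply: (integrableS measurableT) iT => //; exact: measurable_itv.
have := FTC1Ny iy loc.
have := @lebesgue_measure_set1 R 0; have := @lebesgue_measure_set1 R T => T0 z0.
(* The endpoints are discarded because none of their neighbourhoods stays in [[0, T]]. *)
have ae0 : {ae leb, forall t, t <> 0}.
  by exists [set 0]; split => //= t /= /contrapT.
have aeT : {ae leb, forall t, t <> T}.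
  by exists [set T]; split => //= t /= /contrapT.
move=> H; apply: aeS3 ae0 aeT H => t t0 tT H _.
have [tin|tout] := pselect (`[0, T]%classic t); last exact: fout.
move: tin; rewrite /= in_itv/= => /andP[t_ge0 t_leT].
have tpos : 0 < t by rewrite lt_neqAle t_ge0 andbT eq_sym; apply/eqP.
have tltT : t < T by rewrite lt_neqAle t_leT andbT; apply/eqP.
have [_ <-] := H.
rewrite derive1E (@near_eq_derive _ _ _ _ (cst 0)) ?derive_cst//.
near=> s.
have s0T : 0 <= s <= T.
  by apply/andP; split; apply: ltW; near: s; [exact: lt_nbhsr|exact: lt_nbhsl].
transitivity (\int[leb]_(r in `[0, s]) f r); last exact: fprim.
rewrite [LHS]Rintegral_mkcond [RHS]Rintegral_mkcond.
apply: eq_Rintegral => r _; rewrite !patchE.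
have [r0|r0] := leP 0 r.
  congr (if _ then _ else _).
  by apply/idP/idP; rewrite !inE/= !in_itv/= r0.
rewrite fout; first by case: ifP; case: ifP.
by rewrite /= in_itv/= leNgt r0.
Unshelve. all: by end_near. Qed.

End ZeroPrimitive.

Lemma cvg_sumr (R : realType) (X : Type) (F : set_system X) (FF : Filter F)
    n (h : 'I_n -> X -> R) (l : 'I_n -> R) :
  (forall i, h i x @[x --> F] --> l i) ->
  \sum_(i < n) h i x @[x --> F] --> \sum_(i < n) l i.
Proof.
move=> hl; elim: (index_enum _) => [|i s ih].
  by rewrite big_nil; under eq_fun do rewrite big_nil; exact: cvg_cst.
by rewrite big_cons; under eq_fun do rewrite big_cons; exact: cvgD.
Qed.

(** * Second-order differential inequalities *)

Section WithinDerivative.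
Variables (R : realType) (T : R).

Lemma within_nearP (t : R) (P : R -> Prop) :
  (\forall s \near within `[0, T] t^', P s) <->
  exists2 e : R, 0 < e & forall s, 0 <= s <= T -> s != t -> `|s - t| < e -> P s.
Proof.
rewrite near_withinE /dnbhs near_withinE; split.
- move=> /nbhs_normP[e /= e0 H]; exists e => // s s0T st ste.
  by apply: H => //=; rewrite ?in_itv//= distrC.
- move=> [e e0 H]; apply/nbhs_normP; exists e => // s /= ste st.
  by rewrite in_itv/= => s0T; apply: H => //; rewrite distrC.
Qed.

Lemma within_near_le (t : R) (P : R -> Prop) :
  (\forall s \near within `[0, T] (nbhs t), P s) <->
  exists2 e : R, 0 < e & forall s, 0 <= s <= T -> `|s - t| < e -> P s.
Proof.
rewrite near_withinE; split.
- move=> /nbhs_normP[e /= e0 H]; exists e => // s s0T ste.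
  by apply: H => //=; rewrite ?in_itv//= distrC.
- move=> [e e0 H]; apply/nbhs_normP; exists e => // s /= ste.
  by rewrite in_itv/= => s0T; apply: H => //; rewrite distrC.
Qed.

(** Scalar counterpart of [time_derivative]: the quotients stay inside the interval, so the
    derivative is one-sided at 0 and [T]. *)
Definition diff_on (f df : R -> R) := forall t, 0 <= t <= T ->
  (s - t)^-1 * (f s - f t) @[s --> within `[0, T] t^'] --> df t.

Lemma diff_on_is_derive f df t : diff_on f df -> 0 < t < T -> is_derive t 1 f (df t).
Proof.
move=> fdf /andP[t0 tT]; have := fdf t; rewrite !ltW// => /(_ isT) fdft.
have H : h^-1 *: ((f \o shift t) (h *: 1) - f t) @[h --> (0 : R)^'] --> df t.
  apply/cvgrPdist_le => e e0.
  have /cvgrPdist_le/(_ _ e0)/within_nearP[d d0 H] := fdft.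
  near=> h; rewrite /=.
  have -> : h *: 1 + t = h + t :> R by rewrite /GRing.scale/= mulr1.
  have h0 : h != 0 by near: h; exact: nbhs_dnbhs_neq.
  have := H (h + t); rewrite addrK; apply.
  - apply/andP; split.
      rewrite -lerBlDr sub0r -lerN2 opprK.
      apply: le_trans (ler_norm _) _; rewrite normrN ltW//; near: h.
      exact: dnbhs0_lt.
    rewrite -lerBrDr; apply: le_trans (ler_norm _) _; rewrite ltW//; near: h.
    by apply: dnbhs0_lt; rewrite subr_gt0.
  - by rewrite -subr_eq0 addrK.
  - by near: h; exact: dnbhs0_lt.
by apply: DeriveDef; [apply/cvg_ex; exists (df t)|exact: cvg_lim].
Unshelve. all: by end_near. Qed.

Lemma diff_on_cvg f df t : diff_on f df -> 0 <= t <= T ->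
  f s @[s --> within `[0, T] (nbhs t)] --> f t.
Proof.
move=> fdf t0T; apply/cvgrPdist_le => e e0.
have /cvgrPdist_le/(_ _ ltr01)/within_nearP[d d0 H] := fdf _ t0T.
apply/within_near_le; pose D := `|df t| + 1.
have D0 : 0 < D by rewrite ltr_wpDl.
exists (Num.min d (e / D)); first by rewrite lt_min d0 divr_gt0.
move=> s s0T; rewrite lt_min => /andP[sd se].
have [->|st] := eqVneq s t; first by rewrite subrr normr0 ltW.
have st0 : `|s - t| != 0 by rewrite normr_eq0 subr_eq0.
have stp : 0 < `|s - t| by rewrite normr_gt0 subr_eq0.
rewrite distrC; have := H _ s0T st sd; move=> /(le_trans (lerB_dist _ _)).
rewrite lerBlDr => h; have : `|(s - t)^-1 * (f s - f t)| <= D.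
  rewrite /D; have := lerB_dist ((s - t)^-1 * (f s - f t)) (df t); rewrite distrC.
  have := H _ s0T st sd => h1 h2.
  have := le_trans h2 h1; rewrite lerBlDr => h3.
  by rewrite [X in _ <= X]addrC.
rewrite normrM normfV mulrC ler_pdivrMr// => h2.
apply: le_trans h2 _; rewrite mulrC -ler_pdivlMr//; exact: ltW.
Qed.

(** Gronwall for the energy [E], the sum of the squares of [y] and [dy]. Young's inequality bounds
    [E'] by [|y|^2 + 2 |dy|^2 + |ddy|^2], hence by [(2 + K) E + K Z]. With [c = 2 + K] and since
    [expR (- c * s)] is at most 1, [W] is nonincreasing; it vanishes at 0. *)
Lemma second_order_bound n (y dy ddy : 'I_n -> R -> R) (K Z : R) :
  0 <= K -> 0 <= Z ->
  (forall i, diff_on (y i) (dy i)) -> (forall i, diff_on (dy i) (ddy i)) ->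
  (forall t, 0 <= t <= T ->
     sumsq (ddy ^~ t) <= K * (sumsq (y ^~ t) + Z)) ->
  (forall i, y i 0 = 0) -> (forall i, dy i 0 = 0) ->
  forall t, 0 <= t <= T -> sumsq (y ^~ t) <= expR ((2 + K) * T) * (K * T) * Z.
Proof.
move=> K0 Z0 ydy dyddy ddyle y0 dy0 t t0T.
have T0 : 0 <= T by case/andP: t0T; exact: le_trans.
pose c := 2 + K.
pose E : R -> R := \sum_(i < n) (y i * y i + dy i * dy i).
have EE s : E s = sumsq (y ^~ s) + sumsq (dy ^~ s).
  rewrite /E fct_sumE -big_split/=; apply: eq_bigr => i _.
  by rewrite !expr2.
pose W : R -> R := (expR \o (- c) \*: id) * E - (K * Z) \*: id.
have WE s : W s = expR (- c * s) * E s - K * Z * s by [].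
pose dE s := \sum_(i < n) (2 * (y i s * dy i s) + 2 * (dy i s * ddy i s)).
have der s : 0 < s < T ->
    is_derive s 1 W (expR (- c * s) * (dE s - c * E s) - K * Z).
  move=> s0T.
  have dEs : is_derive s 1 E (dE s).
    have di i : is_derive s 1 (y i * y i + dy i * dy i)
        (y i s *: dy i s + y i s *: dy i s + (dy i s *: ddy i s + dy i s *: ddy i s)).
      have d1 := diff_on_is_derive (ydy i) s0T.
      have d2 := diff_on_is_derive (dyddy i) s0T.
      exact: is_deriveD (is_deriveM d1 d1) (is_deriveM d2 d2).
    have := @is_derive_sum _ _ _ n (fun i => y i * y i + dy i * dy i) s 1 _ di.
    move/is_derive_eq; apply; apply: eq_bigr => i _.
    by rewrite /GRing.scale/=; ring.
  have de : is_derive s 1 (expR \o (- c) \*: id) (- c * expR (- c * s)).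
    have d1 : is_derive s 1 ((- c) \*: id) (- c *: (1 : R)) by exact: is_deriveZ.
    apply: is_derive_eq (is_derive1_comp (is_derive_expR _) d1) _.
    by rewrite /GRing.scale/= mulr1 mulrC.
  have d2 : is_derive s 1 ((K * Z) \*: id) (K * Z *: (1 : R)) by exact: is_deriveZ.
  apply: is_derive_eq (is_deriveB (is_deriveM de dEs) d2) _.
  by rewrite /GRing.scale/=; ring.
have dneg s : 0 < s < T -> expR (- c * s) * (dE s - c * E s) - K * Z <= 0.
  move=> /andP[s0 sT]; rewrite subr_le0.
  have sle : 0 <= s <= T by rewrite !ltW.
  have dEle : dE s - c * E s <= K * Z.
    rewrite lerBlDr; apply: (@le_trans _ _ (2 * sumsq (dy ^~ s) + sumsq (y ^~ s) + sumsq (ddy ^~ s))).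
      rewrite /dE /sumsq mulr_sumr -!big_split/=; apply: ler_sum => i _.
      have h1 := sqr_ge0 (y i s - dy i s); have h2 := sqr_ge0 (dy i s - ddy i s).
      by nra.
    have := ddyle _ sle; have := sumsq_ge0 (y ^~ s); have := sumsq_ge0 (dy ^~ s).
    by rewrite EE /c => h1 h2 h3; nra.
  have e0 : 0 < expR (- c * s) by exact: expR_gt0.
  have e1 : expR (- c * s) <= 1.
    by rewrite -expR0 ler_expR mulNr oppr_le0 mulr_ge0 ?(ltW s0)// addr_ge0.
  have KZ : 0 <= K * Z by rewrite mulr_ge0.
  by nra.
(* The monotonicity criterion takes the derivative in the open interval and continuity up to the
   endpoints. *)
have cW : {within `[0, T], continuous W}.
  apply/subspace_continuousP => s; rewrite /= in_itv/= => s0T.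
  have sid : id @ within `[0, T] (nbhs s) --> s by exact: cvg_within.
  have cE : E @ within `[0, T] (nbhs s) --> E s.
    rewrite /E fct_sumE; apply: cvg_sumr => i.
    by apply: cvgD; apply: cvgM; apply: diff_on_cvg s0T; [exact: ydy|exact: ydy|exact: dyddy|exact: dyddy].
  apply: cvgB; last by apply: cvgM => //; exact: cvg_cst.
  apply: cvgM => //.
  apply: (@cvg_comp _ _ _ (fun r => - c * r) expR _ (nbhs (- c * s))); last exact: continuous_expR.
  by apply: cvgM => //; exact: cvg_cst.
have W0t : W t <= W 0.
  have /andP[t0 tT] := t0T.
  apply: (@ler0_derive1_nincr _ W 0 T _ _ cW 0 t (lexx 0) t0 tT).
    by move=> x; rewrite in_itv/= => /der[].
  move=> x; rewrite in_itv/= => x0T; rewrite derive1E.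
  have [_ ->] := der _ x0T; exact: dneg.
have E0 : E 0 = 0.
  rewrite EE /sumsq !big1 ?addr0// => i _; first by rewrite dy0 expr0n.
  by rewrite y0 expr0n.
move: W0t; rewrite !WE E0 !mulr0 subrr subr_le0 => h.
have : E t <= expR (c * t) * (K * Z * t).
  rewrite -ler_pdivrMl ?expR_gt0// -expRN -mulNr//.
move=> hE; apply: (@le_trans _ _ (E t)); first by rewrite EE lerDl sumsq_ge0.
apply: le_trans hE _.
have /andP[tge0 tle] := t0T.
have -> : expR ((2 + K) * T) * (K * T) * Z = expR (c * T) * (K * Z * T) by rewrite /c; ring.
have KZ : 0 <= K * Z by rewrite mulr_ge0.
apply: (@le_trans _ _ (expR (c * T) * (K * Z * t))).
  by rewrite ler_wpM2r ?mulr_ge0// ler_expR ler_wpM2l// addr_ge0.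
by rewrite ler_wpM2l ?expR_ge0// ler_wpM2l.
Qed.

End WithinDerivative.

Lemma sqr_cvg0 (R : realType) (S : Type) (F : set_system S) (FF : Filter F) (u : S -> R) :
  u x ^+ 2 @[x --> F] --> 0 -> u x @[x --> F] --> 0.
Proof.
move=> /cvgrPdist_le u0; apply/cvgrPdist_le => e e0.
have := u0 _ (exprn_gt0 2 e0); apply: filterS => x; rewrite !sub0r !normrN normrX.
have e00 := ltW e0; have := normr_ge0 (u x); nra.
Qed.

Lemma cvg_of_sub0 (R : realType) (S : Type) (F : set_system S) (FF : Filter F)
    (u : S -> R) (l : R) :
  u x - l @[x --> F] --> 0 -> u x @[x --> F] --> l.
Proof.
move=> ul; have : (u x - l) + l @[x --> F] --> 0 + l by apply: cvgD => //; exact: cvg_cst.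
by rewrite add0r; under eq_fun do rewrite subrK.
Qed.

(** * Limits in a semi-inner product *)

Section FormLimits.
Variables (R : realType) (U : lmodType R) (D : set U) (B : U -> U -> R).
Hypothesis DB : semi_inner D B.
Variables (S : Type) (F : set_system S) (FF : Filter F).

Lemma form_cvg0 (d : S -> U) w : (\forall x \near F, D (d x)) -> D w ->
  B (d x) (d x) @[x --> F] --> 0 -> B (d x) w @[x --> F] --> 0.
Proof.
move=> Dd Dw d0; apply: sqr_cvg0.
apply: (@squeeze_cvgr _ _ _ _ (fun=> 0) (fun x => B (d x) (d x) * B w w)).
- by apply: filterS Dd => x Dx; rewrite sqr_ge0/= (form_CS DB).
- exact: cvg_cst.
- by rewrite -(mul0r (B w w)); apply: cvgM => //; exact: cvg_cst.
Qed.

Lemma form_cvg (v : S -> U) l w : (\forall x \near F, D (v x)) -> D l -> D w ->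
  B (v x - l) (v x - l) @[x --> F] --> 0 -> B (v x) w @[x --> F] --> B l w.
Proof.
move=> Dv Dl Dw vl; apply: cvg_of_sub0.
have Dvl : \forall x \near F, D (v x - l).
  by apply: filterS Dv => x Dx; exact: lin_closedB (form_lin_closed DB) _ _.
have := form_cvg0 Dvl Dw vl; apply: cvg_trans; apply: near_eq_cvg.
by apply: filterS Dv => x Dx; rewrite (formBl DB).
Qed.

Lemma form_cvg_sq (v : S -> U) l : (\forall x \near F, D (v x)) -> D l ->
  B (v x - l) (v x - l) @[x --> F] --> 0 -> B (v x) (v x) @[x --> F] --> B l l.
Proof.
move=> Dv Dl vl; apply: cvg_of_sub0.
have := form_cvg Dv Dl Dl vl => h.
have : B (v x - l) (v x - l) + 2 * (B (v x) l - B l l) @[x --> F] --> (0 + 2 * (B l l - B l l) : R).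
  by apply: cvgD => //; apply: cvgM; [exact: cvg_cst|apply: cvgB => //; exact: cvg_cst].
rewrite subrr mulr0 addr0; apply: cvg_trans; apply: near_eq_cvg.
by apply: filterS Dv => x Dx; rewrite (formBB DB)//; ring.
Qed.

End FormLimits.

(** * Boundary signals and their weak time derivatives *)

Section BochnerL2.
Context {R : realType} {disp : measure_display} {Y : measurableType disp}.
Variables (T : R) (mu : {measure set Y -> \bar R}) (X : set (Y -> R)).
Hypothesis XL2 : X `<=` L2 mu.
Local Notation leb := (@lebesgue_measure R).
Local Notation DB := (semi_inner_L2 mu).

Lemma ip_sqB (f g : Y -> R) : \int[mu]_y ((f y - g y) ^+ 2) = ip mu (f - g) (f - g).
Proof. by rewrite ip_sq. Qed.

Lemma simple_in_timeE (s : R -> Y -> R) : simple_in_time X s ->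
  exists (m : nat) (A : 'I_m -> set R) (v : 'I_m -> Y -> R),
    [/\ forall k, measurable (A k), forall k, X (v k) &
        forall t, s t = \sum_(k < m) \1_(A k) t *: v k].
Proof.
move=> [m [A [v [Av sE]]]]; exists m, A, v; split => [k|k|t]; [exact: (Av k).1|exact: (Av k).2|].
by apply/funext => y; rewrite sE fct_sumE.
Qed.

Lemma simple_in_time_L2 s t : simple_in_time X s -> L2 mu (s t).
Proof.
move=> /simple_in_timeE[m [A [v [mA Xv ->]]]].
by apply: lin_closed_sum (L2_lin_closed mu) _ => k; exact/XL2/Xv.
Qed.

Lemma measurable_simple_ip s w : simple_in_time X s -> L2 mu w ->
  measurable_fun setT (fun t => ip mu (s t) w).
Proof.
move=> /simple_in_timeE[m [A [v [mA Xv sE]]]] w2.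
rewrite (_ : (fun _ => _) = fun t => \sum_(k < m) \1_(A k) t * ip mu (v k) w).
  apply: measurable_sum => k; apply: measurable_funM => //.
by apply/funext => t; rewrite sE (form_suml DB)// => k; exact/XL2/Xv.
Qed.

Lemma measurable_simple_sq s : simple_in_time X s ->
  measurable_fun setT (fun t => ip mu (s t) (s t)).
Proof.
move=> ss; have s2 t := simple_in_time_L2 t ss.
have [m [A [v [mA Xv sE]]]] := simple_in_timeE ss.
rewrite (_ : (fun _ => _) = fun t => \sum_(k < m) \1_(A k) t * ip mu (s t) (v k)).
  apply: measurable_sum => k; apply: measurable_funM; first exact: measurable_indic.
  by apply: measurable_simple_ip => //; exact/XL2/Xv.
apply/funext => t; rewrite {2}sE (form_sumr DB)// => k; exact/XL2/Xv.
Qed.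

Lemma bochner_ip_cvg (s : nat -> R -> Y -> R) z t w :
  (forall k, simple_in_time X (s k)) -> L2 mu (z t) -> L2 mu w ->
  \int[mu]_y ((s k t y - z t y) ^+ 2) @[k --> \oo] --> (0 : R) ->
  ip mu (s k t) w @[k --> \oo] --> ip mu (z t) w.
Proof.
move=> ss z2 w2 sz; apply: (form_cvg DB) => //.
by apply: nearW => k; exact: simple_in_time_L2.
Qed.

Lemma bochner_L2_measurable_ip z w : bochner_L2 T mu X z -> L2 mu w ->
  measurable_fun `[0, T] (fun t => ip mu (z t) w).
Proof.
move=> [Xz [s ss sz] _] w2.
apply: (@measurable_fun_cvg _ _ _ _ (fun k t => ip mu (s k t) w)).
- by move=> k; apply: measurable_funTS; exact: measurable_simple_ip.
- move=> t; rewrite /= in_itv/= => t0T; apply: bochner_ip_cvg => //; last exact: sz.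
  exact/XL2/Xz.
Qed.

Lemma bochner_L2_measurable_sq z : bochner_L2 T mu X z ->
  measurable_fun `[0, T] (fun t => ip mu (z t) (z t)).
Proof.
move=> [Xz [s ss sz] _].
apply: (@measurable_fun_cvg _ _ _ _ (fun k t => ip mu (s k t) (s k t))).
- by move=> k; apply: measurable_funTS; exact: measurable_simple_sq.
- move=> t; rewrite /= in_itv/= => t0T; apply: (form_cvg_sq DB).
  + by apply: nearW => k; exact: simple_in_time_L2.
  + exact/XL2/Xz.
  + by have := sz _ t0T; under eq_fun do rewrite ip_sqB.
Qed.

End BochnerL2.

Section TimeSignals.
Variables (R : realType) (T : R).
Local Notation leb := (@lebesgue_measure R).

(** Elements of L2(0,T) extended by zero, so that the L2 theory on the whole line applies without
    restricting the measure. *)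
Definition signal : set (R -> R) :=
  [set g | L2 leb g /\ forall t, ~ `[0, T]%classic t -> g t = 0].

Lemma signal_lin_closed : lin_closed signal.
Proof.
split; first by split => //; exact: (L2_lin_closed leb).1.
move=> a u v [u2 u0] [v2 v0]; split; first exact: (L2_lin_closed leb).2.
move=> t tT; rewrite -[LHS]/(a * u t + v t).
by rewrite u0// v0// mulr0 addr0.
Qed.

Definition prim (g : R -> R) (t : R) : R := \int[leb]_(r in `[0, t]) g r.

Lemma primE g t : prim g t = ip leb g \1_`[0, t].
Proof. by rewrite ip_indic. Qed.

Lemma primDZ a g h t : L2 leb g -> L2 leb h ->
  prim (a *: g + h) t = a * prim g t + prim h t.
Proof.
move=> g2 h2; rewrite !primE (formDZl (semi_inner_L2 leb))//.
exact: L2_itv.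
Qed.

Lemma prim_sum n (c : 'I_n -> R) (g : 'I_n -> R -> R) t : (forall j, L2 leb (g j)) ->
  prim (\sum_(j < n) c j *: g j) t = \sum_(j < n) c j * prim (g j) t.
Proof.
move=> g2; rewrite primE (form_suml (semi_inner_L2 leb))//; last exact: L2_itv.
by apply: eq_bigr => j _; rewrite primE.
Qed.

Lemma prim0 g : prim g 0 = 0.
Proof. by rewrite /prim set_itv1 Rintegral_set1. Qed.

(** Cauchy-Schwarz against the indicator of [[0, t]], whose squared norm is [t]. *)
Lemma prim_sqr_le g t : 0 <= t <= T -> L2 leb g -> prim g t ^+ 2 <= T * ip leb g g.
Proof.
move=> /andP[t0 tT] g2; rewrite primE.
apply: le_trans (form_CS (semi_inner_L2 leb) g2 (L2_itv _ _)) _.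
rewrite mulrC ler_wpM2r ?(form_ge0 (semi_inner_L2 leb))//.
rewrite ip_indic (@eq_Rintegral _ _ _ _ _ (fun=> 1)); last first.
  by move=> r rt; rewrite indicE rt.
rewrite Rintegral_cst; last exact: measurable_itv.
rewrite mul1r [X in fine X]lebesgue_measure_itv/= lte_fin.
by case: ifPn => //= _; rewrite ?sube0 ?subr0//; apply: le_trans tT.
Qed.

Lemma signal_ip g : signal g -> ip leb g g = \int[leb]_(t in `[0, T]) (g t ^+ 2).
Proof.
move=> [_ g0]; rewrite ip_sq [RHS]Rintegral_mkcond; apply: eq_Rintegral => t _.
rewrite patchE; case: ifPn => // /negP tT; rewrite g0 ?expr0n//.
by move=> tT'; apply: tT; rewrite inE.
Qed.

Lemma signal_int g : signal g -> (\int[leb]_(t in `[0%R, T]) (g t ^+ 2)%:E < +oo)%E.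
Proof.
move=> [g2 g0]; apply: le_lt_trans (L2_sq_lty g2).
apply: ge0_subset_integral => //.
- by apply/measurable_EFinP; apply: measurable_funX; exact: (L2_measurable g2).
- by move=> t _; rewrite lee_fin sqr_ge0.
Qed.

End TimeSignals.

Section Combinations.
Variables (R : realType) (Y : Type) (n : nat) (e : 'I_n -> Y -> R).

Definition comb (c : 'I_n -> R) : Y -> R := \sum_(j < n) c j *: e j.

Definition signal_curve (g : 'I_n -> R -> R) (t : R) : Y -> R :=
  comb (fun j => prim (g j) t).

Definition signal_deriv (g : 'I_n -> R -> R) (t : R) : Y -> R :=
  comb (fun j => g j t).

End Combinations.

Section WeakDerivative.
Import HBSimple.
Context {R : realType} {disp : measure_display} {Y : measurableType disp}.
Variables (T : R) (mu : {measure set Y -> \bar R}) (X X0 : set (Y -> R)).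
Hypothesis XL2 : X `<=` L2 mu.
Hypotheses (X0l : lin_closed X0) (X0X : X0 `<=` X).
Variables (n : nat) (e : 'I_n -> Y -> R).
Hypotheses (X0e : forall j, X0 (e j))
  (eo : forall i j, ip mu (e i) (e j) = (i == j)%:R).
Local Notation leb := (@lebesgue_measure R).
Local Notation DB := (semi_inner_L2 mu).

Let e2 j : L2 mu (e j). Proof. exact/XL2/X0X/X0e. Qed.

Local Notation comb := (comb e).
Local Notation signal_curve := (signal_curve e).
Local Notation signal_deriv := (signal_deriv e).

(** Two sets are kept apart: [X] is where weak derivatives take their values and where the tests
    live, with no linear structure assumed, while combinations of the [e j] are formed in the
    linearly closed [X0]. They will be [L20] and the mesh space. *)
Lemma comb_X0 c : X0 (comb c). Proof. exact: lin_closed_sum. Qed.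

Lemma comb_L2 c : L2 mu (comb c). Proof. exact/XL2/X0X/comb_X0. Qed.

Lemma combB c c' : comb c - comb c' = comb (fun j => c j - c' j).
Proof.
rewrite /comb -sumrB; apply: eq_bigr => j _.
by rewrite scalerBl.
Qed.

Lemma ip_comb_basis c i : ip mu (comb c) (e i) = c i.
Proof.
rewrite /comb (form_suml DB)// (bigD1 i)//= eo eqxx mulr1 big1 ?addr0// => j ji.
by rewrite eo (negbTE ji) mulr0.
Qed.

Lemma ip_comb c : ip mu (comb c) (comb c) = sumsq c.
Proof.
rewrite {2}/comb (form_sumr DB)//; last exact: comb_L2.
by apply: eq_bigr => j _; rewrite ip_comb_basis expr2.
Qed.

Lemma simple_in_time_sum m (s : 'I_m -> R -> Y -> R) :
  (forall j, simple_in_time X (s j)) ->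
  simple_in_time X (fun t y => \sum_(j < m) s j t y).
Proof.
elim: m s => [|m ih] s ss.
  exists 0%N, (fun _ => set0), (fun _ => 0); split; first by case.
  by move=> t y; rewrite !big_ord0.
have [m1 [A1 [v1 [Av1 s1E]]]] := ih (fun j => s (lift ord0 j)) (fun j => ss _).
have [m2 [A2 [v2 [Av2 s2E]]]] := ss ord0.
exists (m2 + m1)%N, (fun k => match fintype.split k with inl i => A2 i | inr i => A1 i end),
  (fun k => match fintype.split k with inl i => v2 i | inr i => v1 i end); split.
  by move=> k; case: (fintype.split k).
move=> t y; rewrite big_ord_recl s2E s1E big_split_ord/=; congr (_ + _).
  by apply: eq_bigr => i _; rewrite (unsplitK (inl i)).
by apply: eq_bigr => i _; rewrite (unsplitK (inr i)).
Qed.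

Lemma simple_in_time_sfun (h : {sfun (measurableTypeR R) >-> R}) j :
  simple_in_time X (fun t y => h t * e j y).
Proof.
pose s : seq R := finmap.enum_fset (fset_set (range h)).
exists (size s), (fun k => h @^-1` [set nth 0 s k]), (fun k => nth 0 s k *: e j); split.
  move=> k; split; last by apply: X0X; exact: lin_closedZ.
  rewrite -[X in measurable X]setTI.
  exact: (@measurable_funP1 _ (measurableTypeR R)).
move=> t y; rewrite {1}(fimfunE h t) fsbig_finite//= -/s mulr_suml.
rewrite (big_nth 0) big_mkord; apply: eq_bigr => k _.
transitivity (\1_(h @^-1` [set nth 0 s k]) t * (nth 0 s k * e j y)); first by ring.
by [].
Qed.

(** Orthonormality turns the distance between two combinations into the sum of the squared
    differences of their coefficients. Hence it suffices to approximate each scalar [g j] by simple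
    functions that converge at every time. *)
Lemma signal_deriv_bochner g : (forall j, signal T (g j)) ->
  bochner_L2 T mu X (signal_deriv g).
Proof.
move=> gs; split.
- by move=> t _; exact/X0X/comb_X0.
- have /choice[h hg] j : exists h : {sfun (measurableTypeR R) >-> R}^nat,
      forall t, h k t @[k --> \oo] --> g j t.
    have mg : measurable_fun (@setT (measurableTypeR R)) (EFin \o g j).
      by apply/measurable_EFinP; exact: (L2_measurable (gs j).1).
    have [h hg] := approximation_sfun measurableT mg.
    exists h => t; have := hg t I.
    by move/fine_cvgP => [_].
  exists (fun k t y => \sum_(j < n) h j k t * e j y).
    by move=> k; apply: simple_in_time_sum => j; exact: simple_in_time_sfun.
  move=> t _; have E k : \int[mu]_y ((\sum_(j < n) h j k t * e j y - signal_deriv g t y) ^+ 2) =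
      \sum_(j < n) (h j k t - g j t) ^+ 2.
    rewrite ip_sqB -[RHS]ip_comb -combB; congr ip; congr (_ - _);
    by rewrite /comb fct_sumE.
  under eq_fun do rewrite E.
  suff H : \sum_(j < n) (h j k t - g j t) ^+ 2 @[k --> \oo] --> \sum_(j < n) (0 : R).
    by rewrite big1 in H.
  apply: cvg_sumr => j; rewrite -(mulr0 (0 : R)) -(subrr (g j t)) -expr2.
  have c : h j k t - g j t @[k --> \oo] --> g j t - g j t.
    by apply: cvgB; [exact: hg|exact: cvg_cst].
  by under eq_fun do rewrite expr2; exact: cvgM.
- under eq_integral => t _ do rewrite -ip_sq ip_comb /sumsq -sumEFin.
  rewrite ge0_integral_sum//; last 2 first.
  + move=> j; apply/measurable_EFinP/measurable_funX; apply: measurable_funTS.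
    exact: (L2_measurable (gs j).1).
  + by move=> j t _; rewrite lee_fin sqr_ge0.
  by apply: lte_sum_pinfty => j _; exact: signal_int.
Qed.

Lemma signal_curve_weak_derivative g : (forall j, signal T (g j)) ->
  weak_time_derivative T mu X (signal_curve g) (signal_deriv g).
Proof.
move=> gs; split.
- by move=> t _; exact/X0X/comb_X0.
- exact: signal_deriv_bochner.
- move=> t t0T w Xw; have w2 := XL2 Xw.
  rewrite -![Rintegral mu _ _]/(ip mu _ _).
  rewrite (form_suml DB)// (form_suml DB)// [X in _ = X + _]big1 ?add0r; last first.
    by move=> j _; rewrite prim0 mul0r.
  have -> : (fun r => \int[mu]_y (signal_deriv g r y * w y)) =
      \sum_(j < n) ip mu (e j) w *: g j.
    apply/funext => r; rewrite fct_sumE -[LHS]/(ip mu (signal_deriv g r) w).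
    by rewrite (form_suml DB)//; apply: eq_bigr => j _; rewrite mulrC.
  rewrite -[RHS]/(prim _ t) prim_sum; last by move=> j; exact: (gs j).1.
  by apply: eq_bigr => j _; rewrite mulrC.
Qed.

Lemma indic_out (t : R) : ~ `[0, T]%classic t -> \1_(`[0, T]%classic) t = 0 :> R.
Proof. by move=> tT; rewrite indicE memNset. Qed.

Lemma indic_in (t : R) : 0 <= t <= T -> \1_(`[0, T]%classic) t = 1 :> R.
Proof. by move=> tT; rewrite indicE mem_set//= in_itv. Qed.

(** The square is dominated by [ip mu w w * ip mu (dz t) (dz t)], which is integrable over the
    interval by the Bochner condition. *)
Lemma bochner_signal dz w : bochner_L2 T mu X dz -> L2 mu w ->
  signal T (fun t => \1_(`[0, T]%classic) t * ip mu (dz t) w).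
Proof.
move=> bdz w2; have [Xdz _ dzoo] := bdz.
have mw : measurable_fun setT (fun t => \1_(`[0, T]%classic) t * ip mu (dz t) w).
  have := bochner_L2_measurable_ip XL2 bdz w2.
  move/(measurable_restrictT _ (measurable_itv _)).1; apply: eq_measurable_fun => t _.
  by rewrite patchE indicE; case: ifPn => _; rewrite ?mul1r ?mul0r.
split; last by move=> t tT; rewrite indic_out// mul0r.
apply: L2_intro => //.
pose N t := \1_(`[0, T]%classic) t * ip mu (dz t) (dz t).
have mN : measurable_fun setT N.
  have := bochner_L2_measurable_sq XL2 bdz.
  move/(measurable_restrictT _ (measurable_itv _)).1; apply: eq_measurable_fun => t _.
  by rewrite patchE /N indicE; case: ifPn => _; rewrite ?mul1r ?mul0r.
have ww0 := form_ge0 DB w2.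
have N0 t : 0 <= N t.
  rewrite /N; have [tT|tT] := pselect (`[0, T]%classic t); last by rewrite indic_out ?mul0r.
  move: tT; rewrite /= in_itv/= => tT.
  by rewrite indic_in// mul1r (form_ge0 DB)//; exact/XL2/Xdz.
apply: (@le_lt_trans _ _ (\int[leb]_t ((ip mu w w)%:E * (N t)%:E))%E).
  apply: ge0_le_integral => //.
  - by move=> t _; rewrite lee_fin sqr_ge0.
  - by apply/measurable_EFinP; exact: measurable_funX.
  - by apply: measurable_funeM; exact/measurable_EFinP.
  - move=> t _; rewrite -EFinM lee_fin /N.
    have [tT|tT] := pselect (`[0, T]%classic t); last first.
      by rewrite indic_out// !mul0r expr0n mulr0.
    move: tT; rewrite /= in_itv/= => tT.
    by rewrite indic_in// !mul1r mulrC (form_CS DB)//; exact/XL2/Xdz.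
rewrite ge0_integralZl_EFin//; last 2 first.
- by move=> t _; rewrite lee_fin.
- exact/measurable_EFinP.
apply: lte_mul_pinfty => //.
apply: le_lt_trans dzoo; rewrite [leRHS]integral_mkcond le_eqVlt; apply/orP; left; apply/eqP.
apply: eq_integral => t _; rewrite patchE /N indicE ip_sq.
by case: ifPn => _; rewrite ?mul1r ?mul0r.
Qed.

Lemma prim_indic f t : 0 <= t <= T ->
  prim (fun r => \1_(`[0, T]%classic) r * f r) t = \int[leb]_(r in `[0, t]) f r.
Proof.
move=> /andP[t0 tT]; apply: eq_Rintegral => r; rewrite inE/= in_itv/= => /andP[r0 rt].
by rewrite indic_in ?mul1r// r0 (le_trans rt tT).
Qed.

(** Tested against [e j], the weak derivative identity says that the j-th coordinate of [z] is the
    primitive of the j-th coordinate of [dz]. *)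
Lemma weak_derivative_signal z dz : weak_time_derivative T mu X z dz ->
  z 0 = (fun=> 0) %[ae mu] ->
  (forall t, 0 <= t <= T -> z t = comb (fun j => ip mu (z t) (e j)) %[ae mu]) ->
  0 <= T ->
  let g j t := \1_(`[0, T]%classic) t * ip mu (dz t) (e j) in
  (forall j, signal T (g j)) /\
  forall t, 0 <= t <= T -> z t = signal_curve g t %[ae mu].
Proof.
move=> [Xz bdz zdz] z0 zc T0 g; split; first by move=> j; exact: bochner_signal.
move=> t tT; have := zc t tT; suff -> : (fun j => ip mu (z t) (e j)) = (fun j => prim (g j) t) by [].
apply/funext => j; have := zdz _ tT (e j) (X0X (X0e j)).
rewrite -[LHS]/(ip mu (z t) (e j)) -/(ip mu (z 0) (e j)) => ->.
have Xz0 : X (z 0) by apply: Xz; rewrite lexx.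
rewrite (ip_ael (XL2 Xz0) (L2_lin_closed mu).1 (e2 j) z0) (form0l DB (e2 j)) add0r.
by rewrite prim_indic.
Qed.

(** [dz] may be any weak derivative and takes its values in [X], not in the span of the [e j]. The
    point is that [dz t - signal_deriv g t] is orthogonal to [dz t] itself for almost every [t]. *)
Lemma weak_derivative_unique z dz g : 0 <= T -> weak_time_derivative T mu X z dz ->
  (forall j, signal T (g j)) ->
  (forall t, 0 <= t <= T -> z t = signal_curve g t %[ae mu]) ->
  {ae leb, forall t, 0 <= t <= T -> ip mu (dz t) (dz t) = sumsq (g ^~ t)}.
Proof.
move=> T0 [Xz bdz zdz] gs zg.
have [Xdg bdg gdg] := signal_curve_weak_derivative gs.
have [Xdz [s ss sdz] _] := bdz.
(* For a fixed [w] the two scalar derivatives have the same primitive; the null set of times depends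
   on [w]. *)
have test w : X w -> {ae leb, forall t, 0 <= t <= T ->
    ip mu (dz t) w = ip mu (signal_deriv g t) w}.
  move=> Xw; have w2 := XL2 Xw.
  pose F1 t := \1_(`[0, T]%classic) t * ip mu (dz t) w.
  pose F2 t := \1_(`[0, T]%classic) t * ip mu (signal_deriv g t) w.
  have s1 : signal T F1 by exact: bochner_signal.
  have s2 : signal T F2 by apply: bochner_signal => //; exact: signal_deriv_bochner.
  have [F12 F0] := lin_closedB (@signal_lin_closed _ T) s1 s2.
  have prim0 t : 0 <= t <= T -> \int[leb]_(r in `[0, t]) (F1 - F2) r = 0.
    move=> tT; rewrite -/(prim _ t) primE (formBl (semi_inner_L2 leb) s1.1 s2.1); last exact: L2_itv.
    rewrite -!primE !prim_indic//.
    have z0T : 0 <= (0 : R) <= T by rewrite lexx.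
    have h1 := zdz _ tT _ Xw; have h2 := gdg _ tT _ Xw.
    have ip1 r : 0 <= r <= T -> \int[mu]_y (z r y * w y) = \int[mu]_y (signal_curve g r y * w y).
      by move=> rT; apply: (ip_ael _ _ w2 (zg r rT)); [exact/XL2/Xz|exact/XL2/Xdg].
    by move: h1; rewrite !ip1// h2 => /addrI ->; rewrite subrr.
  have := zero_primitive_ae0 F12 F0 prim0.
  apply: aeS => t /(_ I) h tT; apply/eqP; rewrite -subr_eq0; apply/eqP.
  by move: h; rewrite -[LHS]/(F1 t - F2 t) /F1 /F2 indic_in// !mul1r.
have dz2 t : 0 <= t <= T -> L2 mu (dz t) by move=> tT; exact/XL2/Xdz.
have dg2 t : L2 mu (signal_deriv g t) by exact: comb_L2.
(* The simple functions approximating [dz] have finitely many values each, so countably many tests,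
   and a single null set, are enough. *)
have sk k : {ae leb, forall t, 0 <= t <= T -> ip mu (s k t) (dz t - signal_deriv g t) = 0}.
  have [m [A [v [_ Xv sE]]]] := simple_in_timeE (ss k).
  have /ae_ord := fun l => test _ (Xv l).
  apply: aeS => t tv tT; rewrite sE (form_suml DB); last 2 first.
  - by move=> l; exact/XL2/Xv.
  - by apply: lin_closedB (L2_lin_closed mu) _ _ => //; exact: dz2.
  rewrite big1// => l _; rewrite L2_mulC (formBl DB)//; [|exact: dz2|exact/XL2/Xv].
  by rewrite tv// subrr mulr0.
have te : {ae leb, forall t, forall j, 0 <= t <= T ->
    ip mu (dz t) (e j) = ip mu (signal_deriv g t) (e j)}.
  by have /ae_ord := fun j => test _ (X0X (X0e j)).
have /ae_foralln sk' := sk.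
apply: aeS2 sk' te => t {}sk te tT.
have gdz : ip mu (dz t) (signal_deriv g t) = sumsq (g ^~ t).
  rewrite /signal_deriv /comb (form_sumr DB)//; last exact: dz2.
  by apply: eq_bigr => j _; rewrite te// ip_comb_basis expr2.
(* Limit in [k] of the orthogonality of [s k t] to the difference. *)
have dd : ip mu (dz t) (dz t - signal_deriv g t) = 0; last first.
  by rewrite -gdz; apply/eqP; rewrite -subr_eq0 -(formBr DB) ?dd//; exact: dz2.
have := bochner_ip_cvg XL2 ss (dz2 t tT) (lin_closedB (L2_lin_closed mu) (dz2 t tT) (dg2 t)) (sdz t tT).
under eq_fun do rewrite sk//.
move=> h; rewrite -(cvg_lim (@Rhausdorff R) h).
by apply: cvg_lim; [exact: Rhausdorff|exact: cvg_cst].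
Qed.

End WeakDerivative.

Lemma Rintegral_ae_ge0 {disp : measure_display} {Y : measurableType disp} {R : realType}
    (mu : {measure set Y -> \bar R}) (f : Y -> R) :
  measurable_fun setT f -> {ae mu, forall y, 0 <= f y} -> 0 <= \int[mu]_y f y.
Proof.
move=> mf f0; rewrite (ae_eq_Rintegral (g := fun y => `|f y|) mf).
- by apply: Rintegral_ge0 => y _.
- exact: measurableT_comp.
- by apply: aeS f0 => y fy _; rewrite ger0_norm.
Qed.

Lemma Rintegral_ae_eq0 {disp : measure_display} {Y : measurableType disp} {R : realType}
    (mu : {measure set Y -> \bar R}) (f : Y -> R) :
  mu.-integrable setT (EFin \o f) -> {ae mu, forall y, 0 <= f y} ->
  \int[mu]_y f y = 0 -> f = (fun=> 0) %[ae mu].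
Proof.
move=> intf f0 If0; have mf : measurable_fun setT f.
  by apply/measurable_EFinP; exact: measurable_int intf.
have : (\int[mu]_y `|(f y)%:E| = 0)%E.
  rewrite (ae_eq_integral (fun y => (f y)%:E))//.
  - have := integrable_fin_num measurableT intf; move=> /fineK <-.
    by rewrite -[X in X%:E]/(\int[mu]_y f y) If0.
  - by apply: measurableT_comp => //; exact/measurable_EFinP.
  - exact/measurable_EFinP.
  - by apply: aeS f0 => y fy _; rewrite gee0_abs.
move/(ae_eq_integral_abs _ measurableT (measurable_int mu intf)).1.
by apply: aeS => y /(_ I) [].
Qed.

Lemma L2_sum {disp : measure_display} {Y : measurableType disp} {R : realType}
    (mu : {measure set Y -> \bar R}) (I : Type) (s : seq I) (f : I -> Y -> R) :
  (forall k, L2 mu (f k)) -> L2 mu (fun y => \sum_(k <- s) f k y).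
Proof.
move=> f2; have [l0 ll] := L2_lin_closed mu.
elim: s => [|k s ih].
  by under eq_fun do rewrite big_nil.
under eq_fun do rewrite big_cons.
exact: (lin_closedD (L2_lin_closed mu) (f2 k) ih).
Qed.

Lemma ip_sum {disp : measure_display} {Y : measurableType disp} {R : realType}
    (mu : {measure set Y -> \bar R}) (I : Type) (s : seq I) (f g : I -> Y -> R) :
  (forall k, L2 mu (f k)) -> (forall k, L2 mu (g k)) ->
  \int[mu]_y (\sum_(k <- s) f k y * g k y) = \sum_(k <- s) ip mu (f k) (g k) /\
  mu.-integrable setT (EFin \o (fun y => \sum_(k <- s) f k y * g k y)).
Proof.
move=> f2 g2; elim: s => [|i s [ihE ihI]].
  split.
    rewrite big_nil (@eq_Rintegral _ _ _ _ _ (fun=> 0)); last by move=> x _; rewrite big_nil.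
    by rewrite /Rintegral integral0.
  apply: eq_integrable (@integrable0 _ _ _ mu setT) => // x _.
  by rewrite /= big_nil.
have iI := L2_int (f2 i) (g2 i).
split.
  rewrite big_cons -ihE /ip -RintegralD//.
  by apply: eq_Rintegral => x _; rewrite big_cons.
have := integrableD measurableT iI ihI; apply: eq_integrable => // x _.
by rewrite /= big_cons.
Qed.

(** * Linear spans *)

Section LinearSpan.
Variables (R : realType) (U : lmodType R).

(** Given by its universal property, which serves as an induction principle: a linearly closed
    property passes from [A] to its span by choosing [S]. *)
Definition lspan (A : set U) : set U :=
  [set v | forall S, lin_closed S -> A `<=` S -> S v].

Lemma lspan_lin_closed A : lin_closed (lspan A).
Proof.
split; first by move=> S [S0 _] _.
move=> a u v uA vA S Sl AS; have [_] := Sl; apply; [exact: uA|exact: vA].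
Qed.

Lemma sub_lspan A : A `<=` lspan A. Proof. by move=> v Av S _; exact. Qed.

Lemma lspan_sub A S : lin_closed S -> A `<=` S -> lspan A `<=` S.
Proof. by move=> Sl AS v; exact. Qed.

End LinearSpan.

(** * The mass product and the piezoelectric form *)

Section Mass.
Variables (R : realType) (d : nat) (Omega : set 'rV[R]_d).
Local Notation V := 'rV[R]_d.
Local Notation vol := (volume Omega).
Local Notation vjet := (vjet R d).
Local Notation jet := (jet R d).
Local Notation DB := (semi_inner_L2 vol).

(** No weak derivative links the two components: the forms need only square integrability, and
    closure under linear combinations is then immediate. *)
Definition L2jet : set jet :=
  [set v | L2 vol v.1 /\ forall i, L2 vol (v.2 i)].

Definition L2vjet : set vjet := [set u | forall i, L2jet (u i)].

Lemma L2jet_lin_closed : lin_closed L2jet.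
Proof.
have [l0 ll] := L2_lin_closed vol.
split; first by split=> [|i]; exact: l0.
move=> a u v [u1 u2] [v1 v2]; split=> [|i].
  exact: (ll a u.1 v.1 u1 v1).
exact: (ll a (u.2 i) (v.2 i) (u2 i) (v2 i)).
Qed.

Lemma L2vjet_lin_closed : lin_closed L2vjet.
Proof.
have [l0 ll] := L2jet_lin_closed.
by split=> [i|a u v hu hv i]; [exact: l0|exact: ll].
Qed.

Lemma H1_L2jet v : H1 Omega v -> L2jet v.
Proof. by move=> [v1 v2 _]; split. Qed.

Variables (rho : V -> R) (hrho : admissible_density Omega rho).

Lemma L2_rho f : L2 vol f -> L2 vol (fun x => rho x * f x).
Proof. by move=> f2; apply: L2_bounded_mul => //; case: hrho. Qed.

Lemma massE u w : L2vjet u -> L2vjet w ->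
  mass Omega rho u w = \sum_(i < d) ip vol (fun x => rho x * (u i).1 x) (w i).1.
Proof.
move=> hu hw; have [<- _] := ip_sum (index_enum 'I_d) (fun i => L2_rho (hu i).1) (fun i => (hw i).1).
apply: eq_Rintegral => x _; rewrite mulr_sumr; apply: eq_bigr => i _.
by rewrite mulrA.
Qed.

Lemma semi_inner_mass : semi_inner L2vjet (mass Omega rho).
Proof.
have [_ [rho0 rho0p hrho0]] := hrho.
split=> [|u v hu hv|a u v w hu hv hw|u hu].
- exact: L2vjet_lin_closed.
- apply: eq_Rintegral => x _; congr (_ * _).
  by apply: eq_bigr => i _; rewrite mulrC.
- have huv : L2vjet (a *: u + v) by exact: L2vjet_lin_closed.2.
  rewrite !massE// mulr_sumr -big_split/=; apply: eq_bigr => i _.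
  rewrite -(formDZl DB)//; last 3 first.
  + exact: L2_rho (hu i).1.
  + exact: L2_rho (hv i).1.
  + exact: (hw i).1.
  congr (ip _ _ _); apply/funext => x.
  transitivity (rho x * (a * (u i).1 x + (v i).1 x)); first by [].
  by rewrite mulrDr mulrCA.
- rewrite massE//; apply: sumr_ge0 => i _; apply: Rintegral_ae_ge0.
    exact: measurable_funM (L2_measurable (L2_rho (hu i).1)) (L2_measurable (hu i).1).
  apply: aeS hrho0 => x hx; rewrite -mulrA -expr2 mulr_ge0// ?sqr_ge0//.
  exact: le_trans (ltW rho0p) hx.
Qed.

(** Time regularity is stated in the H^1 norm and used in the mass form; the essential bound of
    [rho] connects the two. *)
Lemma mass_bound : exists2 M : R, 0 <= M &
  forall u, L2vjet u -> mass Omega rho u u <= M * vh1norm Omega u ^+ 2.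
Proof.
have [rhooo _] := hrho; have [mrho [M M0 hM]] := Linfty_bounded rhooo.
exists M => // u hu; rewrite /vh1norm sqr_sqrtr; last first.
  apply: sumr_ge0 => i _; apply: addr_ge0.
    by apply: Rintegral_ge0 => x _; exact: sqr_ge0.
  by apply: sumr_ge0 => j _; apply: Rintegral_ge0 => x _; exact: sqr_ge0.
rewrite massE// mulr_sumr; apply: ler_sum => i _.
have u2 := (hu i).1.
apply: (@le_trans _ _ (M * ip vol (u i).1 (u i).1)); last first.
  apply: ler_wpM2l => //; rewrite ip_sq lerDl; apply: sumr_ge0 => j _.
  by apply: Rintegral_ge0 => x _; exact: sqr_ge0.
rewrite -(formZl DB)// -subr_ge0 -(formBl DB)//; last 2 first.
- exact: lin_closedZ (L2_lin_closed vol) _.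
- exact: L2_rho.
apply: Rintegral_ae_ge0.
  apply: measurable_funM (L2_measurable u2).
  apply: measurable_funB; first exact: measurable_funM (L2_measurable u2).
  exact: L2_measurable (L2_rho u2).
apply: aeS hM => x hx.
rewrite -[X in X * _]/(M * (u i).1 x - rho x * (u i).1 x) -mulrBl -mulrA -expr2.
by rewrite mulr_ge0 ?sqr_ge0// subr_ge0; exact: le_trans (ler_norm _) hx.
Qed.

Lemma mass_cvg0 (S : Type) (F : set_system S) (FF : Filter F) (v : S -> vjet) :
  (\forall s \near F, L2vjet (v s)) ->
  vh1norm Omega (v s) @[s --> F] --> 0 ->
  mass Omega rho (v s) (v s) @[s --> F] --> 0.
Proof.
move=> hv v0; have [M M0 hM] := mass_bound.
apply: (@squeeze_cvgr _ _ _ _ (fun=> 0) (fun s => M * vh1norm Omega (v s) ^+ 2)).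
- apply: filterS hv => s hs; rewrite (form_ge0 semi_inner_mass)//=.
  exact: hM.
- exact: cvg_cst.
- have : M * (vh1norm Omega (v s) * vh1norm Omega (v s)) @[s --> F] --> M * (0 * 0).
    by apply: cvgM; [exact: cvg_cst|exact: cvgM].
  by rewrite !mulr0.
Qed.

Lemma mass_ae0 u : L2vjet u -> vjet_ae_eq Omega u 0 -> mass Omega rho u u = 0.
Proof.
move=> hu u0; rewrite massE// big1// => i _; have [u1 _] := u0 i.
rewrite L2_mulC (ip_ael (f' := fun=> 0) (hu i).1)//.
- exact: (form0l DB (L2_rho (hu i).1)).
- exact: (L2_lin_closed vol).1.
- exact: L2_rho (hu i).1.
Qed.

End Mass.

(** * Pointwise tensor algebra *)

Section TensorAlgebra.
Variables (R : realType) (d : nat).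
Local Notation V := 'rV[R]_d.
Local Notation M := 'M[R]_d.

Lemma appC_lin (C : tensor4 R d) x a (A B : M) :
  appC C x (a *: A + B) = a *: appC C x A + appC C x B.
Proof.
apply/matrixP => i j; rewrite !mxE mulr_sumr -big_split/=; apply: eq_bigr => k _.
rewrite mulr_sumr -big_split/=; apply: eq_bigr => l _.
by rewrite !mxE; ring.
Qed.

Lemma appE_lin (E : tensor3 R d) x a (b c : V) :
  appE E x (a *: b + c) = a *: appE E x b + appE E x c.
Proof.
apply/matrixP => i j; rewrite !mxE mulr_sumr -big_split/=; apply: eq_bigr => k _.
by rewrite !mxE; ring.
Qed.

Lemma appET_lin (E : tensor3 R d) x a (A B : M) :
  appET E x (a *: A + B) = a *: appET E x A + appET E x B.
Proof.
apply/rowP => k; rewrite !mxE mulr_sumr -big_split/=; apply: eq_bigr => i _.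
rewrite mulr_sumr -big_split/=; apply: eq_bigr => j _.
by rewrite !mxE; ring.
Qed.

Lemma appK_lin (K : tensor2 R d) x a (b c : V) :
  appK K x (a *: b + c) = a *: appK K x b + appK K x c.
Proof.
apply/rowP => i; rewrite !mxE mulr_sumr -big_split/=; apply: eq_bigr => k _.
by rewrite !mxE; ring.
Qed.

Lemma strain_lin a (u v : vjet R d) x : strain (a *: u + v) x = a *: strain u x + strain v x.
Proof.
apply/matrixP => i j; rewrite !mxE.
transitivity ((a * (u i).2 j x + (v i).2 j x + (a * (u j).2 i x + (v j).2 i x)) / 2); first by [].
by field.
Qed.

Lemma grad_lin a (p q : jet R d) x : grad (a *: p + q) x = a *: grad p x + grad q x.
Proof. by apply/rowP => i; rewrite !mxE. Qed.

Lemma frobC (A B : M) : frob A B = frob B A.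
Proof. by apply: eq_bigr => i _; apply: eq_bigr => j _; rewrite mulrC. Qed.

Lemma frobDl (A B N : M) : frob (A + B) N = frob A N + frob B N.
Proof.
rewrite /frob -big_split/=; apply: eq_bigr => i _; rewrite -big_split/=.
by apply: eq_bigr => j _; rewrite mxE mulrDl.
Qed.

Lemma dotDl (b c e : V) : dot (b + c) e = dot b e + dot c e.
Proof. by rewrite /dot -big_split/=; apply: eq_bigr => i _; rewrite mxE mulrDl. Qed.

Lemma dotNl (b e : V) : dot (- b) e = - dot b e.
Proof. by rewrite /dot -sumrN; apply: eq_bigr => i _; rewrite mxE mulNr. Qed.

Lemma frob_ge0 (A : M) : 0 <= frob A A.
Proof. by apply: sumr_ge0 => i _; apply: sumr_ge0 => j _; rewrite -expr2 sqr_ge0. Qed.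

Lemma dot_ge0 (b : V) : 0 <= dot b b.
Proof. by apply: sumr_ge0 => i _; rewrite -expr2 sqr_ge0. Qed.

Lemma frob_eq0 (A : M) : frob A A = 0 -> A = 0.
Proof.
move=> A0; apply/matrixP => i j; rewrite mxE; apply/eqP; rewrite -sqrf_eq0 expr2.
have := A0; move=> /eqP; rewrite psumr_eq0; last first.
  by move=> k _; apply: sumr_ge0 => l _; rewrite -expr2 sqr_ge0.
move=> /allP/(_ i (mem_index_enum _)) /=; rewrite psumr_eq0; last first.
  by move=> l _; rewrite -expr2 sqr_ge0.
by move=> /allP/(_ j (mem_index_enum _)) /=.
Qed.

Lemma dot_eq0 (b : V) : dot b b = 0 -> b = 0.
Proof.
move=> b0; apply/rowP => i; rewrite mxE; apply/eqP; rewrite -sqrf_eq0 expr2.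
have := b0; move=> /eqP; rewrite psumr_eq0; last by move=> k _; rewrite -expr2 sqr_ge0.
by move=> /allP/(_ i (mem_index_enum _)) /=.
Qed.

Lemma strain_sym (u : vjet R d) x : sym (strain u x).
Proof. by apply/matrixP => i j; rewrite !mxE addrC. Qed.

Lemma appC0 (C : tensor4 R d) x : appC C x 0 = 0.
Proof. by apply/matrixP => i j; rewrite !mxE big1// => k _; rewrite big1// => l _; rewrite mxE mulr0. Qed.

Lemma appE0 (E : tensor3 R d) x : appE E x 0 = 0.
Proof. by apply/matrixP => i j; rewrite !mxE big1// => k _; rewrite mxE mulr0. Qed.

Lemma appET0 (E : tensor3 R d) x : appET E x 0 = 0.
Proof. by apply/rowP => k; rewrite !mxE big1// => i _; rewrite big1// => j _; rewrite mxE mulr0. Qed.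

Lemma appK0 (K : tensor2 R d) x : appK K x 0 = 0.
Proof. by apply/rowP => i; rewrite !mxE big1// => k _; rewrite mxE mulr0. Qed.

End TensorAlgebra.

Section BilinearForm.
Variables (R : realType) (d : nat) (Omega : set 'rV[R]_d).
Local Notation V := 'rV[R]_d.
Local Notation vol := (volume Omega).
Local Notation vjet := (vjet R d).
Local Notation jet := (jet R d).
Local Notation DB := (semi_inner_L2 vol).
Variables (C : tensor4 R d) (E : tensor3 R d) (K : tensor2 R d) (c0 k0 : R).
Hypotheses (c0_gt0 : 0 < c0) (k0_gt0 : 0 < k0)
  (hcoef : admissible_coefficients Omega C E K c0 k0).

(** The integrands of [form_a] are taken entry by entry, with one pair as index, so that the form
    becomes a finite sum of L2 products and inherits their bilinearity. *)
Definition stress (u : vjet) (psi : jet) (ij : 'I_d * 'I_d) (x : V) : R :=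
  (appC C x (strain u x) + appE E x (grad psi x)) ij.1 ij.2.

Definition eldisp (u : vjet) (psi : jet) (k : 'I_d) (x : V) : R :=
  (- appET E x (strain u x) + appK K x (grad psi x)) 0 k.

Definition strain_entry (u : vjet) (ij : 'I_d * 'I_d) (x : V) : R := strain u x ij.1 ij.2.

Lemma strain_entry_L2 u ij : L2vjet Omega u -> L2 vol (strain_entry u ij).
Proof.
move=> hu; rewrite (_ : strain_entry u ij = 2^-1 *: ((u ij.1).2 ij.2 + (u ij.2).2 ij.1)).
  apply: (lin_closedZ _ (L2_lin_closed vol)).
  exact: (lin_closedD (L2_lin_closed vol) ((hu _).2 _) ((hu _).2 _)).
by apply/funext => x; rewrite /strain_entry mxE mulrC.
Qed.

Lemma stress_L2 u psi ij : L2vjet Omega u -> L2jet Omega psi -> L2 vol (stress u psi ij).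
Proof.
move=> hu hpsi; have [[hC hE hK] _] := hcoef.
rewrite (_ : stress u psi ij =
  (fun x => \sum_(k < d) \sum_(l < d) C ij.1 ij.2 k l x * strain_entry u (k, l) x) +
  (fun x => \sum_(k < d) E ij.1 ij.2 k x * psi.2 k x)).
  apply: (lin_closedD (L2_lin_closed vol)).
    apply: L2_sum => k; apply: L2_sum => l.
    by apply: L2_bounded_mul => //; exact: strain_entry_L2.
  by apply: L2_sum => k; apply: L2_bounded_mul => //; exact: (hpsi.2 k).
apply/funext => x; rewrite /stress !mxE; congr (_ + _).
by apply: eq_bigr => k _; rewrite !mxE.
Qed.

Lemma eldisp_L2 u psi k : L2vjet Omega u -> L2jet Omega psi -> L2 vol (eldisp u psi k).
Proof.
move=> hu hpsi; have [[hC hE hK] _] := hcoef.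
rewrite (_ : eldisp u psi k =
  (fun x => \sum_(j < d) K k j x * psi.2 j x) -
  (fun x => \sum_(i < d) \sum_(j < d) E i j k x * strain_entry u (i, j) x)).
  apply: (lin_closedB (L2_lin_closed vol)).
    by apply: L2_sum => j; apply: L2_bounded_mul => //; exact: (hpsi.2 j).
  apply: L2_sum => i; apply: L2_sum => j.
  by apply: L2_bounded_mul => //; exact: strain_entry_L2.
apply/funext => x; rewrite /eldisp !mxE addrC; congr (_ - _).
by apply: eq_bigr => j _; rewrite !mxE.
Qed.

Lemma frob_sumE u psi w x :
  frob (appC C x (strain u x) + appE E x (grad psi x)) (strain w x) =
  \sum_(ij : 'I_d * 'I_d) stress u psi ij x * strain_entry w ij x.
Proof. by rewrite /frob pair_big; apply: eq_bigr => ij _. Qed.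

Lemma dot_sumE u psi (phi : jet) x :
  dot (- appET E x (strain u x) + appK K x (grad psi x)) (grad phi x) =
  \sum_(k < d) eldisp u psi k x * phi.2 k x.
Proof. by apply: eq_bigr => k _; rewrite [grad _ _ _ _]mxE. Qed.

Lemma form_aE u psi w phi : L2vjet Omega u -> L2jet Omega psi ->
  L2vjet Omega w -> L2jet Omega phi ->
  form_a Omega C E K u psi w phi =
  \sum_(ij : 'I_d * 'I_d) ip vol (stress u psi ij) (strain_entry w ij) +
  \sum_(k < d) ip vol (eldisp u psi k) (phi.2 k).
Proof.
move=> hu hpsi hw hphi; rewrite /form_a.
under eq_Rintegral do rewrite frob_sumE.
under [X in _ + X]eq_Rintegral do rewrite dot_sumE.
congr (_ + _).
  by apply: (ip_sum _ _ _).1 => ij; [exact: stress_L2|exact: strain_entry_L2].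
by apply: (ip_sum _ _ _).1 => k; [exact: eldisp_L2|exact: (hphi.2 k)].
Qed.

Lemma stress_lin a u psi u' psi' ij :
  stress (a *: u + u') (a *: psi + psi') ij = a *: stress u psi ij + stress u' psi' ij.
Proof.
apply/funext => x; rewrite /stress strain_lin grad_lin appC_lin appE_lin.
transitivity (a * stress u psi ij x + stress u' psi' ij x); last by [].
by rewrite /stress !mxE; ring.
Qed.

Lemma eldisp_lin a u psi u' psi' k :
  eldisp (a *: u + u') (a *: psi + psi') k = a *: eldisp u psi k + eldisp u' psi' k.
Proof.
apply/funext => x; rewrite /eldisp strain_lin grad_lin appET_lin appK_lin.
transitivity (a * eldisp u psi k x + eldisp u' psi' k x); last by [].
by rewrite /eldisp !mxE; ring.
Qed.

Lemma strain_entry_lin a u u' ij :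
  strain_entry (a *: u + u') ij = a *: strain_entry u ij + strain_entry u' ij.
Proof.
apply/funext => x; rewrite /strain_entry strain_lin.
transitivity (a * strain u x ij.1 ij.2 + strain u' x ij.1 ij.2); last by [].
by rewrite !mxE.
Qed.

Lemma form_a_linl a u psi u' psi' w phi :
  L2vjet Omega u -> L2jet Omega psi -> L2vjet Omega u' -> L2jet Omega psi' ->
  L2vjet Omega w -> L2jet Omega phi ->
  form_a Omega C E K (a *: u + u') (a *: psi + psi') w phi =
  a * form_a Omega C E K u psi w phi + form_a Omega C E K u' psi' w phi.
Proof.
move=> hu hpsi hu' hpsi' hw hphi.
have h1 : L2vjet Omega (a *: u + u') by exact: (L2vjet_lin_closed Omega).2.
have h2 : L2jet Omega (a *: psi + psi') by exact: (L2jet_lin_closed Omega).2.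
rewrite !form_aE// mulrDr addrACA; congr (_ + _).
  rewrite mulr_sumr -big_split/=; apply: eq_bigr => ij _.
  rewrite stress_lin (formDZl DB)//; [exact: stress_L2|exact: stress_L2|exact: strain_entry_L2].
rewrite mulr_sumr -big_split/=; apply: eq_bigr => k _.
by rewrite eldisp_lin (formDZl DB)//; [exact: eldisp_L2|exact: eldisp_L2|exact: (hphi.2 k)].
Qed.

Lemma form_a_linr a u psi w phi w' phi' :
  L2vjet Omega u -> L2jet Omega psi ->
  L2vjet Omega w -> L2jet Omega phi -> L2vjet Omega w' -> L2jet Omega phi' ->
  form_a Omega C E K u psi (a *: w + w') (a *: phi + phi') =
  a * form_a Omega C E K u psi w phi + form_a Omega C E K u psi w' phi'.
Proof.
move=> hu hpsi hw hphi hw' hphi'.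
have h1 : L2vjet Omega (a *: w + w') by exact: (L2vjet_lin_closed Omega).2.
have h2 : L2jet Omega (a *: phi + phi') by exact: (L2jet_lin_closed Omega).2.
rewrite !form_aE// mulrDr addrACA; congr (_ + _).
  rewrite mulr_sumr -big_split/=; apply: eq_bigr => ij _.
  have s1 := strain_entry_L2 ij hw; have s2 := strain_entry_L2 ij hw'.
  have s3 := stress_L2 ij hu hpsi.
  by rewrite strain_entry_lin (formDr DB (lin_closedZ a (L2_lin_closed vol) s1) s2 s3) (formZr DB a s1 s3).
rewrite mulr_sumr -big_split/=; apply: eq_bigr => k _.
have s3 := eldisp_L2 k hu hpsi.
rewrite -(formZr DB a (hphi.2 k) s3).
exact: (formDr DB (lin_closedZ a (L2_lin_closed vol) (hphi.2 k)) (hphi'.2 k) s3).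
Qed.

(* The E-terms of a(p,p) cancel, so that a(p,p) dominates |strain|^2 + |grad|^2. *)
Lemma form_a_null u psi : L2vjet Omega u -> L2jet Omega psi ->
  form_a Omega C E K u psi u psi = 0 ->
  forall w phi, L2vjet Omega w -> L2jet Omega phi ->
  form_a Omega C E K u psi w phi = 0.
Proof.
move=> hu hpsi a0 w phi hw hphi; have [[hC hE hK] [_ hCc _ _ hKk]] := hcoef.
pose f x := frob (appC C x (strain u x) + appE E x (grad psi x)) (strain u x) +
  dot (- appET E x (strain u x) + appK K x (grad psi x)) (grad psi x).
have [E1 I1] := ip_sum (index_enum ('I_d * 'I_d)%type) (fun ij => stress_L2 ij hu hpsi)
  (fun ij => strain_entry_L2 ij hu).
have [E2 I2] := ip_sum (index_enum 'I_d) (fun k => eldisp_L2 k hu hpsi) (fun k => hpsi.2 k).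
have fE x : f x = \sum_ij stress u psi ij x * strain_entry u ij x +
    \sum_(k < d) eldisp u psi k x * psi.2 k x.
  by rewrite /f frob_sumE dot_sumE.
have fI : vol.-integrable setT (EFin \o f).
  have := integrableD measurableT I1 I2; apply: eq_integrable => // x _.
  by rewrite /= fE.
have f0 : \int[vol]_x f x = 0.
  rewrite -a0 form_aE// -E1 -E2 -RintegralD//.
  by apply: eq_Rintegral => x _; exact: fE.
have fge : {ae vol, forall x,
    c0 * frob (strain u x) (strain u x) + k0 * dot (grad psi x) (grad psi x) <= f x}.
  apply: aeS2 hCc hKk => x hCx hKx; rewrite /f frobDl dotDl dotNl appETP.
  rewrite (frobC (appE _ _ _)).
  have := hCx _ (strain_sym u x); have := hKx (grad psi x); lra.
have fge0 : {ae vol, forall x, 0 <= f x}.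
  apply: aeS fge => x; apply: le_trans.
  by rewrite addr_ge0// mulr_ge0 ?frob_ge0 ?dot_ge0// ltW.
have zero : {ae vol, forall x, strain u x = 0 /\ grad psi x = 0}.
  apply: aeS2 (Rintegral_ae_eq0 fI fge0 f0) fge => x /(_ I) -> h.
  have h1 := frob_ge0 (strain u x); have h2 := dot_ge0 (grad psi x).
  have h3 : 0 <= c0 * frob (strain u x) (strain u x) by rewrite mulr_ge0// ltW.
  have h4 : 0 <= k0 * dot (grad psi x) (grad psi x) by rewrite mulr_ge0// ltW.
  split; [apply: frob_eq0|apply: dot_eq0]; apply/eqP.
    have : c0 * frob (strain u x) (strain u x) == 0 by rewrite eq_le h3 andbT; lra.
    by rewrite mulf_eq0 gt_eqF.
  have : k0 * dot (grad psi x) (grad psi x) == 0 by rewrite eq_le h4 andbT; lra.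
  by rewrite mulf_eq0 gt_eqF.
(* Zero strain and zero gradient annihilate stress and electric displacement, so the form vanishes
   against every test pair. *)
have D0 := (L2_lin_closed vol).1.
rewrite form_aE// !big1 ?addr0// => [k _|ij _].
  rewrite (ip_ael (f' := 0) (eldisp_L2 k hu hpsi) D0 (hphi.2 k)).
    exact: (form0l DB (hphi.2 k)).
  by apply: aeS zero => x [h1 h2] _; rewrite /eldisp h1 h2 appET0 appK0 oppr0 addr0 mxE.
have s1 := strain_entry_L2 ij hw.
rewrite (ip_ael (f' := 0) (stress_L2 ij hu hpsi) D0 s1).
  exact: (form0l DB s1).
by apply: aeS zero => x [h1 h2] _; rewrite /stress h1 h2 appC0 appE0 addr0 mxE.
Qed.

End BilinearForm.

(** * Concatenated coordinate vectors *)

Section JoinedIndices.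
Variable R : realType.

Definition joinf n k (y : 'I_n -> R) (z : 'I_k -> R) (l : 'I_(n + k)) : R :=
  match fintype.split l with inl i => y i | inr j => z j end.

Lemma sumsq_joinf n k (y : 'I_n -> R) (z : 'I_k -> R) :
  sumsq (joinf y z) = sumsq y + sumsq z.
Proof.
rewrite /sumsq big_split_ord/=; congr (_ + _); apply: eq_bigr => i _; rewrite /joinf.
  by rewrite (unsplitK (inl i)).
by rewrite (unsplitK (inr i)).
Qed.

Lemma joinf_lin n k a (y y' : 'I_n -> R) (z z' : 'I_k -> R) :
  joinf (a *: y + y') (a *: z + z') = a *: joinf y z + joinf y' z'.
Proof.
apply/funext => l; rewrite /joinf.
transitivity (a * joinf y z l + joinf y' z' l); last by [].
by rewrite /joinf; case: (fintype.split l).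
Qed.

Lemma joinf0 n k : joinf (0 : 'I_n -> R) (0 : 'I_k -> R) = 0.
Proof. by apply/funext => l; rewrite /joinf; case: (fintype.split l). Qed.

Lemma joinf_inj n k (y y' : 'I_n -> R) (z z' : 'I_k -> R) :
  joinf y z = joinf y' z' -> y = y' /\ z = z'.
Proof.
move=> h; split; apply/funext => i.
  by have := congr1 (@^~ (lshift k i)) h; rewrite /joinf (unsplitK (inl i)).
by have := congr1 (@^~ (rshift n i)) h; rewrite /joinf (unsplitK (inr i)).
Qed.

Lemma diff_on_lin (T a : R) f df g dg : diff_on T f df -> diff_on T g dg ->
  diff_on T (fun t => a * f t + g t) (fun t => a * df t + dg t).
Proof.
move=> hf hg t tT.
have FF : Filter (within `[0, T] t^') by exact: within_filter.
apply: cvg_trans (cvgD (cvgM (cvg_cst a) (hf t tT)) (hg t tT)).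
apply: near_eq_cvg; apply: nearW => s.
transitivity (a * ((s - t)^-1 * (f s - f t)) + (s - t)^-1 * (g s - g t)); first by [].
by ring.
Qed.

End JoinedIndices.

(** * The semidiscrete state equation *)

Section Galerkin.
Variables (R : realType) (d : nat) (Omega : set 'rV[R]_d).
Local Notation V := 'rV[R]_d.
Local Notation vol := (volume Omega).
Local Notation sigma := (surface Omega).
Local Notation vjet := (vjet R d).
Local Notation jet := (jet R d).
Variables (C : tensor4 R d) (E : tensor3 R d) (K : tensor2 R d) (c0 k0 : R).
Hypotheses (c0_gt0 : 0 < c0) (k0_gt0 : 0 < k0)
  (hcoef : admissible_coefficients Omega C E K c0 k0).
Variables (rho : V -> R) (hrho : admissible_density Omega rho).
Variables (gamma : jet -> V -> R) (hgamma : trace_operator Omega gamma).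
Variables (G : jet -> R) (hG : bounded_linear_functional Omega G).
Variables (GammaD : set V) (Vh : set vjet)
  (hVh : finite_dim_subspace (vjet_ae_eq Omega) (H1D Omega gamma GammaD) Vh).
Variables (Wh : set jet) (hWh : finite_dim_subspace (jet_ae_eq Omega) (H1 Omega) Wh).
Local Notation WhG := (Wh `&` H1G Omega G).
Local Notation mass := (mass Omega rho).
Local Notation form_a := (form_a Omega C E K).
Local Notation MB := (semi_inner_mass hrho).

Lemma H1_0 : H1 Omega 0.
Proof.
have l0 := (L2_lin_closed vol).1.
split=> [|i|i phi _]; [exact: l0|exact: l0|].
rewrite (@eq_Rintegral _ _ _ _ _ (fun=> 0)); last by move=> x _; exact: mul0r.
rewrite [in RHS](@eq_Rintegral _ _ _ _ _ (fun=> 0)); last by move=> x _; exact: mul0r.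
by rewrite /Rintegral integral0 oppr0.
Qed.

Lemma trace0 : gamma 0 = (fun=> 0) %[ae sigma].
Proof.
have [_ /(_ 1 0 0 H1_0 H1_0) + _ _] := hgamma.
rewrite scaler0 addr0; apply: aeS => x /(_ I) h _.
by move: h; rewrite mul1r => /esym/eqP; rewrite -subr_eq0 addrK => /eqP.
Qed.

Lemma Vh_L2 : Vh `<=` L2vjet Omega.
Proof.
have [m [b [_ hV]]] := hVh.
by move=> v /hV[hv _] i; apply: H1_L2jet; have [] := hv i.
Qed.

Lemma WhG_L2 : WhG `<=` L2jet Omega.
Proof. by move=> v [_ [hv _]]; exact: H1_L2jet. Qed.

Lemma Vh0 : Vh 0.
Proof.
have [m [b [_ hV]]] := hVh; apply/hV; split.
  move=> i; split; first exact: H1_0.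
  by apply: aeS trace0 => x /(_ I) h _.
exists (fun=> 0); rewrite big1 => [|k _]; last by rewrite scale0r.
by move=> i; split=> [|j]; apply: aeW.
Qed.

Lemma WhG0 : WhG 0.
Proof.
have [m [b [_ hW]]] := hWh; split.
  apply/hW; split; first exact: H1_0.
  exists (fun=> 0); rewrite big1 => [|k _]; last by rewrite scale0r.
  by split=> [|j]; apply: aeW.
split; first exact: H1_0.
have [/(_ 1 0 0 H1_0 H1_0) + _] := hG.
by rewrite scaler0 addr0 mul1r => /esym/eqP; rewrite -subr_eq0 addrK => /eqP.
Qed.

Lemma span_Vh_L2 : lspan Vh `<=` L2vjet Omega.
Proof. exact: lspan_sub (L2vjet_lin_closed Omega) Vh_L2. Qed.

Lemma span_WhG_L2 : lspan WhG `<=` L2jet Omega.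
Proof. exact: lspan_sub (L2jet_lin_closed Omega) WhG_L2. Qed.

Lemma mass_basis : exists (n : nat) (w : 'I_n -> vjet),
  [/\ forall j, lspan Vh (w j),
      forall i j, mass (w i) (w j) = (i == j)%:R &
      forall v, lspan Vh v ->
        let r := v - \sum_(j < n) mass v (w j) *: w j in mass r r = 0].
Proof.
have [m [b [hb hV]]] := hVh.
have b2 k : L2vjet Omega (b k) by move=> i; apply: H1_L2jet; have [] := hb k i.
have Ll := L2vjet_lin_closed Omega.
apply: (orthonormal_basis MB (b := b) (lspan_lin_closed Vh) span_Vh_L2 b2).
move=> v vV.
pose S : set vjet := [set v | L2vjet Omega v /\ exists c : 'I_m -> R,
  let r := v - \sum_(k < m) c k *: b k in mass r r = 0].
suff : S v by case.
have sL c : L2vjet Omega (\sum_(k < m) c k *: b k) by exact: lin_closed_sum.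
apply: vV; first exact: (null_span_lin_closed MB b2).
move=> u Vu; split; first exact: Vh_L2.
  have /hV[_ [c hc]] := Vu; exists c; apply: mass_ae0 => //.
    exact: lin_closedB Ll (Vh_L2 Vu) (sL c).
  move=> i; have [h1 h2] := hc i; split.
    apply: aeS h1 => x /(_ I) h _.
    transitivity ((u i).1 x - ((\sum_(k < m) c k *: b k) i).1 x); first by [].
    by rewrite h subrr.
  move=> j; apply: aeS (h2 j) => x /(_ I) h _.
  transitivity ((u i).2 j x - ((\sum_(k < m) c k *: b k) i).2 j x); first by [].
  by rewrite h subrr.
Qed.

Variables (n : nat) (w : 'I_n -> vjet).
Hypotheses (wV : forall j, lspan Vh (w j))
  (wo : forall i j, mass (w i) (w j) = (i == j)%:R)
  (wspan : forall v, lspan Vh v ->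
        let r := v - \sum_(j < n) mass v (w j) *: w j in mass r r = 0).

Let w2 j : L2vjet Omega (w j). Proof. exact: span_Vh_L2. Qed.

Definition coords (v : vjet) (i : 'I_n) : R := mass v (w i).

Lemma coords_lin a u v : L2vjet Omega u -> L2vjet Omega v ->
  coords (a *: u + v) = a *: coords u + coords v.
Proof. by move=> hu hv; apply/funext => i; rewrite /coords (formDZl MB). Qed.

Lemma coords0 : coords 0 = 0.
Proof. by apply/funext => i; exact: (form0l MB (w2 i)). Qed.

Lemma mass_coords0 v : lspan Vh v -> coords v = 0 -> mass v v = 0.
Proof.
move=> vV c0v; have := wspan vV; rewrite big1 ?subr0//= => j _.
by rewrite -/(coords v j) c0v scale0r.
Qed.

(** Pythagoras: [v] equals its expansion [p] up to a null vector, so the part of [q] orthogonal to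
    the discrete space contributes a term that does not depend on [v]. *)
Lemma mass_sub_coords v q : lspan Vh v -> L2vjet Omega q ->
  mass (v - q) (v - q) = sumsq (fun i => coords v i - coords q i) +
    (mass q q - sumsq (coords q)).
Proof.
move=> vV q2; have v2 := span_Vh_L2 vV.
set p := \sum_(j < n) coords v j *: w j.
have p2 : L2vjet Omega p by exact: lin_closed_sum (L2vjet_lin_closed Omega) w2.
have vp : mass (v - p) (v - p) = 0 by exact: wspan.
have pw j : mass p (w j) = coords v j.
  by rewrite -(form_null_sub MB v2 p2 (w2 j) vp).
have vv : mass v v = sumsq (coords v).
  rewrite (form_null_sub MB v2 p2 v2 vp) (form_suml MB _ _ w2 v2).
  by apply: eq_bigr => j _; rewrite (formC MB (w2 j) v2) expr2.
have vq : mass v q = \sum_(j < n) coords v j * coords q j.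
  rewrite (form_null_sub MB v2 p2 q2 vp) (form_suml MB _ _ w2 q2).
  by apply: eq_bigr => j _; rewrite (formC MB (w2 j) q2).
rewrite (formBB MB v2 q2) vv vq.
have -> : sumsq (fun i => coords v i - coords q i) =
   sumsq (coords v) - 2 * \sum_(j < n) coords v j * coords q j + sumsq (coords q).
  rewrite /sumsq mulr_sumr -sumrB -big_split/=; apply: eq_bigr => i _; ring.
by ring.
Qed.

Variables (k : nat) (e : 'I_k -> V -> R).
Hypothesis e2 : forall j, L2 sigma (e j).

Definition load (zeta : 'I_k -> R) (phi : jet) : R :=
  \sum_(j < k) zeta j * ip sigma (e j) (gamma phi).

(* The graph of the map (coordinates of u, load) |-> coordinates of u''. *)
Definition acceleration_rel (x : 'I_n -> R) (v : 'I_(n + k) -> R) : Prop :=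
  exists u a psi zeta,
  [/\ [/\ lspan Vh u, lspan Vh a & lspan WhG psi],
      x = coords a, v = joinf (coords u) zeta &
      forall w phi, Vh w -> WhG phi ->
        mass a w + form_a u psi w phi = - load zeta phi].

Lemma acceleration_rel_lin c x1 v1 x2 v2 :
  acceleration_rel x1 v1 -> acceleration_rel x2 v2 ->
  acceleration_rel (c *: x1 + x2) (c *: v1 + v2).
Proof.
have Ll := L2vjet_lin_closed Omega; have Jl := L2jet_lin_closed Omega.
have sV := lspan_lin_closed Vh; have sW := lspan_lin_closed WhG.
move=> [u1 [a1 [psi1 [z1 [[h11 h12 h13] -> -> eq1]]]]].
move=> [u2 [a2 [psi2 [z2 [[h21 h22 h23] -> -> eq2]]]]].
have l11 := span_Vh_L2 h11; have l12 := span_Vh_L2 h12; have l13 := span_WhG_L2 h13.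
have l21 := span_Vh_L2 h21; have l22 := span_Vh_L2 h22; have l23 := span_WhG_L2 h23.
exists (c *: u1 + u2), (c *: a1 + a2), (c *: psi1 + psi2), (c *: z1 + z2); split.
- by split; [exact: sV.2|exact: sV.2|exact: sW.2].
- by rewrite coords_lin.
- by rewrite coords_lin// joinf_lin.
- move=> v phi Vv Wphi; have vv2 := Vh_L2 Vv; have phi2 := WhG_L2 Wphi.
  rewrite (formDZl MB)// (form_a_linl hcoef)// addrACA -mulrDr eq1// eq2//.
  rewrite mulrN -opprD; congr (- _); rewrite /load mulr_sumr -big_split/=.
  by apply: eq_bigr => j _; rewrite mulrA -mulrDl.
Qed.

(** For zero coordinates and zero load, test with the pair [(u, psi)] itself: [mass a u] vanishes
    because [u] is null, so [form_a] vanishes on the diagonal and then, by [form_a_null], against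
    all tests. What is left of the equation is that the coordinates of [a] are zero. *)
Lemma acceleration_bound : exists2 K0 : R, 0 <= K0 &
  forall x v, acceleration_rel x v -> sumsq x <= K0 * sumsq v.
Proof.
have Ll := L2vjet_lin_closed Omega; have Jl := L2jet_lin_closed Omega.
have sV := lspan_lin_closed Vh; have sW := lspan_lin_closed WhG.
apply: linear_relation_bound.
- exact: acceleration_rel_lin.
- exists 0, 0, 0, 0; split.
  + by split; [exact: sV.1|exact: sV.1|exact: sW.1].
  + by rewrite coords0.
  + by rewrite coords0 joinf0.
  + move=> v phi /Vh_L2 v2 /WhG_L2 phi2.
    rewrite (form0l MB v2) add0r.
    have := form_a_linl hcoef 0 Ll.1 Jl.1 Ll.1 Jl.1 v2 phi2.
    rewrite !scaler0 !addr0 mul0r add0r => _.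
    have := form_a_linl hcoef 1 Ll.1 Jl.1 Ll.1 Jl.1 v2 phi2.
    rewrite !scaler0 !addr0 mul1r => /esym/eqP; rewrite -subr_eq0 addrK => /eqP ->.
    by rewrite /load big1 ?oppr0// => j _; exact: mul0r.
- move=> x [u [a [psi [z [[hu ha hpsi] -> v0 eq]]]]].
  move: v0; rewrite -(joinf0 R n k) => v0; have [cu z0] := joinf_inj v0.
  have u2 := span_Vh_L2 hu; have a2 := span_Vh_L2 ha; have psi2 := span_WhG_L2 hpsi.
  have load0 phi : load z phi = 0 by rewrite /load -z0 big1// => j _; exact: mul0r.
  have a00 : form_a u psi 0 0 = 0.
    have := form_a_linr hcoef 1 u2 psi2 Ll.1 Jl.1 Ll.1 Jl.1.
    by rewrite !scaler0 !addr0 mul1r => /esym/eqP; rewrite -subr_eq0 addrK => /eqP.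
  (* The equation is given for test pairs in [Vh] and the constrained potentials, whereas [u] and
     [psi] are only in the spans. Setting one test component to zero lets each variable be extended
     to its span separately. *)
  have test1 v : lspan Vh v -> mass a v + form_a u psi v 0 = 0.
    move=> vV; pose S : set vjet := [set v | L2vjet Omega v /\ mass a v + form_a u psi v 0 = 0].
    suff : S v by case.
    apply: vV; last first.
      move=> v' Vv'; split; first exact: Vh_L2.
      by rewrite eq ?load0 ?oppr0//; exact: WhG0.
    split; first by split; [exact: Ll.1|rewrite (formC MB a2 Ll.1) (form0l MB a2) a00 addr0].
    move=> c v1 v2' [l1 h1] [l2 h2]; split; first exact: Ll.2.
    rewrite (formDr MB (lin_closedZ c Ll l1) l2 a2) (formZr MB c l1 a2).
    have := form_a_linr hcoef c u2 psi2 l1 Jl.1 l2 Jl.1; rewrite scaler0 addr0 => ->.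
    by rewrite addrACA -mulrDr h1 h2 mulr0 addr0.
  have test2 phi : lspan WhG phi -> form_a u psi 0 phi = 0.
    move=> vW; pose S : set jet := [set phi | L2jet Omega phi /\ form_a u psi 0 phi = 0].
    suff : S phi by case.
    apply: vW; last first.
      move=> phi' Wphi; split; first exact: WhG_L2.
      have := eq 0 phi' Vh0 Wphi; rewrite load0 oppr0 (formC MB a2 Ll.1) (form0l MB a2).
      by rewrite add0r.
    split; first by split; [exact: Jl.1|exact: a00].
    move=> c v1 v2' [l1 h1] [l2 h2]; split; first exact: Jl.2.
    have := form_a_linr hcoef c u2 psi2 Ll.1 l1 Ll.1 l2; rewrite scaler0 addr0 => ->.
    by rewrite h1 h2 mulr0 addr0.
  (* Zero coordinates make [u] null for the mass product; its strain is controlled only through the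
     diagonal value [au]. *)
  have mu0 : mass u u = 0 by exact: mass_coords0.
  have au : form_a u psi u psi = 0.
    have := form_a_linr hcoef 1 u2 psi2 u2 Jl.1 Ll.1 psi2.
    rewrite scaler0 add0r scale1r addr0 mul1r => ->.
    rewrite (test2 psi hpsi) addr0; have := test1 u hu.
    by rewrite (formC MB a2 u2) (form_null MB u2 a2 mu0) add0r.
  apply/funext => i; rewrite /coords.
  have := test1 (w i) (wV i).
  by rewrite (form_a_null c0_gt0 k0_gt0 hcoef u2 psi2 au (w2 i) Jl.1) addr0.
Qed.

Variable T : R.
Hypothesis T0 : 0 <= T.

(** The potential is hidden in [acceleration_rel]: a second-order relation for the displacement
    coordinates remains, with zero initial data. *)
Definition trajectory (zeta : R -> 'I_k -> R) (y : 'I_n -> R -> R) : Prop :=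
  exists dy ddy : 'I_n -> R -> R,
  [/\ forall i, diff_on T (y i) (dy i),
      forall i, diff_on T (dy i) (ddy i),
      forall t, 0 <= t <= T -> acceleration_rel (ddy ^~ t) (joinf (y ^~ t) (zeta t)),
      forall i, y i 0 = 0 &
      forall i, dy i 0 = 0].

(** Coordinates are bounded functionals for the mass form, hence for the H^1 norm in which the
    difference quotients converge. *)
Lemma coords_diff_on u du i :
  (forall t, 0 <= t <= T -> L2vjet Omega (u t)) ->
  (forall t, 0 <= t <= T -> L2vjet Omega (du t)) ->
  time_derivative T (vh1norm Omega) u du ->
  diff_on T (fun t => coords (u t) i) (fun t => coords (du t) i).
Proof.
move=> u2 du2 udu t tT; have Ll := L2vjet_lin_closed Omega.
have FF : Filter (within `[0, T] t^') by exact: within_filter.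
have d2 s : 0 <= s <= T -> L2vjet Omega ((s - t)^-1 *: (u s - u t) - du t).
  move=> sT; apply: (lin_closedB Ll) (du2 t tT); apply: (lin_closedZ _ Ll).
  by apply: (lin_closedB Ll); exact: u2.
have near_in : \forall s \near within `[0, T] t^', 0 <= s <= T.
  by apply/within_nearP; exists 1.
apply: cvg_of_sub0.
have nd2 : \forall s \near within `[0, T] t^',
    L2vjet Omega ((s - t)^-1 *: (u s - u t) - du t).
  by apply: filterS near_in => s; exact: d2.
have := form_cvg0 MB FF nd2 (w2 i) (mass_cvg0 hrho FF nd2 (udu t tT)).
apply: cvg_trans; apply: near_eq_cvg; apply: filterS near_in => s sT.
have us := u2 s sT; have ut := u2 t tT; have dut := du2 t tT.
have usut := lin_closedB Ll us ut.
rewrite /coords (formBl MB (lin_closedZ (s - t)^-1 Ll usut) dut (w2 i)).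
by rewrite (formZl MB _ usut (w2 i)) (formBl MB us ut (w2 i)).
Qed.

Lemma solution_trajectory z u psi zeta :
  semidiscrete_solution Omega C E K rho gamma G Vh Wh T z u psi ->
  (forall t, 0 <= t <= T -> L2 sigma (z t)) ->
  (forall t, 0 <= t <= T -> z t = \sum_(j < k) zeta t j *: e j %[ae sigma]) ->
  trajectory zeta (fun i t => coords (u t) i).
Proof.
move=> [du [ddu [uV [udu dudu _] [psiW _] [u0 du0] eq]]] z2 zE.
have u2 t : 0 <= t <= T -> L2vjet Omega (u t) by move=> /uV[h _ _]; exact: Vh_L2.
have du2 t : 0 <= t <= T -> L2vjet Omega (du t) by move=> /uV[_ h _]; exact: Vh_L2.
have ddu2 t : 0 <= t <= T -> L2vjet Omega (ddu t) by move=> /uV[_ _ h]; exact: Vh_L2.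
have T00 : 0 <= (0 : R) <= T by rewrite lexx.
exists (fun i t => coords (du t) i), (fun i t => coords (ddu t) i); split.
- by move=> i; exact: coords_diff_on.
- by move=> i; exact: coords_diff_on.
- move=> t tT; have [Vu Vdu Vddu] := uV t tT.
  exists (u t), (ddu t), (psi t), (zeta t); split => //.
  + by split; [exact: sub_lspan|exact: sub_lspan|apply: sub_lspan; exact: psiW].
  + move=> v phi Vv Wphi; rewrite eq//; congr (- _).
    have g2 : L2 sigma (gamma phi).
      by have [+ _ _ _] := hgamma; apply; case: Wphi => _ [].
    have c2 : L2 sigma (\sum_(j < k) zeta t j *: e j) by exact: lin_closed_sum (L2_lin_closed sigma) e2.
    rewrite -[LHS]/(ip sigma (z t) (gamma phi)) (ip_ael (z2 t tT) c2 g2 (zE t tT)).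
    exact: (form_suml (semi_inner_L2 sigma) _ _ e2 g2).
- by move=> i; exact: (form_null MB (u2 0 T00) (w2 i) (mass_ae0 hrho (u2 0 T00) u0)).
- by move=> i; exact: (form_null MB (du2 0 T00) (w2 i) (mass_ae0 hrho (du2 0 T00) du0)).
Qed.

(** Three trajectories are the least number that serves all purposes: with [Z = 0] the bound gives
    uniqueness and the preservation of midpoints, and with positive [Z] the Lipschitz estimate. *)
Lemma response_bound : exists2 C1 : R, 0 <= C1 &
  forall a b zeta1 zeta2 zeta3 y1 y2 y3,
  trajectory zeta1 y1 -> trajectory zeta2 y2 -> trajectory zeta3 y3 ->
  forall Z, 0 <= Z ->
  (forall t, 0 <= t <= T -> sumsq (a *: zeta1 t + (b *: zeta2 t + zeta3 t)) <= Z) ->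
  forall t, 0 <= t <= T ->
    sumsq (fun i => a * y1 i t + (b * y2 i t + y3 i t)) <= C1 * Z.
Proof.
have [K0 K0ge0 hK0] := acceleration_bound.
exists (expR ((2 + K0) * T) * (K0 * T)); first by rewrite !mulr_ge0// expR_ge0.
move=> a b zeta1 zeta2 zeta3 y1 y2 y3 [dy1 [ddy1 [d1 dd1 r1 i1 di1]]].
move=> [dy2 [ddy2 [d2 dd2 r2 i2 di2]]] [dy3 [ddy3 [d3 dd3 r3 i3 di3]]] Z Z0 hZ t tT.
apply: (@second_order_bound _ T n (fun i t => a * y1 i t + (b * y2 i t + y3 i t))
  (fun i t => a * dy1 i t + (b * dy2 i t + dy3 i t))
  (fun i t => a * ddy1 i t + (b * ddy2 i t + ddy3 i t)) K0 Z) => //.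
- by move=> i; apply: diff_on_lin => //; exact: diff_on_lin.
- by move=> i; apply: diff_on_lin => //; exact: diff_on_lin.
- move=> s sT.
  have := hK0 _ _ (acceleration_rel_lin a (r1 s sT) (acceleration_rel_lin b (r2 s sT) (r3 s sT))).
  rewrite -joinf_lin -joinf_lin sumsq_joinf => h; apply: le_trans h _.
  by apply: ler_wpM2l => //; apply: lerD => //; exact: hZ.
- by move=> i; rewrite i1 i2 i3 !mulr0 !addr0.
- by move=> i; rewrite di1 di2 di3 !mulr0 !addr0.
Qed.

End Galerkin.

(** * Minimization of strictly convex quadratic costs *)

Section Minimizer.
Variables (R : realType) (U U' : lmodType R).
Variables (D : set U) (B : U -> U -> R) (DB : semi_inner D B).
Variables (D' : set U') (B' : U' -> U' -> R) (DB' : semi_inner D' B').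
Hypothesis complete : forall g : nat -> U, (forall N, D (g N)) ->
  (forall N, B (g N.+1 - g N) (g N.+1 - g N) <= 16^-1 ^+ N) ->
  exists2 l, D l & B (g N - l) (g N - l) @[N --> \oo] --> (0 : R).
Variables (K : set U) (KD : K `<=` D) (K0 : K !=set0).
Hypothesis Kmid : forall g h, K g -> K h -> K (2^-1 *: (g + h)).
Hypothesis Kclosed : forall (g : nat -> U) l, (forall N, K (g N)) -> D l ->
  B (g N - l) (g N - l) @[N --> \oo] --> (0 : R) -> K l.
Variables (p : U -> U') (pD : forall g, K g -> D' (p g)).
Hypothesis pmid : forall g h, K g -> K h ->
  let r := p (2^-1 *: (g + h)) - 2^-1 *: (p g + p h) in B' r r = 0.
Variables (lip : R).
Hypothesis plip : forall g h, K g -> K h ->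
  B' (p g - p h) (p g - p h) <= lip * B (g - h) (g - h).
Variables (alpha : R) (alpha_gt0 : 0 < alpha).

Definition quad_cost (g : U) : R := 2^-1 * B' (p g) (p g) + alpha / 2 * B g g.

Lemma quad_cost_ge0 g : K g -> 0 <= quad_cost g.
Proof.
move=> Kg; rewrite addr_ge0// mulr_ge0//.
- exact: (form_ge0 DB' (pD Kg)).
- by rewrite divr_ge0// ltW.
- exact: (form_ge0 DB (KD Kg)).
Qed.

(** Parallelogram law in both forms. The exact deficit also contains one eighth of the squared
    distance between [p g] and [p h], which is dropped. *)
Lemma quad_cost_midpoint g h : K g -> K h ->
  quad_cost (2^-1 *: (g + h)) + alpha / 8 * B (g - h) (g - h) <=
  2^-1 * (quad_cost g + quad_cost h).
Proof.
move=> Kg Kh; have Km := Kmid Kg Kh.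
have Dl := form_lin_closed DB; have Dl' := form_lin_closed DB'.
have Dg := KD Kg; have Dh := KD Kh; have Dgh := lin_closedD Dl Dg Dh.
have Dg' := pD Kg; have Dh' := pD Kh; have Dgh' := lin_closedD Dl' Dg' Dh'.
have D2 := lin_closedZ 2^-1 Dl' Dgh'.
have pm : B' (p (2^-1 *: (g + h))) (p (2^-1 *: (g + h))) =
    4^-1 * B' (p g + p h) (p g + p h).
  have Dm := pD Km; have r0 := pmid Kg Kh.
  rewrite (form_null_sub DB' Dm D2 Dm r0) (formC DB' D2 Dm).
  rewrite (form_null_sub DB' Dm D2 D2 r0) (formZl DB' _ Dgh' D2) (formZr DB' _ Dgh' Dgh').
  by field.
have mm : B (2^-1 *: (g + h)) (2^-1 *: (g + h)) = 4^-1 * B (g + h) (g + h).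
  by rewrite (formZl DB _ Dgh (lin_closedZ _ Dl Dgh)) (formZr DB _ Dgh Dgh); field.
rewrite /quad_cost pm mm (formDD DB Dg Dh) (formBB DB Dg Dh) (formDD DB' Dg' Dh').
have := form_ge0 DB' (lin_closedB Dl' Dg' Dh'); rewrite (formBB DB' Dg' Dh').
set x := B' (p g) (p g); set y := B' (p g) (p h); set z := B' (p h) (p h) => xyz.
set a := B g g; set b := B g h; set c := B h h.
rewrite -subr_ge0; apply: (@le_trans _ _ (8^-1 * (x - 2 * y + z))); first by rewrite mulr_ge0.
by rewrite le_eqVlt; apply/orP; left; apply/eqP; field.
Qed.

Lemma quad_cost_cvg (g : nat -> U) l : (forall N, K (g N)) -> K l ->
  B (g N - l) (g N - l) @[N --> \oo] --> (0 : R) ->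
  quad_cost (g N) @[N --> \oo] --> quad_cost l.
Proof.
move=> Kg Kl gl; apply: cvgD.
  apply: cvgM; first exact: cvg_cst.
  apply: (form_cvg_sq DB').
  - by apply: nearW => N; exact: pD.
  - exact: pD.
  apply: (@squeeze_cvgr _ _ _ _ (fun=> 0) (fun N => lip * B (g N - l) (g N - l))).
  - apply: nearW => N; rewrite plip// andbT.
    apply: (form_ge0 DB'); apply: (lin_closedB (form_lin_closed DB')); exact: pD.
  - exact: cvg_cst.
  - by rewrite -(mulr0 lip); apply: cvgM => //; exact: cvg_cst.
apply: cvgM; first exact: cvg_cst.
apply: (form_cvg_sq DB) => //; first by apply: nearW => N; exact: KD.
exact: KD.
Qed.

Lemma quad_cost_minimizer : exists g, [/\ K g,
  forall h, K h -> quad_cost g <= quad_cost h &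
  forall h, K h -> quad_cost h <= quad_cost g -> B (g - h) (g - h) = 0].
Proof.
have Dl := form_lin_closed DB.
pose A : set R := [set quad_cost g | g in K].
have hA : has_inf A.
  split; first by have [g Kg] := K0; exists (quad_cost g), g.
  by exists 0 => _ [g Kg <-]; exact: quad_cost_ge0.
have infle g : K g -> inf A <= quad_cost g.
  by move=> Kg; apply: ge_inf; [exact: hA.2|exists g].
have a8 : 0 < alpha / 8 by rewrite divr_gt0.
(* The tolerance is matched to the midpoint inequality: half the sum of two consecutive tolerances
   is at most [alpha / 8 * 16^-1 ^+ N], which leaves exactly the step size that [complete]
   accepts. *)
have /choice[g gP] N : exists g, K g /\ quad_cost g < inf A + alpha / 8 * 16^-1 ^+ N.
  have eN : 0 < alpha / 8 * 16^-1 ^+ N by rewrite mulr_gt0// exprn_gt0.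
  by have [_ [g Kg <-] ?] := inf_adherent eN hA; exists g.
have Kg N : K (g N) by have [] := gP N.
have [||l Dl0 gl] := complete (g := g).
- by move=> N; exact: KD.
- move=> N; have := quad_cost_midpoint (Kg N.+1) (Kg N).
  have := infle _ (Kmid (Kg N.+1) (Kg N)).
  have := (gP N).2; have := (gP N.+1).2; rewrite exprS.
  set b := B _ _; set m := quad_cost (2^-1 *: _); set u := quad_cost (g N).
  set v := quad_cost _; set e := 16^-1 ^+ N.
  have e0 : 0 <= e by rewrite exprn_ge0.
  move=> h1 h2 h3 h4.
  have : alpha / 8 * b <= alpha / 8 * e.
    have : 0 <= alpha / 8 * e by rewrite mulr_ge0// ltW.
    move: h1; rewrite mulrCA => h1; nra.
  by rewrite ler_pM2l.
have Kl : K l by exact: Kclosed Kg Dl0 gl.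
have cl := quad_cost_cvg Kg Kl gl.
have li : quad_cost l <= inf A.
  have cinf : inf A + alpha / 8 * 16^-1 ^+ N @[N --> \oo] --> inf A + alpha / 8 * 0.
    apply: cvgD; first exact: cvg_cst.
    apply: cvgM; first exact: cvg_cst.
    have : geometric (1 : R) 16^-1 @ \oo --> (0 : R).
      by apply: cvg_geometric; rewrite ger0_norm// invf_lt1// ltr1n.
    by rewrite /geometric; under eq_fun do rewrite mul1r.
  rewrite mulr0 addr0 in cinf; apply: (ler_cvg_to cl cinf); apply: nearW => N.
  exact/ltW/(gP N).2.
exists l; split => // [h Kh|h Kh hl]; first exact: le_trans li (infle _ Kh).
(* A competitor as cheap as [l] would make the midpoint cheaper than the infimum unless its distance
   to [l] is zero. *)
have := quad_cost_midpoint Kl Kh; have := infle _ (Kmid Kl Kh).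
have Blh := form_ge0 DB (lin_closedB Dl Dl0 (KD Kh)).
move=> h1 h2; apply/eqP; rewrite eq_le Blh andbT.
have : alpha / 8 * B (l - h) (l - h) <= 0 by lra.
by rewrite pmulr_rle0.
Qed.

End Minimizer.

(** * Vectors of signals *)

Section SignalSpace.
Variables (R : realType) (T : R) (k : nat).
Local Notation leb := (@lebesgue_measure R).

Definition signals : set ('I_k -> R -> R) := [set g | forall j, signal T (g j)].

Definition signal_form (g h : 'I_k -> R -> R) : R := \sum_(j < k) ip leb (g j) (h j).

Lemma semi_inner_signal_form : semi_inner signals signal_form.
Proof.
have [s0 sl] := @signal_lin_closed _ T.
split=> [|g h gs hs|a f g h fs gs hs|f fs].
- by split=> [j|a u v us vs j]; [exact: s0|exact: (sl a (u j) (v j))].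
- by apply: eq_bigr => j _; exact: L2_mulC.
- rewrite /signal_form mulr_sumr -big_split/=; apply: eq_bigr => j _.
  exact: (formDZl (semi_inner_L2 leb) a (fs j).1 (gs j).1 (hs j).1).
- by apply: sumr_ge0 => j _; exact: (form_ge0 (semi_inner_L2 leb) (fs j).1).
Qed.

Lemma le_signal_form g j : signals g -> ip leb (g j) (g j) <= signal_form g g.
Proof.
move=> gs; rewrite /signal_form (bigD1 j)//= lerDl; apply: sumr_ge0 => i _.
exact: (form_ge0 (semi_inner_L2 leb) (gs i).1).
Qed.

Lemma signal_complete (g : nat -> 'I_k -> R -> R) : (forall N, signals (g N)) ->
  (forall N, signal_form (g N.+1 - g N) (g N.+1 - g N) <= 16^-1 ^+ N) ->
  exists2 l, signals l & signal_form (g N - l) (g N - l) @[N --> \oo] --> (0 : R).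
Proof.
move=> gs gC; have Sl := form_lin_closed semi_inner_signal_form.
have /choice[l hl] j : exists l, [/\ L2 leb l,
    ip leb (g N j - l) (g N j - l) @[N --> \oo] --> (0 : R) &
    forall t, (forall N, g N j t = 0) -> l t = 0].
  apply: L2_complete => N; first exact: (gs N j).1.
  by apply: le_trans (gC N); exact: (le_signal_form j (lin_closedB Sl (gs _) (gs _))).
exists l.
  by move=> j; have [l2 _ l0] := hl j; split=> // t tT; apply: l0 => N; exact: (gs N j).2.
have -> : 0 = \sum_(j < k) (0 : R) by rewrite big1.
by apply: cvg_sumr => j; have [_ + _] := hl j.
Qed.

Lemma prim_signal_bound (g : 'I_k -> R -> R) t : signals g -> 0 <= t <= T ->
  sumsq (fun j => prim (g j) t) <= T * signal_form g g.
Proof.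
move=> gs tT; rewrite /signal_form mulr_sumr; apply: ler_sum => j _.
exact: prim_sqr_le (gs j).1.
Qed.

Lemma prim_signal_lin (a : R) (g h : 'I_k -> R -> R) t : signals g -> signals h ->
  (fun j => prim ((a *: g + h) j) t) = a *: (fun j => prim (g j) t) + (fun j => prim (h j) t).
Proof.
by move=> gs hs; apply/funext => j; exact: (primDZ a t (gs j).1 (hs j).1).
Qed.

(** Passes from equality at almost every time to equality of the primitives at every time, the form
    in which uniqueness of the control is claimed. *)
Lemma signal_form_eq0_prim (g h : 'I_k -> R -> R) : signals g -> signals h ->
  signal_form (g - h) (g - h) = 0 ->
  forall t, 0 <= t <= T -> (fun j => prim (g j) t) = (fun j => prim (h j) t).
Proof.
move=> gs hs gh0 t tT; have Sl := form_lin_closed semi_inner_signal_form.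
have := prim_signal_bound (lin_closedB Sl gs hs) tT; rewrite gh0 mulr0 => h0.
have /sumsq_eq0 z : sumsq (fun j => prim ((g - h) j) t) = 0.
  by apply/eqP; rewrite eq_le h0 sumsq_ge0.
apply/funext => j; apply/eqP; rewrite -subr_eq0 -(z j).
by rewrite !primE -(formBl (semi_inner_L2 leb) (gs j).1 (hs j).1 (L2_itv _ _)).
Qed.

End SignalSpace.

(** * Piecewise constant controls *)

Section BoundarySpace.
Variables (R : realType) (d : nat) (Omega : set 'rV[R]_d).
Local Notation V := 'rV[R]_d.
Local Notation sigma := (surface Omega).
Local Notation DB := (semi_inner_L2 sigma).
Variables (m : nat) (cell : 'I_m -> set V) (hcell : boundary_mesh Omega cell).

Definition mesh_space : set (V -> R) := P0 Omega cell `&` L20 Omega.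

(** For a general [Omega] a cell may have infinite area; its indicator is then not square integrable
    and is replaced by zero. *)
Definition finite_cell (l : 'I_m) : V -> R :=
  if (sigma (cell l) < +oo)%E then \1_(cell l) else 0.

Lemma finite_cell_L2 l : L2 sigma (finite_cell l).
Proof.
have [mc _ _] := hcell; rewrite /finite_cell; case: ifPn => [fc|_].
  exact: L2_indic (mc l) fc.
exact: (L2_lin_closed sigma).1.
Qed.

Lemma L20_L2 : L20 Omega `<=` L2 sigma. Proof. by move=> v []. Qed.

(* A square integrable piecewise constant function vanishes on the cells of
   infinite area. *)
Lemma P0_finite_cells v : L2 sigma v -> P0 Omega cell v ->
  exists c : 'I_m -> R, v = \sum_(l < m) c l *: finite_cell l %[ae sigma].
Proof.
move=> v2 [c vc]; have [mc tc _] := hcell; exists c.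
have c0 l : ~~ (sigma (cell l) < +oo)%E -> c l = 0.
  move=> foo; apply/eqP/negPn/negP => cl0; move/negP: foo; apply.
  apply: (L2_constant_on v2 (mc l) _ cl0).
  apply: aeS vc => x /(_ I) -> xl.
  rewrite (bigD1 l)//= indicE mem_set// mulr1 big1 ?addr0// => i il.
  rewrite indicE memNset ?mulr0// => xi; move/eqP: il; apply.
  by apply: tc => //; exists x.
apply: aeS vc => x /(_ I) -> _; rewrite fct_sumE; apply: eq_bigr => l _.
transitivity (c l * finite_cell l x); last by [].
rewrite /finite_cell; case: ifPn => // /c0 ->.
by rewrite !mul0r.
Qed.

(** Each [finite_cell l] equals its own square, so the integral is a sum of L2 products. This
    supplies additivity, which square integrability alone does not give on a space of infinite
    measure. *)
Lemma integral_finite_cells (c : 'I_m -> R) :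
  \int[sigma]_x (\sum_(l < m) c l *: finite_cell l) x =
  \sum_(l < m) c l * ip sigma (finite_cell l) (finite_cell l).
Proof.
have b2 := finite_cell_L2.
have cb2 l : L2 sigma (c l *: finite_cell l) by exact: (lin_closedZ _ (L2_lin_closed sigma)).
transitivity (\sum_(l < m) ip sigma (c l *: finite_cell l) (finite_cell l)); last first.
  by apply: eq_bigr => l _; rewrite (formZl DB _ (b2 l) (b2 l)).
have [<- _] := ip_sum (index_enum 'I_m) cb2 b2.
apply: eq_Rintegral => x _; rewrite fct_sumE; apply: eq_bigr => l _.
transitivity (c l * finite_cell l x); first by [].
transitivity (c l * finite_cell l x * finite_cell l x); last by [].
rewrite -mulrA; congr (_ * _); rewrite /finite_cell; case: ifPn => _; last by rewrite mulr0.
by rewrite indicE; case: (_ \in _); rewrite ?mulr1 ?mulr0.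
Qed.

(** The zero-mean condition is the delicate one, since the integral need not be additive on L2.
    Piecewise constant members are first rewritten as combinations of finite cells, where it is. *)
Lemma mesh_space_lin_closed : lin_closed mesh_space.
Proof.
have Ll := L2_lin_closed sigma.
have sL c : L2 sigma (\sum_(l < m) c l *: finite_cell l) by exact: lin_closed_sum Ll finite_cell_L2.
split.
  split; first by exists (fun=> 0); apply: aeW => x _; rewrite big1// => l _; rewrite mul0r.
  split; first exact: Ll.1.
  rewrite (@eq_Rintegral _ _ _ _ _ (fun=> 0)); last by [].
  by rewrite /Rintegral integral0.
move=> a u v [uP [u2 u0]] [vP [v2 v0]]; have auv := Ll.2 a _ _ u2 v2.
split.
  have [c hc] := uP; have [c' hc'] := vP; exists (fun l => a * c l + c' l).
  apply: aeS2 hc hc' => x /(_ I) h /(_ I) h' _.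
  transitivity (a * u x + v x); first by [].
  rewrite h h' mulr_sumr -big_split/=; apply: eq_bigr => l _.
  by rewrite mulrDl mulrA.
split => //.
have [c hc] := P0_finite_cells u2 uP; have [c' hc'] := P0_finite_cells v2 vP.
have E : a *: u + v = \sum_(l < m) (a * c l + c' l) *: finite_cell l %[ae sigma].
  apply: aeS2 hc hc' => x /(_ I) h /(_ I) h' _.
  transitivity (a * u x + v x); first by [].
  rewrite h h' !fct_sumE mulr_sumr -big_split/=; apply: eq_bigr => l _.
  transitivity (a * (c l * finite_cell l x) + c' l * finite_cell l x); first by [].
  transitivity ((a * c l + c' l) * finite_cell l x); last by [].
  by rewrite mulrDl mulrA.
rewrite (ae_eq_Rintegral (L2_measurable auv) (L2_measurable (sL _)) E).
rewrite integral_finite_cells.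
rewrite (ae_eq_Rintegral (L2_measurable u2) (L2_measurable (sL c)) hc) in u0.
rewrite (ae_eq_Rintegral (L2_measurable v2) (L2_measurable (sL c')) hc') in v0.
rewrite !integral_finite_cells in u0 v0.
transitivity (a * \sum_(l < m) c l * ip sigma (finite_cell l) (finite_cell l) +
   \sum_(l < m) c' l * ip sigma (finite_cell l) (finite_cell l)).
  by rewrite mulr_sumr -big_split/=; apply: eq_bigr => l _; ring.
by rewrite u0 v0 mulr0 addr0.
Qed.

Lemma mesh_basis : exists (k : nat) (e : 'I_k -> V -> R),
  [/\ forall j, mesh_space (e j),
      forall i j, ip sigma (e i) (e j) = (i == j)%:R &
      forall v, mesh_space v ->
        v = \sum_(j < k) ip sigma v (e j) *: e j %[ae sigma]].
Proof.
have Ll := L2_lin_closed sigma.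
have XD : mesh_space `<=` L2 sigma by move=> v [_ []].
have [||k [e [Xe eo Xs]]] := orthonormal_basis DB (b := finite_cell) mesh_space_lin_closed XD.
- exact: finite_cell_L2.
- move=> v [vP [v2 _]]; have [c hc] := P0_finite_cells v2 vP; exists c => /=.
  apply: ip_ae0.
    by apply: (lin_closedB Ll v2); exact: lin_closed_sum Ll finite_cell_L2.
  apply: aeS hc => x /(_ I) h _.
  transitivity (v x - (\sum_(l < m) c l *: finite_cell l) x); first by [].
  by rewrite h subrr.
exists k, e; split => // v vX; have r0 := Xs v vX.
have r2 : L2 sigma (v - \sum_(j < k) ip sigma v (e j) *: e j).
  by apply: (lin_closedB Ll (XD _ vX)); apply: lin_closed_sum Ll _ => j; exact/XD/Xe.
apply: aeS (ip_eq0 r2 r0) => x /(_ I) h _; apply/eqP; rewrite -subr_eq0; apply/eqP.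
exact: h.
Qed.

End BoundarySpace.

(** * The control problem *)

Section TimeContinuity.
Variables (R : realType) (T : R).
Hypothesis T0 : 0 <= T.
Local Notation leb := (@lebesgue_measure R).

Definition continuous_on (f : R -> R) :=
  forall t, 0 <= t <= T -> f s @[s --> within `[0, T] (nbhs t)] --> f t.

Lemma continuous_on_integrable f : continuous_on f ->
  leb.-integrable `[0, T] (EFin \o f).
Proof.
move=> cf; apply: continuous_compact_integrable; first exact: segment_compact.
by apply/subspace_continuousP => t; rewrite /= in_itv/=; exact: cf.
Qed.

Lemma continuous_onB f g : continuous_on f -> continuous_on g ->
  continuous_on (fun t => f t - g t).
Proof. by move=> cf cg t tT; apply: cvgB; [exact: cf|exact: cg]. Qed.

Lemma continuous_on_sqr f : continuous_on f -> continuous_on (fun t => f t ^+ 2).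
Proof.
move=> cf t tT; rewrite expr2; under eq_fun do rewrite expr2.
by apply: cvgM; exact: cf.
Qed.

Lemma continuous_on_sumsq n (f : 'I_n -> R -> R) : (forall i, continuous_on (f i)) ->
  continuous_on (fun t => sumsq (f ^~ t)).
Proof. by move=> cf t tT; apply: cvg_sumr => i; exact: continuous_on_sqr. Qed.

Definition cutoff (f : R -> R) (t : R) : R := \1_(`[0, T]%classic) t * f t.

Lemma cutoffE f t : 0 <= t <= T -> cutoff f t = f t.
Proof. by move=> tT; rewrite /cutoff indic_in// mul1r. Qed.

Lemma continuous_on_signal f : continuous_on f -> signal T (cutoff f).
Proof.
move=> cf; split; last by move=> t tT; rewrite /cutoff indic_out// mul0r.
have mi := measurable_itv `[0, T] : measurable (`[0, T]%classic : set (measurableTypeR R)).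
have mc : measurable_fun setT (cutoff f).
  have /integrableP[/measurable_EFinP + _] := continuous_on_integrable cf.
  move/(measurable_restrictT _ (measurable_itv _)).1; apply: eq_measurable_fun => t _.
  by rewrite patchE /cutoff indicE; case: ifPn => _; rewrite ?mul1r ?mul0r.
apply: L2_intro => //.
have /integrable_lty := continuous_on_integrable (continuous_on_sqr cf).
move=> /(_ (measurable_itv _)); apply: le_lt_trans; rewrite [leRHS]integral_mkcond.
rewrite le_eqVlt; apply/orP; left; apply/eqP; apply: eq_integral => t _.
by rewrite patchE /cutoff indicE; case: ifPn => _; rewrite ?mul1r ?mul0r ?expr0n.
Qed.

Lemma signal_ip_le f Z : signal T f -> (forall t, 0 <= t <= T -> f t ^+ 2 <= Z) ->
  ip leb f f <= T * Z.
Proof.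
move=> fs fZ; rewrite (signal_ip fs).
have cZ : continuous_on (fun=> Z) by move=> t _; exact: cvg_cst.
apply: (@le_trans _ _ (\int[leb]_(t in `[0, T]) Z)).
  apply: le_Rintegral => //.
  - apply: (integrableS measurableT) => //; have := Lfun2_integrable_sqr fs.1; exact.
  - exact: continuous_on_integrable cZ.
rewrite Rintegral_cst; last exact: measurable_itv.
rewrite mulrC ler_wpM2r//.
  by apply: le_trans (fZ 0 _); rewrite ?sqr_ge0// lexx.
rewrite [X in fine X]lebesgue_measure_itv/= lte_fin.
by case: ifPn => //= _; rewrite ?sube0 ?subr0.
Qed.

Lemma signal_form_integral n (f : 'I_n -> R -> R) : signals T f ->
  signal_form f f = \int[leb]_(t in `[0, T]) sumsq (f ^~ t) /\
  leb.-integrable `[0, T] (EFin \o (fun t => sumsq (f ^~ t))).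
Proof.
move=> fs; have [E I] := ip_sum (index_enum 'I_n) (fun i => (fs i).1) (fun i => (fs i).1).
have sE t : \sum_(i < n) f i t * f i t = sumsq (f ^~ t).
  by apply: eq_bigr => i _; rewrite expr2.
split.
  rewrite /signal_form -E [RHS]Rintegral_mkcond; apply: eq_Rintegral => t _.
  rewrite sE patchE; case: ifPn => // /negP tT; rewrite /sumsq big1// => i _.
  by rewrite (fs i).2 ?expr0n// => tT'; apply: tT; rewrite inE.
have : leb.-integrable `[0, T] (EFin \o (fun t => \sum_(i < n) f i t * f i t)).
  exact: (integrableS measurableT) I.
by apply: eq_integrable => // t _; rewrite /= sE.
Qed.

End TimeContinuity.

Section ControlProblem.
Variables (R : realType) (d : nat) (Omega : set 'rV[R]_d).
Local Notation V := 'rV[R]_d.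
Local Notation sigma := (surface Omega).
Local Notation leb := (@lebesgue_measure R).
Variables (T : R) (T_gt0 : 0 < T).
Variables (C : tensor4 R d) (E : tensor3 R d) (K : tensor2 R d).
Variables (rho : V -> R) (hrho : admissible_density Omega rho).
Variables (gamma : jet R d -> V -> R) (hgamma : trace_operator Omega gamma).
Variable G : jet R d -> R.
Variables (GammaD : set V) (Vh : set (vjet R d))
  (hVh : finite_dim_subspace (vjet_ae_eq Omega) (H1D Omega gamma GammaD) Vh).
Variable Wh : set (jet R d).
Variables (Sh : (R -> V -> R) -> R -> vjet R d)
  (hSh : solution_operator Omega C E K rho gamma G Vh Wh T Sh).
Variables (m : nat) (cell : 'I_m -> set V) (hcell : boundary_mesh Omega cell).
Variables (za zb : R) (hza : za <= 0) (hzb : 0 <= zb).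
Variables (ud : R -> vjet R d)
  (hud : forall t, 0 <= t <= T -> H1D Omega gamma GammaD (ud t))
  (hud_cont : continuous_in_time T (vh1norm Omega) ud).
Variables (alpha : R) (alpha_gt0 : 0 < alpha).
Local Notation MB := (semi_inner_mass hrho).
Local Notation mass := (mass Omega rho).
Local Notation Zadh := (Zadh Omega T cell za zb).
Local Notation X := (L20 Omega).

Let T0 : 0 <= T. Proof. exact: ltW. Qed.

Variables (n : nat) (w : 'I_n -> vjet R d).
Hypotheses (wV : forall j, lspan Vh (w j))
  (wspan : forall v, lspan Vh v ->
        let r := v - \sum_(j < n) mass v (w j) *: w j in mass r r = 0).
Variables (k : nat) (e : 'I_k -> V -> R).
Hypotheses (eX : forall j, mesh_space Omega cell (e j))
  (eo : forall i j, ip sigma (e i) (e j) = (i == j)%:R)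
  (espan : forall v, mesh_space Omega cell v ->
        v = \sum_(j < k) ip sigma v (e j) *: e j %[ae sigma]).
Local Notation coords := (coords Omega rho w).
Local Notation trajectory :=
  (trajectory Omega C E K rho gamma G Vh Wh w e T).
Local Notation curve := (signal_curve e).

Let w2 j : L2vjet Omega (w j). Proof. exact: (span_Vh_L2 hVh (wV j)). Qed.
Let ml := mesh_space_lin_closed hcell.
Let mX : mesh_space Omega cell `<=` X. Proof. by move=> v []. Qed.
Let e2 j : L2 sigma (e j). Proof. exact: (L20_L2 (mX (eX j))). Qed.

Definition admissible (g : 'I_k -> R -> R) : Prop :=
  signals T g /\
  forall t, 0 <= t <= T -> {ae sigma, forall x, za <= curve g t x <= zb}.

Lemma curve_mesh_space g t : mesh_space Omega cell (curve g t).
Proof. exact: lin_closed_sum ml eX. Qed.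

Lemma curve_Zadh g : admissible g -> Zadh (curve g).
Proof.
move=> [gs gb].
have Zg : Zspace Omega T (curve g).
  split; last first.
    apply: aeW => x _; rewrite /signal_curve /comb big1// => j _.
    by rewrite prim0 scale0r.
  exists (signal_deriv e g).
  exact: (signal_curve_weak_derivative (mu := sigma) (@L20_L2 _ _ Omega) ml mX eX eo gs).
by split; split=> // t tT; have [] := curve_mesh_space g t.
Qed.

Lemma Zadh_mesh_space z t : Zadh z -> 0 <= t <= T -> mesh_space Omega cell (z t).
Proof. by move=> [[[[dz [Xz _ _]] _] zP] _] tT; split; [exact: zP|exact: Xz]. Qed.

Lemma Zadh_signal z : Zadh z ->
  exists g, admissible g /\ forall t, 0 <= t <= T -> z t = curve g t %[ae sigma].
Proof.
move=> Zz; have zm t : 0 <= t <= T -> mesh_space Omega cell (z t) by exact: Zadh_mesh_space.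
have [[[[dz dzP] z0] _] [_ zb']] := Zz.
have zc t : 0 <= t <= T -> z t = comb e (fun j => ip sigma (z t) (e j)) %[ae sigma].
  by move=> tT; exact: (espan (zm t tT)).
have [gs zg] := weak_derivative_signal (mu := sigma) (@L20_L2 _ _ Omega) mX eX dzP z0 zc T0.
eexists; split; last exact: zg.
split; first exact: gs.
by move=> t tT; apply: aeS2 (zg t tT) (zb' t tT) => x /(_ I) ->.
Qed.

(** [z] need only agree with the curve almost everywhere: [Sh] may treat the two differently, but
    both responses are trajectories for the same load, so [trajectory_unique] identifies their
    coordinates. *)
Lemma curve_trajectory z g : Zadh z ->
  (forall t, 0 <= t <= T -> z t = curve g t %[ae sigma]) ->
  trajectory (fun t j => prim (g j) t) (fun i t => coords (Sh z t) i).
Proof.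
move=> Zz zg; have [psi sol] := hSh Zz.1.1.
apply: (solution_trajectory hrho hgamma hVh wV e2 T0 sol) => //.
by move=> t tT; exact/L20_L2/mX/Zadh_mesh_space.
Qed.

Lemma Sh_span z t : Zadh z -> 0 <= t <= T -> lspan Vh (Sh z t).
Proof.
move=> Zz tT; have [psi [du [ddu [uV _ _ _ _]]]] := hSh Zz.1.1.
by apply: sub_lspan; have [] := uV t tT.
Qed.

Lemma trajectory_continuous zeta y i : trajectory zeta y -> continuous_on T (y i).
Proof. by move=> [dy [ddy [h _ _ _ _]]] t tT; exact: diff_on_cvg (h i) tT. Qed.

Lemma ud_L2 t : 0 <= t <= T -> L2vjet Omega (ud t).
Proof. by move=> tT i; apply: H1_L2jet; have [] := hud tT i. Qed.

Let near_T (t : R) : \forall s \near within `[0, T] (nbhs t), 0 <= s <= T.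
Proof. by apply/within_near_le; exists 1. Qed.

Let near_ud (t : R) : \forall s \near within `[0, T] (nbhs t), L2vjet Omega (ud s).
Proof. by apply: filterS (near_T t) => s; exact: ud_L2. Qed.

Lemma ud_mass_cvg t : 0 <= t <= T ->
  mass (ud s - ud t) (ud s - ud t) @[s --> within `[0, T] (nbhs t)] --> 0.
Proof.
move=> tT; have FF : Filter (within `[0, T] (nbhs t)) by exact: within_filter.
apply: (mass_cvg0 hrho FF); last exact: hud_cont.
apply: filterS (near_ud t) => s us.
exact: lin_closedB (L2vjet_lin_closed Omega) us (ud_L2 tT).
Qed.

Lemma ud_coords_continuous i : continuous_on T (fun t => coords (ud t) i).
Proof.
move=> t tT; have FF : Filter (within `[0, T] (nbhs t)) by exact: within_filter.
exact: (form_cvg MB FF (near_ud t) (ud_L2 tT) (w2 i) (ud_mass_cvg tT)).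
Qed.

(* Pythagoras: what is left of |ud|^2 after projection onto Vh. *)
Definition ud_rest (t : R) : R := mass (ud t) (ud t) - sumsq (coords (ud t)).

Lemma ud_rest_continuous : continuous_on T ud_rest.
Proof.
apply: continuous_onB.
  move=> t tT; have FF : Filter (within `[0, T] (nbhs t)) by exact: within_filter.
  exact: (form_cvg_sq MB FF (near_ud t) (ud_L2 tT) (ud_mass_cvg tT)).
exact: (continuous_on_sumsq (f := fun i t => coords (ud t) i) ud_coords_continuous).
Qed.

(** Affine rather than linear in [g], because of [ud]; hence the minimization argument works with
    midpoints. *)
Definition misfit (g : 'I_k -> R -> R) (i : 'I_n) : R -> R :=
  cutoff T (fun t => coords (Sh (curve g) t) i - coords (ud t) i).

Let curve_traj g : admissible g ->
  trajectory (fun t j => prim (g j) t) (fun i t => coords (Sh (curve g) t) i).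
Proof.
move=> ag; apply: curve_trajectory; first exact: curve_Zadh.
by move=> t tT; exact: aeW.
Qed.

Lemma misfitE g i t : 0 <= t <= T ->
  misfit g i t = coords (Sh (curve g) t) i - coords (ud t) i.
Proof. exact: cutoffE. Qed.

Lemma misfit_out g i t : ~ (0 <= t <= T) -> misfit g i t = 0.
Proof.
by move=> tT; rewrite /misfit /cutoff indic_out ?mul0r//= in_itv.
Qed.

Lemma misfit_signals g : admissible g -> signals T (misfit g).
Proof.
move=> ag i; apply: continuous_on_signal; apply: continuous_onB.
  exact: trajectory_continuous (curve_traj ag).
exact: ud_coords_continuous.
Qed.

Variable C1 : R.
Hypothesis hC1 : forall a b zeta1 zeta2 zeta3 y1 y2 y3,
    trajectory zeta1 y1 -> trajectory zeta2 y2 -> trajectory zeta3 y3 ->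
    forall Z, 0 <= Z ->
    (forall t, 0 <= t <= T -> sumsq (a *: zeta1 t + (b *: zeta2 t + zeta3 t)) <= Z) ->
    forall t, 0 <= t <= T ->
      sumsq (fun i => a * y1 i t + (b * y2 i t + y3 i t)) <= C1 * Z.

Lemma trajectory_unique zeta y y' : trajectory zeta y -> trajectory zeta y' ->
  forall t, 0 <= t <= T -> forall i, y i t = y' i t.
Proof.
move=> hy hy' t tT i.
(* The combination [- y' + y] has zero load; the coefficient 0 merely fills the third slot. *)
have := @hC1 (-1) 0 _ _ _ _ _ _ hy' hy' hy _ (lexx 0) _ t tT; rewrite mulr0 => H.
have /sumsq_eq0/(_ i) : sumsq (fun i => -1 * y' i t + (0 * y' i t + y i t)) = 0.
  apply/eqP; rewrite eq_le sumsq_ge0 andbT; apply: H => s sT.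
  rewrite scale0r add0r scaleN1r addNr /sumsq big1// => j _.
  by rewrite -[X in X ^+ 2]/(0 : R) expr0n.
by rewrite mul0r add0r mulN1r addrC => /eqP; rewrite subr_eq0 => /eqP.
Qed.

Let Sl := form_lin_closed (semi_inner_signal_form T k).

(** Origin of the constant: the load difference is at most [T] times the squared distance of the
    signals, the response multiplies this by [C1], integration in time gives another [T], and
    bounding each coordinate by the whole sum gives [n]. *)
Lemma misfit_lipschitz g h : admissible g -> admissible h ->
  signal_form (misfit g - misfit h) (misfit g - misfit h) <=
  n%:R * (T * (C1 * T)) * signal_form (g - h) (g - h).
Proof.
move=> ag ah; have gs := ag.1; have hs := ah.1.
have ghs := lin_closedB Sl gs hs.
have Sl' := form_lin_closed (semi_inner_signal_form T n).
have ms := lin_closedB Sl' (misfit_signals ag) (misfit_signals ah).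
set Q := signal_form (g - h) (g - h).
have Q0 : 0 <= Q by exact: (form_ge0 (semi_inner_signal_form T k) ghs).
have TQ0 : 0 <= T * Q by rewrite mulr_ge0.
have bnd t : 0 <= t <= T -> sumsq ((misfit g - misfit h) ^~ t) <= C1 * (T * Q).
  move=> tT; have := @hC1 (-1) 0 _ _ _ _ _ _
    (curve_traj ah) (curve_traj ah) (curve_traj ag) _ TQ0 _ t tT.
  have -> : sumsq (fun i => -1 * coords (Sh (curve h) t) i + (0 * coords (Sh (curve h) t) i +
      coords (Sh (curve g) t) i)) = sumsq ((misfit g - misfit h) ^~ t).
    congr sumsq; apply/funext => i.
    transitivity (misfit g i t - misfit h i t); last by [].
    rewrite (misfitE g i tT) (misfitE h i tT).
    set p := coords _ i; set q := coords _ i; set v := coords _ i.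
    by move: p q v => p q v; ring.
  apply => s sT; apply: le_trans (prim_signal_bound ghs sT).
  rewrite le_eqVlt; apply/orP; left; apply/eqP; congr sumsq.
  have := prim_signal_lin (-1) s hs gs; rewrite scale0r add0r scaleN1r => <-.
  by rewrite addrC.
rewrite /signal_form -mulrA mulr_natl -[in leRHS](card_ord n) -sumr_const.
apply: ler_sum => i _.
have -> : T * (C1 * T) * Q = T * (C1 * (T * Q)) by ring.
apply: (signal_ip_le T0 (ms i)) => t tT.
exact: le_trans (le_sumsq ((misfit g - misfit h) ^~ t) i) (bnd t tT).
Qed.

Lemma curve_lin a g h t : signals T g -> signals T h ->
  curve (a *: g + h) t = a *: curve g t + curve h t.
Proof.
move=> gs hs; rewrite /signal_curve (prim_signal_lin a t gs hs) /comb scaler_sumr -big_split/=.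
by apply: eq_bigr => j _; rewrite scalerA -scalerDl.
Qed.

Lemma admissible_midpoint g h : admissible g -> admissible h ->
  admissible (2^-1 *: (g + h)).
Proof.
move=> [gs gb] [hs hb]; have ghs := lin_closedD Sl gs hs.
split; first exact: lin_closedZ Sl ghs.
move=> t tT; apply: aeS2 (gb t tT) (hb t tT) => x /andP[g1 g2] /andP[h1 h2].
have h0 := Sl.1; have -> : curve (2^-1 *: (g + h)) t x = 2^-1 * (curve g t x + curve h t x).
  rewrite scalerDr curve_lin//; last exact: lin_closedZ Sl hs.
  rewrite -[2^-1 *: h]addr0 curve_lin//.
  transitivity (2^-1 * curve g t x + (2^-1 * curve h t x + curve 0 t x)); first by [].
  have -> : curve 0 t x = 0.
    rewrite /signal_curve /comb fct_sumE big1// => j _.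
    transitivity (prim (0 : R -> R) t * e j x); first by [].
    by rewrite primE (form0l (semi_inner_L2 leb) (L2_itv _ _)) mul0r.
  by rewrite addr0 mulrDr.
by apply/andP; split; lra.
Qed.

Lemma misfit_midpoint g h : admissible g -> admissible h ->
  let r := misfit (2^-1 *: (g + h)) - 2^-1 *: (misfit g + misfit h) in
  signal_form r r = 0.
Proof.
move=> ag ah /=; have gs := ag.1; have hs := ah.1.
have am := admissible_midpoint ag ah.
suff -> : misfit (2^-1 *: (g + h)) - 2^-1 *: (misfit g + misfit h) = 0.
  have SB := semi_inner_signal_form T n.
  exact: (form0l SB (form_lin_closed SB).1).
apply/funext => i; apply/funext => t.
transitivity (misfit (2^-1 *: (g + h)) i t - 2^-1 * (misfit g i t + misfit h i t)); first by [].
have [tT|tT] := pselect (0 <= t <= T); last first.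
  by rewrite !(misfit_out _ _ tT) addr0 mulr0 subrr.
rewrite !(misfitE _ _ tT).
(* The loads of the midpoint and of the two halves cancel, so the combination of the states
   vanishes. The [ud] terms cancel as well, because the weights of a midpoint add up to one. *)
have := @hC1 (- 2^-1) (- 2^-1) _ _ _ _ _ _
  (curve_traj ag) (curve_traj ah) (curve_traj am) _ (lexx 0) _ t tT.
rewrite mulr0 => H.
have /sumsq_eq0/(_ i) : sumsq (fun i => - 2^-1 * coords (Sh (curve g) t) i +
    (- 2^-1 * coords (Sh (curve h) t) i + coords (Sh (curve (2^-1 *: (g + h))) t) i)) = 0.
  apply/eqP; rewrite eq_le sumsq_ge0 andbT; apply: H => s sT.
  have h2 := lin_closedZ 2^-1 Sl hs.
  rewrite (_ : _ + _ = 0).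
    by rewrite /sumsq big1// => j _; rewrite -[X in X ^+ 2]/(0 : R) expr0n.
  apply/funext => j; rewrite scalerDr.
  transitivity (- 2^-1 * prim (g j) s + (- 2^-1 * prim (h j) s + prim (2^-1 *: g j + 2^-1 *: h j) s)).
    by [].
  rewrite (primDZ 2^-1 s (gs j).1 (h2 j).1).
  have := primDZ 2^-1 s (hs j).1 (L2_lin_closed leb).1; rewrite addr0 => ->.
  rewrite [prim 0 s]primE (form0l (semi_inner_L2 leb) (L2_itv _ _)).
  by rewrite -[RHS]/(0 : R); ring.
set p := coords _ i; set q := coords _ i; set r := coords _ i; set v := coords _ i.
by move: p q r v => p q r v h0; rewrite -[RHS]/(0 : R); lra.
Qed.

(** At a fixed time the coefficients converge as numbers, so the curves converge at every boundary
    point and no subsequence is extracted. The bounds pass to the limit off a countable union of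
    null sets. *)
Lemma admissible_closed (g : nat -> 'I_k -> R -> R) l : (forall N, admissible (g N)) ->
  signals T l -> signal_form (g N - l) (g N - l) @[N --> \oo] --> (0 : R) ->
  admissible l.
Proof.
move=> ag ls gl; split => // t tT.
have pc j : prim (g N j) t @[N --> \oo] --> prim (l j) t.
  apply: cvg_of_sub0; apply: sqr_cvg0.
  apply: (@squeeze_cvgr _ _ _ _ (fun=> 0) (fun N => T * signal_form (g N - l) (g N - l))).
  - apply: nearW => N; rewrite sqr_ge0/=.
    have gls := lin_closedB Sl (ag N).1 ls.
    apply: le_trans (prim_signal_bound gls tT).
    apply: le_trans (le_sumsq _ j); rewrite le_eqVlt; apply/orP; left; apply/eqP.
    congr (_ ^+ 2); rewrite !primE.
    by rewrite -(formBl (semi_inner_L2 leb) ((ag N).1 j).1 (ls j).1 (L2_itv _ _)).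
  - exact: cvg_cst.
  - by rewrite -(mulr0 T); apply: cvgM => //; exact: cvg_cst.
have cc x : curve (g N) t x @[N --> \oo] --> curve l t x.
  rewrite /signal_curve /comb fct_sumE; under eq_fun do rewrite fct_sumE.
  by apply: cvg_sumr => j; apply: cvgM; [exact: pc|exact: cvg_cst].
have /ae_foralln : forall N, {ae sigma, forall x, za <= curve (g N) t x <= zb}.
  by move=> N; exact: (ag N).2.
apply: aeS => x hx; apply/andP; split.
- by apply: (cvgr_to_ge (cc x)); apply: nearW => N; have /andP[] := hx N.
- by apply: (cvgr_to_le (cc x)); apply: nearW => N; have /andP[] := hx N.
Qed.

Lemma admissible0 : admissible 0.
Proof.
split; first exact: Sl.1.
move=> t _; apply: aeW => x.
have -> : curve 0 t x = 0; last by rewrite hza hzb.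
rewrite /signal_curve /comb fct_sumE big1// => j _.
transitivity (prim (0 : R -> R) t * e j x); first by [].
by rewrite primE (form0l (semi_inner_L2 leb) (L2_itv _ _)) mul0r.
Qed.

Local Notation cost := (quad_cost (@signal_form R k) (@signal_form R n) misfit alpha).

(** The two functionals differ by a constant independent of the control, so they have the same
    minimizers. *)
Lemma jhE z g : Zadh z -> admissible g ->
  (forall t, 0 <= t <= T -> z t = curve g t %[ae sigma]) ->
  jh Omega rho T Sh ud alpha z =
  cost g + 2^-1 * \int[leb]_(t in `[0, T]) ud_rest t.
Proof.
move=> Zz ag zg; have gs := ag.1.
have [mE mI] := signal_form_integral (misfit_signals ag).
have tr := curve_trajectory Zz zg.
have E1 : \int[leb]_(t in `[0, T]) mass (Sh z t - ud t) (Sh z t - ud t) =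
    signal_form (misfit g) (misfit g) + \int[leb]_(t in `[0, T]) ud_rest t.
  rewrite mE -RintegralD//; last exact: (continuous_on_integrable ud_rest_continuous).
  apply: eq_Rintegral => t; rewrite inE/= in_itv/= => tT.
  rewrite (mass_sub_coords hrho hVh wV wspan (Sh_span Zz tT) (ud_L2 tT)).
  congr (_ + _); congr sumsq; apply/funext => i.
  by rewrite (misfitE g i tT) (trajectory_unique tr (curve_traj ag) tT).
(* [time_weak_deriv] falls back on a default value when no weak derivative exists; membership of [z]
   in [Zspace] rules this out. *)
have dzP : weak_time_derivative T sigma X z (time_weak_deriv T sigma X z).
  by apply: xgetPex; have [[[[dz dzP] _] _] _] := Zz; exists dz.
have E2 : \int[leb]_(t in `[0, T]) \int[sigma]_x (time_weak_deriv T sigma X z t x ^+ 2) =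
    signal_form g g.
  have [gE gI] := signal_form_integral gs; rewrite gE.
  have [_ bdz _] := dzP.
  have ms := bochner_L2_measurable_sq (mu := sigma) (@L20_L2 _ _ Omega) bdz.
  have un := weak_derivative_unique (mu := sigma) (@L20_L2 _ _ Omega) ml mX eX eo T0 dzP gs zg.
  under eq_Rintegral do rewrite -ip_sq.
  congr fine; apply: ae_eq_integral.
  - exact: measurable_itv.
  - exact/measurable_EFinP.
  - exact: (measurable_int leb gI).
  - apply: aeS un => t h; rewrite /= in_itv/= => tT.
    by rewrite h.
rewrite /jh E1 E2 /quad_cost; ring.
Qed.

Lemma control_problem_solution :
  let is_solution (z : R -> V -> R) := Zadh z /\
    forall y, Zadh y ->
      jh Omega rho T Sh ud alpha z <= jh Omega rho T Sh ud alpha y in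
  exists zh, is_solution zh /\
    forall zh', is_solution zh' ->
      forall t, 0 <= t <= T -> zh t = zh' t %[ae sigma].
Proof.
have [g [ag gmin guniq]] := quad_cost_minimizer (semi_inner_signal_form T k)
  (semi_inner_signal_form T n) (@signal_complete R T k)
  (K := admissible) (fun g ag => ag.1) (ex_intro _ _ admissible0) admissible_midpoint
  admissible_closed misfit_signals misfit_midpoint misfit_lipschitz alpha_gt0.
have Zg := curve_Zadh ag.
have gg t : 0 <= t <= T -> curve g t = curve g t %[ae sigma] by move=> _; exact: aeW.
exists (curve g); split.
  split; first exact: Zg.
  move=> y Zy; have [h [ah yh]] := Zadh_signal Zy.
  by rewrite (jhE Zg ag gg) (jhE Zy ah yh) lerD2r gmin.
move=> z [Zz zmin] t tT; have [h [ah zh]] := Zadh_signal Zz.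
have hg : cost h <= cost g.
  by have := zmin _ Zg; rewrite (jhE Zg ag gg) (jhE Zz ah zh) lerD2r.
have := signal_form_eq0_prim ag.1 ah.1 (guniq h ah hg) tT => ph.
apply: aeS (zh t tT) => x /(_ I) -> _.
by rewrite /signal_curve ph.
Qed.

End ControlProblem.

Theorem theorem3p6 (R : realType) (d : nat) (d_gt0 : (0 < d)%N)
  (Omega : set 'rV[R]_d) (hOmega : bounded_lipschitz_domain Omega)
  (GammaD GammaN : set 'rV[R]_d)
  (hGamma : boundary_partition Omega GammaD GammaN)
  (T : R) (T_gt0 : 0 < T)
  (C : tensor4 R d) (E : tensor3 R d) (K : tensor2 R d) (c0 k0 : R)
  (c0_gt0 : 0 < c0) (k0_gt0 : 0 < k0)
  (hcoef : admissible_coefficients Omega C E K c0 k0)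
  (rho : 'rV[R]_d -> R) (hrho : admissible_density Omega rho)
  (gamma : jet R d -> 'rV[R]_d -> R) (hgamma : trace_operator Omega gamma)
  (G : jet R d -> R) (hG : bounded_linear_functional Omega G)
  (hG1 : G (jet_one R d) <> 0)
  (Vh : set (vjet R d))
  (hVh : finite_dim_subspace (vjet_ae_eq Omega) (H1D Omega gamma GammaD) Vh)
  (Wh : set (jet R d))
  (hWh : finite_dim_subspace (jet_ae_eq Omega) (H1 Omega) Wh)
  (hWh1 : Wh (jet_one R d))
  (Sh : (R -> 'rV[R]_d -> R) -> R -> vjet R d)
  (hSh : solution_operator Omega C E K rho gamma G Vh Wh T Sh)
  (m : nat) (cell : 'I_m -> set 'rV[R]_d) (hcell : boundary_mesh Omega cell)
  (za zb : R) (hza : za <= 0) (hzb : 0 <= zb)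
  (ud : R -> vjet R d)
  (hud : forall t, 0 <= t <= T -> H1D Omega gamma GammaD (ud t))
  (hud_cont : continuous_in_time T (vh1norm Omega) ud)
  (hud0 : vjet_ae_eq Omega (ud 0) 0)
  (alpha : R) (alpha_gt0 : 0 < alpha) :
  let is_solution (z : R -> 'rV[R]_d -> R) :=
    Zadh Omega T cell za zb z /\
    forall y, Zadh Omega T cell za zb y ->
      jh Omega rho T Sh ud alpha z <= jh Omega rho T Sh ud alpha y in
  exists zh, is_solution zh /\
    forall zh', is_solution zh' ->
      forall t, 0 <= t <= T -> zh t = zh' t %[ae surface Omega].
Proof.
have T0 : 0 <= T by exact: ltW.
have [n [w [wV wo wspan]]] := mass_basis hrho hVh.
have [k [e [eX eo espan]]] := mesh_basis hcell.
have [C1 _ hC1] := response_bound c0_gt0 k0_gt0 hcoef hrho hgamma hG hVh hWh wV wspan e T0.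
have := control_problem_solution T_gt0 hrho hgamma hVh hSh hcell hza hzb hud hud_cont
  alpha_gt0 wV wspan eX eo espan hC1.
by apply.
Qed.
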